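(* For each prime power $q$ and each integer $N\ge 1$ let $\mathcal{A}=\mathcal{A}_{N,q}$ be a set of monic polynomials of degree $N$ in $\mathbb{F}_q[t]$ with $$|\mathcal{A}|\gg q^N\exp\big(-\tfrac13\sqrt{N\log q}\big).$$ Assume there exists a subset $\mathcal{S}=\mathcal{S}_{N,q}\subset\mathcal{A}$ satisfying $$|\mathcal{S}|=(1+o(1))|\mathcal{A}|\quad\text{as } q^N\to\infty$$ and $$\big|\{(F_1,F_2,G_1,G_2)\in\mathcal{S}^4:\ F_1F_2=G_1G_2\}\big|=(2+o(1))|\mathcal{S}|^2\quad\text{as } q^N\to\infty.$$ If $f$ is a Steinhaus random multiplicative function over $\mathbb{F}_q[t]$, then $$\frac{1}{\sqrt{|\mathcal{A}|}}\sum_{F\in\mathcal{A}}f(F)\xrightarrow{d}\mathcal{CN}(0,1)\quad\text{as } q^N\to\infty.$$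
   Context: $\mathbb{F}_q$ is the finite field with $q$ elements and $\mathcal{M}$ is the set of monic polynomials in $\mathbb{F}_q[t]$. A Steinhaus random multiplicative function over $\mathbb{F}_q[t]$ is the random function $f:\mathcal{M}\to\mathbb{C}$ obtained from independent random variables $(f(P))_P$, indexed by the monic irreducible polynomials $P$ and each uniformly distributed on the complex unit circle, by $f(1)=1$ and $f(F)=f(P_1)^{a_1}\cdots f(P_r)^{a_r}$, where $F=P_1^{a_1}\cdots P_r^{a_r}$ is the factorization of $F$ into powers of distinct monic irreducibles. $\xrightarrow{d}$ is convergence in distribution and $\mathcal{CN}(0,1)$ is the standard complex normal distribution (mean 0, variance 1: real and imaginary parts are independent real normals with mean $0$ and variance $1/2$). The notation $|\mathcal{A}|\gg X$ means $|\mathcal{A}|\ge cX$ for some absolute constant $c>0$. The limit $q^N\to\infty$ is along arbitrary sequences of pairs $(q,N)$ with $q^N\to\infty$ ($q$ and $N$ may vary and depend on each other arbitrarily, e.g. $q$ fixed and $N\to\infty$, or $N$ fixed and $q\to\infty$). *)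

(* Defs.v *)
From HB Require Import structures.
From mathcomp Require Import all_boot all_order all_algebra.
From mathcomp Require Import finmap.
From mathcomp Require Import all_classical all_reals all_analysis.
From mathcomp Require Import complex.
Set Implicit Arguments.
Unset Strict Implicit.
Unset Printing Implicit Defensive.
Import Order.TTheory GRing.Theory Num.Theory.
Import numFieldNormedType.Exports.
Local Open Scope classical_set_scope.
Local Open Scope ring_scope.

Definition prime_power (q : nat) : Prop :=
  exists p k, [/\ prime p, (0 < k)%N & q = (p ^ k)%N].

(* The filter "q ^ N tends to infinity" on pairs (q, N) with q a prime power and
   N >= 1. Convergence along it is convergence along every sequence of such
   pairs with q ^ N tending to infinity. *)
Definition qN_infty : set_system (nat * nat) :=
  filter_from [set: nat] (fun M =>
    [set p : nat * nat |
      [/\ prime_power p.1, (1 <= p.2)%N & (M <= p.1 ^ p.2)%N]]).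

Definition monic_irreducible (K : fieldType) (Q : {poly K}) : Prop :=
  Q \is monic /\ irreducible_poly Q.

Section Probability.
Context {R : realType}.

(* The library has no measurable structure on R[i]; complex random variables are
   measured through their coordinates in R * R, whose measurable sets are the
   Borel sets of the plane. *)
Definition coords (z : R[i]) : R * R := (complex.Re z, complex.Im z).

Lemma two_pi_gt0 : (0 : R) < 2 * pi.
Proof. by rewrite mulr_gt0 // pi_gt0. Qed.

Definition uniform_circle (B : set (R * R)) : \bar R :=
  uniform_prob two_pi_gt0 [set t | B (cos t, sin t)].

(* normal_prob takes the mean and the standard deviation. The product lives on
   measurableTypeR R, the copy of R with its Borel sets on which the library
   defines normal_prob. *)
Definition CN01 : probability (measurableTypeR R * measurableTypeR R)%type R :=
  (normal_prob (0 : R) (Num.sqrt 2^-1) \x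
   normal_prob (0 : R) (Num.sqrt 2^-1))%E.

Section Independence.
Context {d : measure_display} {T : measurableType d} (P : probability T R).

Definition mutually_independent (I : choiceType) (D : set I)
    (X : I -> T -> R[i]) : Prop :=
  forall (J : {fset I}) (B : I -> set (R * R)),
    [set` J] `<=` D ->
    (forall i, i \in J -> measurable (B i)) ->
    P (\bigcap_(i in [set` J]) (coords \o X i) @^-1` B i) =
    (\prod_(i <- J) P ((coords \o X i) @^-1` B i))%E.

(* The values of f on polynomials that are not monic are irrelevant. *)
Record steinhaus (K : fieldType) (f : {poly K} -> T -> R[i]) : Prop := {
  steinhaus_measurable : forall Q, monic_irreducible Q ->
    measurable_fun [set: T] (coords \o f Q);
  steinhaus_uniform : forall Q, monic_irreducible Q ->
    forall B : set (R * R), measurable B ->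
      P ((coords \o f Q) @^-1` B) = uniform_circle B;
  steinhaus_independent :
    mutually_independent [set Q | monic_irreducible Q] f;
  steinhaus_one : forall w, f 1 w = 1;
  steinhaus_factorization :
    forall (s : {fset {poly K}}) (a : {poly K} -> nat) (w : T),
      (forall Q, Q \in s -> monic_irreducible Q) ->
      f (\prod_(Q <- s) Q ^+ a Q) w = \prod_(Q <- s) f Q w ^+ a Q
}.

End Independence.

(* Convergence in distribution of complex random variables, defined on possibly
   varying probability spaces, to a law nu on the plane. *)
Definition cvg_in_distribution (I : Type) (F : set_system I)
    (d : I -> measure_display) (T : forall i, measurableType (d i))
    (P : forall i, probability (T i) R) (X : forall i, T i -> R[i])
    (nu : probability (measurableTypeR R * measurableTypeR R)%type R) : Prop :=
  forall g : R * R -> R, continuous g -> (exists M, forall z, `|g z| <= M) ->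
    (\int[P i]_w (g (coords (X i w)))%:E)%E @[i --> F] -->
    (\int[nu]_z (g z)%:E)%E.

End Probability.

Definition multiplicative_quadruples (K : fieldType) (S : {fset {poly K}}) :=
  [fset x in ((S `*` S) `*` (S `*` S))%fset |
     x.1.1 * x.1.2 == x.2.1 * x.2.2]%fset.

Definition normalized_sum (R : realType) (K : fieldType) (T : Type)
    (A : {fset {poly K}}) (f : {poly K} -> T -> R[i]) (w : T) : R[i] :=
  (((Num.sqrt (#|` A|%:R : R))^-1)%:C)%C * \sum_(Q <- A) f Q w.

(* Main.v *)
Require Import Defs.
From HB Require Import structures.
From mathcomp Require Import all_boot all_order all_algebra.
From mathcomp Require Import finmap.
From mathcomp Require Import all_classical all_reals all_analysis.
From mathcomp Require Import complex qpoly.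
From mathcomp Require Import measurable_realfun.
From mathcomp Require Import ring lra zify.
Set Implicit Arguments.
Unset Strict Implicit.
Unset Printing Implicit Defensive.
Import Order.TTheory GRing.Theory Num.Theory.
Import numFieldNormedType.Exports.
Local Open Scope classical_set_scope.
Local Open Scope ring_scope.

(** Let W be the normalized sum over A, L = sqrt (N log q) and k ~ 3L / (8 log q).
By a bound on smooth polynomials and the lower bound on |A|, all but o(|A|) elements F
of A lie in S, have an irreducible factor P_F of degree > k, and are divisible by no
D^2 with deg D > k. For these F, which form a set S', put Y = sum of Re (c f(F)). The
law of f does not change when the single value f(P_F) is rotated, and P_F divides each
element of S' at most once, so differentiating in the angle gives

  E [Re (c f(F)) sin (tY + a)] = t E [Im (c f(F)) (sum_(P_F | G) Im (c f(G))) cos (tY + a)].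

Summing over F, phi(t) = E cos (tY + a) satisfies phi' = - t E [V cos (tY + a)], where V
is the sum of Im (c f(F)) Im (c f(G)) over the pairs with P_F | G. The terms F = G give
the mean |c|^2 |S'| / 2 of V, and by orthogonality its variance is at most a constant
times |c|^4 (number of such pairs + number of nontrivial solutions of F1 F2 = G1 G2).
With |c|^2 of order 1 / |A| this is o(1): the pairs number at most |S'| q^(N - k - 1)
and the nontrivial solutions o(|S|^2). Hence phi(1) is close to exp (- |c|^2 |S'| / 4)
cos a, which identifies the limit of the characteristic function of W. As E |W|^2 = 1,
and a bounded continuous function is uniformly close on a large square to a
trigonometric polynomial obeying the same bound, this gives weak convergence. *)

(** * Factorization and counting of monic polynomials *)

Section MonicPolynomials.
Variable K : fieldType.
Implicit Types p P Q D : {poly K}.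

Lemma monic_size_mul p P : p \is monic -> P \is monic ->
  (size (p * P)%R).-1 = ((size p).-1 + (size P).-1)%N.
Proof.
move=> mp mP; rewrite size_Mmonic ?monic_neq0//.
by move: (size_poly_gt0 p) (size_poly_gt0 P); rewrite !monic_neq0//; lia.
Qed.

Lemma monic_size_exp P n : P \is monic ->
  (size (P ^+ n)%R).-1 = (n * (size P).-1)%N.
Proof.
move=> mP; elim: n => [|n IH]; first by rewrite expr0 size_poly1.
by rewrite exprS monic_size_mul ?monic_exp// IH mulSn.
Qed.

Lemma monic_size_prod (s : seq {poly K}) (F : {poly K} -> {poly K}) :
  (forall Q, Q \in s -> F Q \is monic) ->
  (size (\prod_(Q <- s) F Q)%R).-1 = (\sum_(Q <- s) (size (F Q)).-1)%N.
Proof.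
elim: s => [|Q s IH] ms; first by rewrite !big_nil size_poly1.
have ms' R : R \in s -> F R \is monic by move=> h; apply: ms; rewrite in_cons h orbT.
rewrite !big_cons monic_size_mul ?IH// ?ms ?mem_head//.
by rewrite big_seq; apply: monic_prod.
Qed.

Lemma monic_irreducible_divisor p : p \is monic -> (1 < size p)%N ->
  exists2 Q, monic_irreducible Q & Q %| p.
Proof.
move: {2}(size p) (leqnn (size p)) => n; elim: n p => [|n IH] p.
  by rewrite leqn0 => /eqP->.
move=> pn mp p1; have [irr|] := pselect (irreducible_poly p).
  by exists p => //; split.
move=> /not_andP[//|/existsNP[q /not_implyP[q1 /not_implyP[qp /negP nqp]]]].
have p0 := monic_neq0 mp.
have q0 : q != 0 by apply: contraTneq qp => ->; rewrite dvd0p.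
pose q' := (lead_coef q)^-1 *: q.
have lq : (lead_coef q)^-1 != 0 by rewrite invr_eq0 lead_coef_eq0.
have mq' : q' \is monic by rewrite monicE lead_coefZ mulVf ?lead_coef_eq0.
have sq' : size q' = size q by rewrite size_scale.
have qq' : q' %| p by rewrite dvdpZl.
have lt : (size q < size p)%N.
  by rewrite ltn_neqAle dvdp_size_eqp// nqp dvdp_leq.
have [| | Q irrQ Qq] := IH q' _ mq'.
- by rewrite sq'; lia.
- by rewrite sq'; move: q1; rewrite -size_poly_gt0 in q0; lia.
by exists Q => //; exact: dvdp_trans Qq qq'.
Qed.

Lemma monic_factorization p : p \is monic ->
  exists (s : {fset {poly K}}) (a : {poly K} -> nat),
    (forall Q, Q \in s -> monic_irreducible Q) /\ p = \prod_(Q <- s) Q ^+ a Q.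
Proof.
move: {2}(size p) (leqnn (size p)) => n; elim: n p => [|n IH] p.
  rewrite leqn0 size_poly_eq0 => /eqP-> /monic_neq0.
  by rewrite eqxx.
move=> pn mp; have [p1|p1] := leqP (size p) 1.
  exists fset0, (fun=> 0%N); split; first by move=> Q; rewrite in_fset0.
  have /size1_polyC pC := p1.
  by rewrite big_seq_fset0; move: mp; rewrite pC monicE lead_coefC => /eqP->.
have [Q [mQ irrQ] /(Pdiv.IdomainMonic.dvdpP mQ)[p' pE]] := monic_irreducible_divisor mp p1.
have mp' : p' \is monic by move: mp; rewrite pE monicMr.
have szp := monic_size_mul mp' mQ.
have [Q1 _] := irrQ.
have [||s [a [sirr p'E]]] := IH p'.
- have := pn; rewrite pE; move: szp (size_poly_gt0 p'); rewrite monic_neq0//.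
  by set u := size _; set v := size _; set w := size Q in Q1 *; lia.
- exact: mp'.
have [Qs|Qs] := boolP (Q \in s).
  exists s, (fun R => (a R + (R == Q))%N); split => //.
  rewrite pE p'E (big_fsetD1 Q)//= [in RHS](big_fsetD1 Q)//= eqxx exprD expr1.
  rewrite mulrAC; congr (_ * _); apply: eq_fbigr => R; rewrite !inE => /andP[/negPf-> _].
  by rewrite addn0.
exists (Q |` s)%fset, (fun R => if R == Q then 1%N else a R); split.
  by move=> R; rewrite in_fset1U => /orP[/eqP->//|/sirr].
rewrite big_fsetU1//= eqxx expr1 mulrC pE p'E; congr (_ * _).
apply: eq_fbigr => R Rs; case: eqP => // RQ.
by move: Qs; rewrite -RQ Rs.
Qed.

End MonicPolynomials.

Section Factorization.
Variable K : fieldType.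
Implicit Types p P Q D : {poly K}.

Lemma prod_exp_extend (s t : {fset {poly K}}) (a : {poly K} -> nat) :
  (s `<=` t)%fset ->
  \prod_(Q <- s) Q ^+ a Q = \prod_(Q <- t) Q ^+ (if Q \in s then a Q else 0%N).
Proof.
move=> st; rewrite -[RHS](big_fset_incl _ st); last first.
  by move=> Q _ /negPf->; rewrite expr0.
by apply: eq_fbigr => Q Qs _; rewrite Qs.
Qed.

Lemma monic_factorization2 p P : p \is monic -> P \is monic ->
  exists (s : {fset {poly K}}) (a b : {poly K} -> nat),
    [/\ forall Q, Q \in s -> monic_irreducible Q,
        p = \prod_(Q <- s) Q ^+ a Q & P = \prod_(Q <- s) Q ^+ b Q].
Proof.
move=> /monic_factorization[s [a [sirr pE]]] /monic_factorization[t [b [tirr PE]]].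
exists (s `|` t)%fset, (fun Q => if Q \in s then a Q else 0%N),
  (fun Q => if Q \in t then b Q else 0%N); split.
- by move=> Q; rewrite in_fsetU => /orP[/sirr|/tirr].
- by rewrite pE; apply: prod_exp_extend; exact: fsubsetUl.
- by rewrite PE; apply: prod_exp_extend; exact: fsubsetUr.
Qed.

End Factorization.

Lemma in_fset_filter (T : choiceType) (A : {fset T}) (p : pred T) (x : T) :
  (x \in [fset y in A | p y]%fset) = (x \in A) && p x.
Proof. by rewrite !inE. Qed.

Lemma leq_sum_fsubset (T : choiceType) (A B : {fset T}) (F : T -> nat) :
  (A `<=` B)%fset -> (\sum_(x <- A) F x <= \sum_(x <- B) F x)%N.
Proof.
move=> AB; rewrite [leqRHS](big_fsetID _ (fun x => x \in A))/=.
rewrite (_ : [fset x in B | x \in A]%fset = A) ?leq_addr//.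
by apply/fsetP => x; rewrite !inE/= andbC; case: (boolP (x \in A)) => // /(fsubsetP AB)->.
Qed.

Section MonicCounting.
Variable K : finFieldType.
Implicit Types p P Q D F : {poly K}.
Local Notation q := #|K|.

Definition monics (n : nat) : {fset {poly K}} :=
  [fset ('X^n + val p)%R | p in {: {poly_n K}}]%fset.

Lemma monicsP n p :
  reflect (p \is monic /\ size p = n.+1) (p \in monics n).
Proof.
apply: (iffP (imfsetP _ _ _ _)) => [[/= r _ ->]|[mp sp]].
  have sr : (size (val r) < size ('X^n : {poly K}))%N.
    by rewrite size_polyXn ltnS; exact: size_npoly.
  by rewrite monicE lead_coefDl// lead_coefXn size_polyDl// size_polyXn.
have pn : p`_n = 1 by move: mp; rewrite monicE /lead_coef sp => /eqP.
have sz : (size (p - 'X^n)%R <= n)%N.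
  apply/leq_sizeP => j; rewrite leq_eqVlt => /predU1P[<-|nj].
    by rewrite coefB pn coefXn eqxx subrr.
  by rewrite coefB coefXn gtn_eqF// subr0 nth_default// sp.
by exists (npolyp n (p - 'X^n)) => //=; rewrite npolypK// addrC subrK.
Qed.

Lemma card_monics n : (#|` monics n| <= q ^ n)%N.
Proof.
apply: leq_trans (leq_imfset_card _ _ _) _.
by rewrite /= -cardE -card_npoly.
Qed.

Definition smooth (k n : nat) : {fset {poly K}} :=
  [fset p in monics n | `[< forall Q, monic_irreducible Q -> Q %| p ->
                            ((size Q).-1 <= k)%N >]]%fset.

Lemma smoothP k n p :
  reflect [/\ p \is monic, size p = n.+1 &
    forall Q, monic_irreducible Q -> Q %| p -> ((size Q).-1 <= k)%N]
   (p \in smooth k n).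
Proof.
apply: (iffP idP) => [|[mp sp H]].
  by rewrite !inE/= => /andP[/monicsP[mp sp] /asboolP].
by rewrite !inE/=; apply/andP; split; [exact/monicsP|exact/asboolP].
Qed.

Lemma card_multiples (D : {poly K}) (A B : {fset {poly K}}) :
  D \is monic -> (forall p, p \in A -> exists2 p', p' \in B & p = p' * D) ->
  (#|` A| <= #|` B|)%N.
Proof.
move=> mD AB.
have sub : (A `<=` [fset (p * D)%R | p in B])%fset.
  by apply/fsubsetP => p /AB[p' Bp' ->]; apply/imfsetP; exists p'.
by apply: leq_trans (fsubset_leq_card sub) _; exact: leq_imfset_card.
Qed.

Lemma card_smooth_multiples k n j D a : D \is monic -> (size D).-1 = j ->
  (#|` [fset p in smooth k n | ((D ^+ a)%R %| p)%R]%fset| <=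
     (a * j <= n)%N * #|` smooth k (n - a * j)|)%N.
Proof.
move=> mD Dj.
have mDa : D ^+ a \is monic by exact: monic_exp.
have Daj : (size (D ^+ a)%R).-1 = (a * j)%N by rewrite monic_size_exp// Dj.
have [ajn|ajn] := leqP (a * j)%N n; last first.
  rewrite mul0n leqn0 cardfs_eq0; apply/eqP/fsetP => p; rewrite in_fset0.
  apply/negP; rewrite in_fset_filter => /andP[/smoothP[mp sp _]].
  move/(dvdp_leq (monic_neq0 mp)); rewrite sp.
  by move: Daj ajn; set u := size _; lia.
rewrite mul1n; apply: (@card_multiples (D ^+ a)) => //.
move=> p; rewrite in_fset_filter => /andP[/smoothP[mp sp psm] /(Pdiv.IdomainMonic.dvdpP mDa)[p' pE]].
have mp' : p' \is monic by move: mp; rewrite pE monicMr.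
exists p' => //; apply/smoothP; split => //.
  have := monic_size_mul mp' mDa; rewrite -pE sp Daj.
  by move: (size_poly_gt0 p'); rewrite monic_neq0//; set u := size _; lia.
by move=> Q irrQ Qp'; apply: psm => //; rewrite pE dvdp_mulr.
Qed.

Lemma smooth_count_rec k n :
  (n * #|` smooth k n| <=
   \sum_(j < k.+1) q ^ j * \sum_(1 <= a < n.+1) ((a * j <= n) * (j * #|` smooth k (n - a * j)|)))%N.
Proof.
have step F : F \in smooth k n ->
  (n <= \sum_(j < k.+1) \sum_(D <- monics j) \sum_(1 <= a < n.+1) ((D ^+ a %| F)%R * j))%N.
  move=> /smoothP[mF sF Fsm].
  have [s [e [sirr FE]]] := monic_factorization mF.
  have msa Q : Q \in s -> Q ^+ e Q \is monic by move=> /sirr[mQ _]; exact: monic_exp.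
  have sz := monic_size_prod msa; move: (sz); rewrite -FE sF [n.+1.-1]/= => szn.
  have QF Q a : Q \in s -> (a <= e Q)%N -> Q ^+ a %| F.
    move=> Qs ae; rewrite FE (big_fsetD1 Q)//= dvdp_mulr// -(subnK ae) exprD.
    exact: dvdp_mulIr.
  rewrite [leqLHS]szn.
  have le1 Q : Q \in s -> ((size (Q ^+ e Q)%R).-1 <=
      \sum_(1 <= a < n.+1) ((Q ^+ a %| F)%R * (size Q).-1))%N.
    move=> Qs; have [mQ [Q1 _]] := sirr _ Qs.
    rewrite monic_size_exp//.
    have en : (e Q <= n)%N.
      have := dvdp_leq (monic_neq0 mF) (QF Q _ Qs (leqnn _)); rewrite sF.
      have := monic_size_exp (e Q) mQ.
      by move: Q1; set u := size (Q ^+ _); set v := size Q; case: (v) => [|[|w]]//=; nia.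
    rewrite (@big_cat_nat _ _ _ (e Q).+1)//=; apply: leq_trans (leq_addr _ _).
    rewrite big_nat (eq_bigr (fun=> (size Q).-1)); last first.
      by move=> a /andP[_ ae]; rewrite QF// mul1n.
    by rewrite -big_nat sum_nat_const_nat subSS subn0.
  pose G D j := (\sum_(1 <= a < n.+1) ((D ^+ a %| F)%R * j))%N.
  pose s' := [fset Q in s | (0 < e Q)%N]%fset.
  have s's Q : Q \in s' -> Q \in s by rewrite in_fset_filter => /andP[].
  have degk Q : Q \in s' -> ((size Q).-1 < k.+1)%N.
    rewrite in_fset_filter => /andP[Qs e0]; rewrite ltnS; apply: Fsm; first exact: sirr.
    by have := QF Q 1%N Qs e0; rewrite expr1.
  apply: (@leq_trans (\sum_(Q <- s') G Q (size Q).-1)).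
    rewrite (big_fsetID _ (fun Q => 0 < e Q)%N)/= [X in (_ + X)%N]big1_fset ?addn0.
      rewrite big_seq [leqRHS]big_seq; apply: leq_sum => Q Qs'.
      exact/le1/s's.
    move=> Q; rewrite in_fset_filter -leqNgt leqn0 => /andP[_ /eqP->] _.
    by rewrite expr0 size_poly1.
  apply: (@leq_trans (\sum_(Q <- s') \sum_(j < k.+1) (if (size Q).-1 == j then G Q j else 0%N))).
    rewrite big_seq [leqRHS]big_seq; apply: leq_sum => Q Qs'.
    by rewrite (bigD1 (Ordinal (degk _ Qs')))//= eqxx leq_addr.
  rewrite exchange_big/=; apply: leq_sum => j _.
  rewrite -big_mkcond/= big_fset_condE/=; apply: leq_sum_fsubset.
  apply/fsubsetP => Q; rewrite in_fset_filter => /andP[/s's Qs /eqP Qj].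
  have [mQ [Q1 _]] := sirr _ Qs; apply/monicsP; split => //.
  by rewrite -Qj prednK//; exact: ltnW.
apply: (@leq_trans (\sum_(F <- smooth k n) n)%N).
  by rewrite big_const_seq count_predT iter_addn_0.
apply: (@leq_trans (\sum_(F <- smooth k n)
    \sum_(j < k.+1) \sum_(D <- monics j) \sum_(1 <= a < n.+1) ((D ^+ a %| F)%R * j))%N).
  by rewrite big_seq [leqRHS]big_seq; apply: leq_sum => F; exact: step.
rewrite exchange_big/=; apply: leq_sum => j _.
rewrite exchange_big/=.
apply: (@leq_trans (\sum_(D <- monics j)
   \sum_(1 <= a < n.+1) ((a * j <= n) * (j * #|` smooth k (n - a * j)|)))%N); last first.
  rewrite big_const_seq count_predT iter_addn_0 mulnC leq_mul2r; apply/orP; right.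
  exact: card_monics.
rewrite big_seq [leqRHS]big_seq; apply: leq_sum => D /monicsP[mD sD].
rewrite exchange_big/=; apply: leq_sum => a _.
rewrite -big_distrl/= mulnCA mulnC leq_mul2l; apply/orP; right.
apply: leq_trans (@card_smooth_multiples k n j D a mD _); last by rewrite sD.
rewrite card_fset_sum1 -[leqRHS]big_fset_condE/= [leqRHS]big_mkcond/=.
by apply: leq_sum => p _; case: ifP.
Qed.

End MonicCounting.

Section SmoothBound.
Variables (R : realType) (K : finFieldType).
Local Notation q := #|K|.

Lemma expR_quarter_le : expR (4^-1 : R) <= 13 / 10.
Proof.
have h : expR (16^-1 : R) <= 16 / 15.
  have := expR_ge1Dx (- (16^-1) : R); rewrite expRN => h.
  rewrite -[leLHS]invrK -[leRHS]invrK lef_pV2 ?posrE ?invr_gt0 ?expR_gt0//.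
  by apply: le_trans h; rewrite invf_div; lra.
rewrite (_ : 4^-1 = 16^-1 *+ 4); last by rewrite -mulr_natr; field.
rewrite -[_ *+ 4]mulr_natl expRM_natl.
by apply: le_trans (lerXn2r 4 _ _ h) _; rewrite ?nnegrE ?expR_ge0//; lra.
Qed.

Lemma ln2_ge : 2 / 3 <= ln (2 : R).
Proof.
have h : expR (15^-1 : R) <= 15 / 14.
  have := expR_ge1Dx (- (15^-1) : R); rewrite expRN => h.
  rewrite -[leLHS]invrK -[leRHS]invrK lef_pV2 ?posrE ?invr_gt0 ?expR_gt0//.
  by apply: le_trans h; rewrite invf_div; lra.
rewrite -[leLHS]expRK ler_ln ?posrE ?expR_gt0//.
rewrite (_ : 2 / 3 = 15^-1 *+ 10); last by rewrite -mulr_natr; field.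
rewrite -[_ *+ 10]mulr_natl expRM_natl.
by apply: le_trans (lerXn2r 10 _ _ h) _; rewrite ?nnegrE ?expR_ge0//; lra.
Qed.

Lemma geometric_sum_le (x : R) m : 0 <= x -> x < 1 ->
  \sum_(1 <= a < m) x ^+ a <= x / (1 - x).
Proof.
move=> x0 x1; rewrite ler_pdivlMr ?subr_gt0//.
suff : \sum_(1 <= a < m) x ^+ a * (1 - x) <= x - x ^+ (maxn 1 m).
  by rewrite -mulr_suml => /le_trans; apply; rewrite gerBl exprn_ge0.
elim: m => [|m IH]; first by rewrite big_geq// maxnC expr1 subrr.
case: m IH => [_|m IH]; first by rewrite big_geq// expr1 subrr.
rewrite big_nat_recr//=; apply: le_trans (lerD IH (lexx _)) _.
by rewrite !(maxn_idPr _)// [x ^+ m.+2]exprS mulrBr mulr1 mulrC; lra.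
Qed.

(* Strong induction on n through n psi(n) = sum_(P^a | F) deg P; the weight
   exp(-n/4k) keeps the geometric series in a below 1/(1 - 1.3/2). *)
Lemma card_smooth_le k n : (0 < k)%N -> (1 < q)%N ->
  (#|` smooth K k n|%:R : R) <=
  q%:R ^+ n * expR ((13 / 7 * (k * k.+1)%:R - n%:R) / (4 * k%:R)).
Proof.
move=> k0 q1; have k0' : 0 < k%:R :> R by rewrite ltr0n.
have q0' : 0 < q%:R :> R by rewrite ltr0n ltnW.
set n0 : R := 13 / 7 * _.
elim/ltn_ind: n => n IH.
have [nn0|nn0] := leP n%:R n0.
  apply: (@le_trans _ _ (q%:R ^+ n)).
    rewrite -natrX ler_nat; apply: leq_trans (card_monics _ _).
    apply/fsubset_leq_card/fsubsetP => p /smoothP[mp sp _]; exact/monicsP.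
  rewrite ler_peMr ?exprn_ge0 ?ler0n//.
  rewrite -[leLHS]expR0 ler_expR; apply: divr_ge0; first by rewrite subr_ge0.
  by rewrite mulr_ge0.
have n0_ge0 : 0 <= n0 by rewrite mulr_ge0.
have n_gt0 : 0 < n%:R :> R by apply: le_lt_trans nn0.
rewrite -(ler_pM2l n_gt0).
pose b : R := (4 * k%:R)^-1.
have b0 : 0 < b by rewrite invr_gt0 mulr_gt0.
pose x j : R := (expR b / q%:R) ^+ j.
set E := expR _.
have term (j a : nat) : (a * j <= n)%N -> (0 < a * j)%N ->
    q%:R ^+ j * (j%:R * (#|` smooth K k (n - a * j)|%:R : R)) <=
    (q%:R ^+ n * E) * (j%:R * (q%:R ^+ j * x j ^+ a)).
  move=> ajn aj0.
  rewrite [leRHS](_ : _ = q%:R ^+ j * (j%:R * (q%:R ^+ n * E * x j ^+ a))); last by ring.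
  rewrite ler_pM2l ?exprn_gt0//; apply: ler_wpM2l => //.
  have lt : (n - a * j < n)%N by lia.
  apply: le_trans (IH _ lt) _.
  rewrite /x -exprM (mulnC j a) expr_div_n -expRM_natl.
  rewrite (_ : q%:R ^+ (n - a * j) = q%:R ^+ n / q%:R ^+ (a * j)); last first.
    by rewrite expfB_cond ?gt_eqF//= ?(leq_trans ajn)//.
  rewrite natrB// [leRHS](_ : _ = q%:R ^+ n / q%:R ^+ (a * j) * (E * expR ((a * j)%:R * b))); last by ring.
  rewrite ler_pM2l ?divr_gt0 ?exprn_gt0// /E.
  rewrite -expRD ler_expR /b natrM.
  have -> : n0 - (n%:R - a%:R * j%:R) = n0 - n%:R + a%:R * j%:R by ring.
  by rewrite mulrDl.
have b1 : expR b <= 13 / 10.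
  apply: le_trans expR_quarter_le; rewrite ler_expR /b lef_pV2 ?posrE ?mulr_gt0//.
  by rewrite ler_peMr// ler1n.
have x_ge0 j : 0 <= x j by rewrite exprn_ge0// divr_ge0// ?expR_ge0// ltW.
have x1 : expR b / q%:R <= 13 / 20.
  rewrite ler_pdivrMr//; apply: le_trans b1 _.
  have : 2 <= q%:R :> R by rewrite ler_nat.
  by lra.
have geo (j m : nat) : (0 < j <= k)%N ->
    q%:R ^+ j * \sum_(1 <= a < m) x j ^+ a <= 26 / 7.
  move=> /andP[j0 jk].
  have xj : x j <= 13 / 20.
    apply: (le_trans _ x1); rewrite /x -[leRHS]expr1; apply: ler_wiXn2l => //.
    by apply: (le_trans x1); lra.
  apply: (@le_trans _ _ (q%:R ^+ j * (x j / (7 / 20)))).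
    rewrite ler_pM2l ?exprn_gt0//.
    apply: le_trans (geometric_sum_le m (x_ge0 j) _) _; first by apply: le_lt_trans xj _; lra.
    by apply: ler_wpM2l => //; rewrite lef_pV2 ?posrE; lra.
  rewrite mulrA /x expr_div_n mulrCA divff ?mulr1; last by rewrite gt_eqF// exprn_gt0.
  rewrite -expRM_natl ler_pdivrMr//.
  apply: (@le_trans _ _ (13 / 10)); last by lra.
  apply: le_trans expR_quarter_le; rewrite ler_expR /b invfM mulrCA.
  by rewrite -[leRHS]mulr1 ler_pM2l// ler_pdivrMr// mul1r ler_nat.
apply: (@le_trans _ _ (\sum_(j < k.+1) (q%:R ^+ n * E) * (j%:R * (26 / 7)))); last first.
  rewrite -mulr_sumr mulrC ler_wpM2r ?mulr_ge0 ?exprn_ge0 ?expR_ge0// -mulr_suml.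
  apply: (le_trans _ (ltW nn0)); rewrite -natr_sum.
  have := @bin2_sum k.+1; rewrite big_mkord => ->.
  have -> : n0 = (k.+1 * k)%:R * (13 / 7) by rewrite mulrC mulnC.
  have -> : (k.+1 * k = 'C(k.+1, 2) * 2)%N by rewrite bin2 /= muln2 -[LHS]odd_double_half oddM /= andNb.
  by rewrite natrM; lra.
rewrite -natrM; have := smooth_count_rec K k n; rewrite -(ler_nat R) => /le_trans; apply.
rewrite natr_sum; apply: ler_sum => j _.
rewrite natrM natrX natr_sum mulr_sumr.
have [j0|j0] := posnP (j : nat).
  rewrite big1 => [|a _]; first by rewrite j0 mul0r mulr0.
  by rewrite j0 muln0 mul0n muln0 mulr0.
apply: (@le_trans _ _ (\sum_(1 <= a < n.+1) (q%:R ^+ n * E) * (j%:R * (q%:R ^+ j * x j ^+ a)))).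
  rewrite big_nat [leRHS]big_nat; apply: ler_sum => a /andP[a0 _].
  have [ajn|ajn] := leqP (a * j) n.
    by rewrite mul1n natrM; apply: term => //; rewrite muln_gt0 a0.
  by rewrite mul0n mulr0 !mulr_ge0 ?exprn_ge0 ?expR_ge0.
rewrite -mulr_sumr; apply: ler_wpM2l; first by rewrite mulr_ge0 ?exprn_ge0 ?expR_ge0.
rewrite -mulr_sumr -mulr_sumr; apply: ler_wpM2l => //.
by apply: geo; rewrite j0 -ltnS ltn_ord.
Qed.

End SmoothBound.

(** * Approximation by trigonometric polynomials *)

Section TrigonometricApproximation.
Variable R : realType.
Implicit Types (f g : R * R -> R) (z : R * R).

Inductive trig_poly : (R * R -> R) -> Prop :=
| trig_cos a b : trig_poly (fun z => cos (a * z.1 + b * z.2))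
| trig_sin a b : trig_poly (fun z => sin (a * z.1 + b * z.2))
| trig_add f g : trig_poly f -> trig_poly g -> trig_poly (fun z => f z + g z)
| trig_scale c f : trig_poly f -> trig_poly (fun z => c * f z).

Lemma trig_cst c : trig_poly (fun=> c).
Proof.
have := trig_scale c (trig_cos 0 0).
by under eq_fun do rewrite !mul0r addr0 cos0 mulr1.
Qed.

Lemma trig_mul f g : trig_poly f -> trig_poly g -> trig_poly (fun z => f z * g z).
Proof.
move=> tf; elim: tf g => {f} [a b|a b|f1 f2 _ IH1 _ IH2|c f _ IH] g tg.
- elim: tg => {g} [c d|c d|g1 g2 _ IH1 _ IH2|e g _ IH].
  + have := trig_add (trig_scale 2^-1 (trig_cos (a + c) (b + d)))
                     (trig_scale 2^-1 (trig_cos (a - c) (b - d))).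
    congr trig_poly; apply/funext => z.
    have -> : (a + c) * z.1 + (b + d) * z.2 = (a * z.1 + b * z.2) + (c * z.1 + d * z.2) by ring.
    have -> : (a - c) * z.1 + (b - d) * z.2 = (a * z.1 + b * z.2) - (c * z.1 + d * z.2) by ring.
    by rewrite cosD cosB; field.
  + have := trig_add (trig_scale 2^-1 (trig_sin (a + c) (b + d)))
                     (trig_scale (- 2^-1) (trig_sin (a - c) (b - d))).
    congr trig_poly; apply/funext => z.
    have -> : (a + c) * z.1 + (b + d) * z.2 = (a * z.1 + b * z.2) + (c * z.1 + d * z.2) by ring.
    have -> : (a - c) * z.1 + (b - d) * z.2 = (a * z.1 + b * z.2) - (c * z.1 + d * z.2) by ring.
    by rewrite sinD sinB; field.
  + by under eq_fun do rewrite mulrDr; exact: trig_add.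
  + by under eq_fun do rewrite mulrCA; exact: trig_scale.
- elim: tg => {g} [c d|c d|g1 g2 _ IH1 _ IH2|e g _ IH].
  + have := trig_add (trig_scale 2^-1 (trig_sin (a + c) (b + d)))
                     (trig_scale 2^-1 (trig_sin (a - c) (b - d))).
    congr trig_poly; apply/funext => z.
    have -> : (a + c) * z.1 + (b + d) * z.2 = (a * z.1 + b * z.2) + (c * z.1 + d * z.2) by ring.
    have -> : (a - c) * z.1 + (b - d) * z.2 = (a * z.1 + b * z.2) - (c * z.1 + d * z.2) by ring.
    by rewrite sinD sinB; field.
  + have := trig_add (trig_scale (- 2^-1) (trig_cos (a + c) (b + d)))
                     (trig_scale 2^-1 (trig_cos (a - c) (b - d))).
    congr trig_poly; apply/funext => z.
    have -> : (a + c) * z.1 + (b + d) * z.2 = (a * z.1 + b * z.2) + (c * z.1 + d * z.2) by ring.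
    have -> : (a - c) * z.1 + (b - d) * z.2 = (a * z.1 + b * z.2) - (c * z.1 + d * z.2) by ring.
    by rewrite cosD cosB; field.
  + by under eq_fun do rewrite mulrDr; exact: trig_add.
  + by under eq_fun do rewrite mulrCA; exact: trig_scale.
- by under eq_fun do rewrite mulrDl; apply: trig_add; [exact: IH1|exact: IH2].
- by under eq_fun do rewrite -mulrA; apply: trig_scale; exact: IH.
Qed.

(* The expectation of [phi] under the binomial law of parameters [n] and [u]. *)
Fixpoint bernstein (n : nat) (u : R) (phi : nat -> R) : R :=
  if n is n'.+1 then
    (1 - u) * bernstein n' u phi + u * bernstein n' u (fun k => phi k.+1)
  else phi 0%N.

Lemma bernstein_le n u phi psi : 0 <= u <= 1 ->
  (forall k, (k <= n)%N -> phi k <= psi k) ->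
  bernstein n u phi <= bernstein n u psi.
Proof.
move=> /andP[u0 u1]; elim: n phi psi => [|n IH] phi psi le; first exact: le.
apply: lerD; apply: ler_wpM2l; rewrite ?subr_ge0//; apply: IH => k kn; apply: le => //.
exact: leqW.
Qed.

Lemma bernsteinD n u phi psi :
  bernstein n u (fun k => phi k + psi k) = bernstein n u phi + bernstein n u psi.
Proof. by elim: n phi psi => //= n IH phi psi; rewrite !IH; ring. Qed.

Lemma bernsteinZ n u c phi :
  bernstein n u (fun k => c * phi k) = c * bernstein n u phi.
Proof. by elim: n phi => //= n IH phi; rewrite !IH; ring. Qed.

Lemma bernstein_cst n u c : bernstein n u (fun=> c) = c.
Proof. by elim: n => //= n ->; ring. Qed.

Lemma bernstein_sqr n u c :
  bernstein n u (fun k => (k%:R + c) ^+ 2) = n%:R * (u * (1 - u)) + (n%:R * u + c) ^+ 2.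
Proof.
elim: n c => [|n IH] c /=; first by ring.
rewrite IH (_ : (fun k => _) = (fun k : nat => (k%:R + (c + 1)) ^+ 2)); last first.
  by apply/funext => k; rewrite -natr1; ring.
by rewrite IH -natr1; ring.
Qed.

Lemma bernstein_variance n u : (0 < n)%N ->
  bernstein n u (fun k => (k%:R / n%:R - u) ^+ 2) = u * (1 - u) / n%:R.
Proof.
move=> n0; have n0' : n%:R != 0 :> R by rewrite pnatr_eq0 -lt0n.
rewrite (_ : (fun k => _) = (fun k : nat => (n%:R ^- 2) * (k%:R - n%:R * u) ^+ 2)); last first.
  by apply/funext => k; field.
by rewrite bernsteinZ bernstein_sqr; field.
Qed.

Lemma bernstein_norm n u phi B : 0 <= u <= 1 ->
  (forall k, (k <= n)%N -> `|phi k| <= B) -> `|bernstein n u phi| <= B.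
Proof.
move=> u01 le; rewrite ler_norml; apply/andP; split.
  rewrite -[leLHS](bernstein_cst n u); apply: bernstein_le => // k kn.
  by have := le k kn; rewrite ler_norml => /andP[].
rewrite -[leRHS](bernstein_cst n u); apply: bernstein_le => // k kn.
by have := le k kn; rewrite ler_norml => /andP[].
Qed.

Lemma trig_bernstein n (u : R * R -> R) (phi : nat -> R * R -> R) :
  trig_poly u -> (forall k, trig_poly (phi k)) ->
  trig_poly (fun z => bernstein n (u z) (fun k => phi k z)).
Proof.
move=> tu; elim: n phi => [|n IH] phi tphi /=; first exact: tphi.
apply: trig_add; apply: trig_mul => //; [|exact: IH|by apply: IH => k; exact: tphi].
by apply: trig_add; [exact: trig_cst|under eq_fun do rewrite -mulN1r; exact: trig_scale].
Qed.

Lemma bernstein2_approx n (G : R -> R -> R) (u v B e d : R) :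
  (0 < n)%N -> 0 <= u <= 1 -> 0 <= v <= 1 -> 0 <= B -> 0 < d -> 0 <= e ->
  (forall s t, `|G s t| <= B) ->
  (forall s t, 0 <= s <= 1 -> 0 <= t <= 1 -> `|s - u| < d -> `|t - v| < d ->
     `|G s t - G u v| <= e) ->
  `|bernstein n u (fun j => bernstein n v (fun k => G (j%:R / n%:R) (k%:R / n%:R)))
    - G u v| <= e + B / (d ^+ 2 * n%:R).
Proof.
move=> n0 u01 v01 B0 d0 e0 GB Gd.
have n0' : 0 < n%:R :> R by rewrite ltr0n.
rewrite -[X in _ - X](bernstein_cst n u) -mulN1r -bernsteinZ -bernsteinD.
under eq_fun => j do
  rewrite -[X in _ + -1 * X](bernstein_cst n v) -bernsteinZ -bernsteinD.
pose c := 2 * B / d ^+ 2.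
have c0 : 0 <= c by apply: divr_ge0; [rewrite mulr_ge0|exact: sqr_ge0].
have dev (w : R) : 0 <= w <= 1 -> w * (1 - w) <= 4^-1.
  by move=> _; have := sqr_ge0 (w - 2^-1); lra.
have inn j : (j <= n)%N ->
  `|bernstein n v (fun k => G (j%:R / n%:R) (k%:R / n%:R) + -1 * G u v)| <=
  e + c * (4^-1 / n%:R) + c * (j%:R / n%:R - u) ^+ 2.
  move=> jn.
  have bnd k : (k <= n)%N -> `|G (j%:R / n%:R) (k%:R / n%:R) + -1 * G u v| <=
      e + c * (j%:R / n%:R - u) ^+ 2 + c * (k%:R / n%:R - v) ^+ 2.
    move=> kn; rewrite mulN1r.
    have far (w : R) : d <= `|w| -> 2 * B <= c * w ^+ 2.
      move=> dw; rewrite /c mulrAC ler_pdivlMr ?exprn_gt0//.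
      apply: ler_wpM2l; first by rewrite mulr_ge0.
      by rewrite -[leRHS]real_normK ?num_real// lerXn2r ?nnegrE// ltW.
    have big : `|G (j%:R / n%:R) (k%:R / n%:R) - G u v| <= 2 * B.
      apply: le_trans (ler_normB _ _) _; have := GB u v.
      by have := GB (j%:R / n%:R) (k%:R / n%:R); lra.
    have sq w : 0 <= c * w ^+ 2 by rewrite mulr_ge0 ?sqr_ge0//.
    have [/far fj|nj] := leP d `|j%:R / n%:R - u|.
      apply: le_trans big _; have := sq (k%:R / n%:R - v); lra.
    have [/far fk|nk] := leP d `|k%:R / n%:R - v|.
      apply: le_trans big _; have := sq (j%:R / n%:R - u); lra.
    have frac i : (i <= n)%N -> 0 <= (i%:R / n%:R : R) <= 1.
      by move=> le; rewrite divr_ge0//= ler_pdivrMr// mul1r ler_nat.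
    apply: le_trans (Gd _ _ (frac _ jn) (frac _ kn) nj nk) _.
    have := sq (j%:R / n%:R - u); have := sq (k%:R / n%:R - v); lra.
  have ub : bernstein n v (fun k => e + c * (j%:R / n%:R - u) ^+ 2 + c * (k%:R / n%:R - v) ^+ 2)
      <= e + c * (4^-1 / n%:R) + c * (j%:R / n%:R - u) ^+ 2.
    rewrite bernsteinD bernsteinZ bernstein_cst bernstein_variance//.
    have : c * (v * (1 - v) / n%:R) <= c * (4^-1 / n%:R).
      by apply: ler_wpM2l => //; rewrite ler_pM2r ?invr_gt0// dev.
    by lra.
  rewrite ler_norml; apply/andP; split.
    rewrite -[leLHS]mulN1r; apply: le_trans (_ : -1 * bernstein n v (fun k => e + c * (j%:R / n%:R - u) ^+ 2 + c * (k%:R / n%:R - v) ^+ 2) <= _).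
      by rewrite !mulN1r lerN2.
    rewrite -bernsteinZ; apply: bernstein_le => // k kn.
    by have := bnd k kn; rewrite ler_norml => /andP[h _]; lra.
  apply: le_trans ub; apply: bernstein_le => // k kn.
  by have := bnd k kn; rewrite ler_norml => /andP[].
have ub : bernstein n u (fun j => e + c * (4^-1 / n%:R) + c * (j%:R / n%:R - u) ^+ 2) <=
    e + B / (d ^+ 2 * n%:R).
  rewrite bernsteinD bernsteinZ bernstein_cst bernstein_variance//.
  have : c * (u * (1 - u) / n%:R) <= c * (4^-1 / n%:R).
    by apply: ler_wpM2l => //; rewrite ler_pM2r ?invr_gt0// dev.
  have -> : B / (d ^+ 2 * n%:R) = c * (4^-1 / n%:R) * 2.
    by rewrite /c; field; rewrite !gt_eqF.
  by lra.
rewrite ler_norml; apply/andP; split.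
  rewrite -[leLHS]mulN1r; apply: le_trans (_ : -1 * bernstein n u (fun j => e + c * (4^-1 / n%:R) + c * (j%:R / n%:R - u) ^+ 2) <= _).
    by rewrite !mulN1r lerN2.
  rewrite -bernsteinZ; apply: bernstein_le => // k kn.
  by have := inn k kn; rewrite ler_norml => /andP[h _]; lra.
apply: le_trans ub; apply: bernstein_le => // k kn.
by have := inn k kn; rewrite ler_norml => /andP[].
Qed.

Lemma uniformly_continuous_square (G : R -> R -> R) (e : R) : 0 < e ->
  continuous (fun z : R * R => G z.1 z.2) ->
  exists2 d : R, 0 < d & forall s t s' t', 0 <= s <= 1 -> 0 <= t <= 1 ->
    `|s' - s| < d -> `|t' - t| < d -> `|G s' t' - G s t| <= e.
Proof.
move=> e0 cG.
have cpt : compact (`[0, 1]%classic `*` `[0, 1]%classic : set (R * R)).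
  by apply: compact_setX; exact: segment_compact.
pose P (d : R) (z : R * R) := forall s' t', `|s' - z.1| < d -> `|t' - z.2| < d ->
   `|G s' t' - G z.1 z.2| <= e.
have cov := (compact_near_coveringP _).1 cpt.
have : \forall d \near (0 : R)^'+, `[0, 1]%classic `*` `[0, 1]%classic `<=` P d.
  apply: cov => -[s t] _ /=.
  have e2 : 0 < e / 2 by rewrite divr_gt0.
  have /cvgrPdist_lt/(_ _ e2) := cG (s, t).
  rewrite -nbhs_ballE => -[r /= r0 H].
  have r2 : 0 < r / 2 by rewrite divr_gt0.
  exists (ball (s, t) (r / 2), [set d : R | 0 < d < r / 2]).
    split; first exact: nbhsx_ballx.
    near=> d => /=; apply/andP; split; near: d; [exact: nbhs_right_gt|exact: nbhs_right_lt].
  move=> [[s1 t1] d] /= [[/= s1s t1t] /andP[d0 dr]] s' t' /= ss' tt'.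
  have h1 : `|G s t - G s1 t1| < e / 2.
    apply: (H (s1, t1)); split => /=; [apply: le_ball s1s|apply: le_ball t1t]; lra.
  have h2 : `|G s t - G s' t'| < e / 2.
    apply: (H (s', t')); split => /=; rewrite /ball/=.
      rewrite (_ : s - s' = (s - s1) - (s' - s1)); last by ring.
      apply: le_lt_trans (ler_normB _ _) _.
      by move: s1s; rewrite /ball/= => s1s; lra.
    rewrite (_ : t - t' = (t - t1) - (t' - t1)); last by ring.
    apply: le_lt_trans (ler_normB _ _) _.
    by move: t1t; rewrite /ball/= => t1t; lra.
  rewrite (_ : _ - _ = (G s t - G s1 t1) - (G s t - G s' t')); last by ring.
  by apply: le_trans (ler_normB _ _) _; lra.
move=> [d0 /= d00 H]; exists (d0 / 2); first by rewrite divr_gt0.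
move=> s t s' t' s01 t01 ss' tt'.
have d02 : 0 < d0 / 2 by rewrite divr_gt0.
apply: (H (d0 / 2) _ d02 (s, t) _ s' t' ss' tt') => /=.
  by rewrite sub0r normrN gtr0_norm//; lra.
by split; rewrite /= in_itv.
Unshelve. all: by end_near. Qed.

Lemma trig_approximation (g : R * R -> R) (B M e : R) : continuous g ->
  (forall z, `|g z| <= B) -> 0 < M -> 0 < e ->
  exists h, [/\ trig_poly h, forall z, `|h z| <= B &
    forall z, `|z.1| <= M -> `|z.2| <= M -> `|h z - g z| <= e].
Proof.
move=> cg gB M0 e0.
have B0 : 0 <= B by apply: le_trans (gB (0, 0)).
pose s : R := sin 2^-1.
have half_itv (x : R) : `|x| <= 2^-1 -> x \in `[- (pi / 2), (pi / 2)].
  by move=> x2; rewrite in_itv/= -ler_norml; apply: (le_trans x2); have := @pihalf_ge1 R; lra.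
have s1 : s < 1.
  have p1 := @pihalf_ge1 R.
  have p2 : pi / 2 \in `[- (pi / 2), (pi / 2 : R)] by rewrite in_itv/= lexx andbT; lra.
  rewrite /s -[ltRHS]sin_pihalf ltr_sin//; first lra.
  by rewrite half_itv// gtr0_norm ?invr_gt0.
have s0 : 0 < s by apply: sin_gt0_pihalf; have := @pihalf_ge1 R; lra.
pose clip (y : R) : R := (`|y + s| - `|y - s|) / 2.
have clip_le y : -1 < clip y < 1.
  suff : `|clip y| < 1 by rewrite ltr_norml.
  rewrite /clip normrM [X in _ * X]gtr0_norm ?invr_gt0// ltr_pdivrMr// mul1r.
  apply: le_lt_trans (ler_dist_dist _ _) _.
  by rewrite opprB addrC addrA subrK gtr0_norm; lra.
have clipE y : `|y| <= s -> clip y = y.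
  rewrite ler_norml => /andP[sy ys]; rewrite /clip ger0_norm; last by lra.
  by rewrite ler0_norm; last lra; field.
pose phi (t : R) : R := 2 * M * asin (clip (2 * t - 1)).
have cclip : continuous (fun t : R => clip (2 * t - 1)).
  move=> t; apply: cvgM; last exact: cvg_cst.
  apply: cvgB; apply: cvg_norm.
    apply: cvgD; last exact: cvg_cst.
    by apply: cvgB; last exact: cvg_cst; apply: cvgM; [exact: cvg_cst|exact: cvg_id].
  apply: cvgB; last exact: cvg_cst.
  by apply: cvgB; last exact: cvg_cst; apply: cvgM; [exact: cvg_cst|exact: cvg_id].
have cphi : continuous phi.
  move=> t; apply: (@continuousM _ _ (fun=> 2 * M) (fun t : R => asin (clip (2 * t - 1))) t).
    exact: cst_continuous.
  exact: (continuous_comp (cclip t) (continuous_asin (clip_le _))).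
pose u (x : R) : R := 2^-1 + 2^-1 * sin (x / (2 * M)).
have u01 x : 0 <= u x <= 1.
  by have := sin_geN1 (x / (2 * M)); have := sin_le1 (x / (2 * M)); rewrite /u; lra.
have phiu x : `|x| <= M -> phi (u x) = x.
  move=> xM; rewrite /phi (_ : 2 * u x - 1 = sin (x / (2 * M))); last by rewrite /u; field.
  have x2 : `|x / (2 * M)| <= 2^-1.
    rewrite normrM normfV (gtr0_norm (_ : 0 < 2 * M)) ?mulr_gt0// ler_pdivrMr ?mulr_gt0//.
    by rewrite mulrA mulVf// mul1r.
  rewrite clipE; last first.
    have hh : 2^-1 \in `[- (pi / 2), (pi / 2 : R)] by rewrite half_itv// gtr0_norm ?invr_gt0.
    have hhN : - 2^-1 \in `[- (pi / 2), (pi / 2 : R)].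
      by rewrite half_itv// normrN gtr0_norm ?invr_gt0.
    move: (x2); rewrite !ler_norml => /andP[h1 h2]; rewrite /s -sinN.
    by apply/andP; split; rewrite leNgt ltr_sin -?leNgt ?hh ?hhN ?half_itv.
  by rewrite sinK ?half_itv// mulrC divfK// mulf_neq0// gt_eqF.
pose G (s t : R) := g (phi s, phi t).
have cG : continuous (fun z : R * R => G z.1 z.2).
  move=> z; apply: (@continuous_comp _ _ _ (fun z => (phi z.1, phi z.2)) g); last exact: cg.
  have h1 : phi z0.1 @[z0 --> z] --> phi z.1.
    by apply: (@cvg_comp _ _ _ fst phi _ _ _ _ (cphi z.1)); exact: cvg_fst.
  have h2 : phi z0.2 @[z0 --> z] --> phi z.2.
    by apply: (@cvg_comp _ _ _ snd phi _ _ _ _ (cphi z.2)); exact: cvg_snd.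
  exact: cvg_pair h1 h2.
have e2 : 0 < e / 2 by rewrite divr_gt0.
have [d d0 Gd] := uniformly_continuous_square e2 cG.
pose n := (Num.truncn (2 * B / (d ^+ 2 * e))).+1.
have n0 : (0 < n)%N by [].
pose h z := bernstein n (u z.1) (fun j => bernstein n (u z.2) (fun k => G (j%:R / n%:R) (k%:R / n%:R))).
exists h; split.
- have tu1 : trig_poly (fun z => u z.1).
    apply: trig_add; first exact: trig_cst.
    apply: trig_scale; have := trig_sin (2 * M)^-1 0.
    by under eq_fun do rewrite mul0r addr0 mulrC.
  have tu2 : trig_poly (fun z => u z.2).
    apply: trig_add; first exact: trig_cst.
    apply: trig_scale; have := trig_sin 0 (2 * M)^-1.
    by under eq_fun do rewrite mul0r add0r mulrC.
  apply: trig_bernstein => // j; apply: trig_bernstein => // k; exact: trig_cst.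
- by move=> z; apply: bernstein_norm => // j _; apply: bernstein_norm => // k _; exact: gB.
- move=> z z1 z2.
  have -> : g z = G (u z.1) (u z.2) by rewrite /G !phiu//; case: z {z1 z2}.
  apply: (@le_trans _ _ (e / 2 + B / (d ^+ 2 * n%:R))).
    by apply: bernstein2_approx => //; [exact: ltW|move=> s' t'; exact: gB|move=> s' t' _ _; exact: Gd].
  have de : 0 < d ^+ 2 * e by rewrite mulr_gt0 ?exprn_gt0.
  have : 2 * B / (d ^+ 2 * e) < n%:R by rewrite /n truncnS_gt.
  rewrite ltr_pdivrMr// => le.
  suff : B / (d ^+ 2 * n%:R) <= e / 2 by lra.
  rewrite ler_pdivrMr ?mulr_gt0 ?exprn_gt0 ?ltr0n//.
  have -> : e / 2 * (d ^+ 2 * n%:R) = (n%:R * (d ^+ 2 * e)) / 2 by field.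
  by lra.
Qed.

End TrigonometricApproximation.

(** * Bounded random variables *)

Section BoundedRandomVariables.
Context {d : measure_display} {T : measurableType d} {R : realType}.
Variable P : probability T R.
Implicit Types X Y : T -> R.

Definition bounded_rv X := measurable_fun setT X /\ exists M, forall w, `|X w| <= M.

Notation E X := (\int[P]_w X w).

Lemma bounded_rv_integrable X : bounded_rv X -> P.-integrable setT (EFin \o X).
Proof.
move=> [mX [M XM]]; apply: measurable_bounded_integrable => //.
- by rewrite (le_lt_trans (probability_le1 _ _))// ltry.
- exists M; split; first exact: num_real.
  by move=> x Mx w _; apply: le_trans (XM w) _; exact: ltW.
Qed.

Lemma bounded_rv_cst c : bounded_rv (fun=> c).
Proof. by split; [exact: measurable_cst|exists `|c|]. Qed.

Lemma bounded_rvD X Y : bounded_rv X -> bounded_rv Y -> bounded_rv (fun w => X w + Y w).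
Proof.
move=> [mX [M XM]] [mY [N YN]]; split; first exact: measurable_funD.
by exists (M + N) => w; apply: le_trans (ler_normD _ _) _; exact: lerD.
Qed.

Lemma bounded_rvM X Y : bounded_rv X -> bounded_rv Y -> bounded_rv (fun w => X w * Y w).
Proof.
move=> [mX [M XM]] [mY [N YN]]; split; first exact: measurable_funM.
by exists (M * N) => w; rewrite normrM; exact: ler_pM.
Qed.

Lemma bounded_rvZ c X : bounded_rv X -> bounded_rv (fun w => c * X w).
Proof. by move=> bX; apply: bounded_rvM => //; exact: bounded_rv_cst. Qed.

Lemma bounded_rvN X : bounded_rv X -> bounded_rv (fun w => - X w).
Proof. by move=> /(bounded_rvZ (-1)); under eq_fun do rewrite mulN1r. Qed.

Lemma bounded_rvB X Y : bounded_rv X -> bounded_rv Y -> bounded_rv (fun w => X w - Y w).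
Proof. by move=> bX /bounded_rvN; exact: bounded_rvD. Qed.

Lemma bounded_rv_sqr X : bounded_rv X -> bounded_rv (fun w => X w ^+ 2).
Proof. by move=> bX; under eq_fun do rewrite expr2; exact: bounded_rvM. Qed.

Lemma bounded_rv_norm X : bounded_rv X -> bounded_rv (fun w => `|X w|).
Proof.
move=> [mX [M XM]]; split; first exact: measurableT_comp.
by exists M => w; rewrite normr_id.
Qed.

Lemma bounded_rv_sum (I : eqType) (s : seq I) (Z : I -> T -> R) :
  (forall i, i \in s -> bounded_rv (Z i)) -> bounded_rv (fun w => \sum_(i <- s) Z i w).
Proof.
elim: s => [|i s IH] bZ; first by under eq_fun do rewrite big_nil; exact: bounded_rv_cst.
under eq_fun do rewrite big_cons.
apply: bounded_rvD; first by apply: bZ; rewrite mem_head.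
by apply: IH => j js; apply: bZ; rewrite in_cons js orbT.
Qed.

Lemma bounded_rv_comp (h : R -> R) X M : continuous h -> (forall x, `|h x| <= M) ->
  bounded_rv X -> bounded_rv (fun w => h (X w)).
Proof.
move=> ch hM [mX _]; split; last by exists M => w.
by apply: measurableT_comp => //; exact: continuous_measurable_fun.
Qed.

Lemma bounded_rv_cos X : bounded_rv X -> bounded_rv (fun w => cos (X w)).
Proof. by apply: (@bounded_rv_comp _ _ 1); [exact: continuous_cos|exact: cos_max]. Qed.

Lemma bounded_rv_sin X : bounded_rv X -> bounded_rv (fun w => sin (X w)).
Proof. by apply: (@bounded_rv_comp _ _ 1); [exact: continuous_sin|exact: sin_max]. Qed.

Lemma expectedD X Y : bounded_rv X -> bounded_rv Y -> E (fun w => X w + Y w) = E X + E Y.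
Proof. by move=> bX bY; apply: RintegralD => //; exact: bounded_rv_integrable. Qed.

Lemma expectedB X Y : bounded_rv X -> bounded_rv Y -> E (fun w => X w - Y w) = E X - E Y.
Proof. by move=> bX bY; apply: RintegralB => //; exact: bounded_rv_integrable. Qed.

Lemma expectedZ c X : bounded_rv X -> E (fun w => c * X w) = c * E X.
Proof. by move=> bX; apply: RintegralZl => //; exact: bounded_rv_integrable. Qed.

Lemma expected_cst c : E (fun=> c) = c.
Proof.
rewrite Rintegral_cst//.
rewrite -[RHS]mulr1; congr (_ * _).
by rewrite -[RHS]/(fine 1%:E); congr fine; exact: probability_setT.
Qed.

Lemma expected_sum (I : eqType) (s : seq I) (Z : I -> T -> R) :
  (forall i, i \in s -> bounded_rv (Z i)) ->
  E (fun w => \sum_(i <- s) Z i w) = \sum_(i <- s) E (Z i).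
Proof.
elim: s => [|i s IH] bZ.
  by under eq_Rintegral do rewrite big_nil; rewrite expected_cst big_nil.
have bs j : j \in s -> bounded_rv (Z j) by move=> js; apply: bZ; rewrite in_cons js orbT.
under eq_Rintegral do rewrite big_cons.
rewrite expectedD ?big_cons ?IH//; last exact: bounded_rv_sum.
by apply: bZ; rewrite mem_head.
Qed.

Lemma le_expected X Y : bounded_rv X -> bounded_rv Y -> (forall w, X w <= Y w) -> E X <= E Y.
Proof.
by move=> bX bY XY; apply: le_Rintegral => //; exact: bounded_rv_integrable.
Qed.

Lemma norm_expected_le X Y : bounded_rv X -> bounded_rv Y -> (forall w, `|X w| <= Y w) ->
  `|E X| <= E Y.
Proof.
move=> bX bY XY; apply: (le_trans (le_normr_Rintegral _ _)) => //.
  exact: bounded_rv_integrable.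
by apply: le_expected => //; exact: bounded_rv_norm.
Qed.

Lemma expected_norm_le_sqrt (X : T -> R) : bounded_rv X ->
  \int[P]_w `|X w| <= Num.sqrt (\int[P]_w (X w ^+ 2)).
Proof.
move=> bX; set m := \int[P]_w `|X w|.
have bN := bounded_rv_norm bX; have bS := bounded_rv_sqr bX.
have m0 : 0 <= m by apply: Rintegral_ge0.
have : 0 <= \int[P]_w ((X w ^+ 2 - 2 * m * `|X w|) + m ^+ 2).
  apply: Rintegral_ge0 => w _; rewrite -[X w ^+ 2]real_normK ?num_real//.
  by have := sqr_ge0 (`|X w| - m); lra.
rewrite expectedD; last 2 first.
- by apply: bounded_rvB => //; exact: bounded_rvZ.
- exact: bounded_rv_cst.
rewrite expectedB//; last exact: bounded_rvZ.
rewrite expectedZ// expected_cst -/m => h.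
rewrite -[leLHS]ger0_norm// -sqrtr_sqr ler_wsqrtr//; lra.
Qed.

End BoundedRandomVariables.

(** * Complex random variables and averages over the circle *)

Section ComplexParts.
Variable R : realType.
Implicit Types x y : R[i].
Local Notation re := (@complex.Re R).
Local Notation im := (@complex.Im R).

Lemma reM x y : re (x * y) = re x * re y - im x * im y.
Proof. by case: x y => [a b] [c e]. Qed.

Lemma imM x y : im (x * y) = re x * im y + im x * re y.
Proof. by case: x y => [a b] [c e]. Qed.

Lemma reD x y : re (x + y) = re x + re y.
Proof. by case: x y => [a b] [c e]. Qed.

Lemma imD x y : im (x + y) = im x + im y.
Proof. by case: x y => [a b] [c e]. Qed.

Lemma re_conj x : re (conjc x) = re x. Proof. by case: x. Qed.
Lemma im_conj x : im (conjc x) = - im x. Proof. by case: x. Qed.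

Lemma re_sum (I : Type) (s : seq I) (A : pred I) (F : I -> R[i]) :
  re (\sum_(i <- s | A i) F i) = \sum_(i <- s | A i) re (F i).
Proof. exact: (big_morph _ reD). Qed.

Lemma im_sum (I : Type) (s : seq I) (A : pred I) (F : I -> R[i]) :
  im (\sum_(i <- s | A i) F i) = \sum_(i <- s | A i) im (F i).
Proof. exact: (big_morph _ imD). Qed.

Lemma de_moivre (t : R) n : (cos t +i* sin t)%C ^+ n = (cos (n%:R * t) +i* sin (n%:R * t))%C.
Proof.
elim: n => [|n IH]; first by rewrite expr0 mul0r cos0 sin0.
rewrite exprS IH -natr1 mulrDl mul1r [_ + t]addrC cosD sinD.
by apply/eqP; rewrite eq_complex/=; apply/andP; split; apply/eqP; ring.
Qed.

Definition sqnorm x := re x ^+ 2 + im x ^+ 2.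

Lemma sqnormM x y : sqnorm (x * y) = sqnorm x * sqnorm y.
Proof. by rewrite /sqnorm reM imM; ring. Qed.

Lemma sqnorm_conj x : sqnorm (conjc x) = sqnorm x.
Proof. by rewrite /sqnorm re_conj im_conj sqrrN. Qed.

Lemma norm_re_le x M : 0 <= M -> sqnorm x <= M ^+ 2 -> `|re x| <= M.
Proof.
move=> M0 xM; rewrite -(@ler_pXn2r _ 2)// ?nnegrE// real_normK ?num_real//.
by apply: le_trans xM; rewrite lerDl sqr_ge0.
Qed.

Lemma norm_im_le x M : 0 <= M -> sqnorm x <= M ^+ 2 -> `|im x| <= M.
Proof.
move=> M0 xM; rewrite -(@ler_pXn2r _ 2)// ?nnegrE// real_normK ?num_real//.
by apply: le_trans xM; rewrite lerDr sqr_ge0.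
Qed.

End ComplexParts.

Section ComplexMeasurable.
Context {d : measure_display} {U : measurableType d} {R : realType}.
Implicit Types X Y : U -> R[i].

Definition complex_measurable X :=
  measurable_fun setT (fun w => complex.Re (X w)) /\
  measurable_fun setT (fun w => complex.Im (X w)).

Lemma complex_measurableE X : complex_measurable X <-> measurable_fun setT (coords \o X).
Proof. by split => [[m1 m2]|/measurable_fun_pairP[]//]; exact: measurable_fun_pair. Qed.

Lemma complex_measurable_cst c : complex_measurable (fun=> c).
Proof. by split; exact: measurable_cst. Qed.

Lemma complex_measurableM X Y : complex_measurable X -> complex_measurable Y ->
  complex_measurable (fun w => X w * Y w).
Proof.
move=> [rX iX] [rY iY]; split.
  by under eq_fun do rewrite reM; apply: measurable_funB; exact: measurable_funM.
by under eq_fun do rewrite imM; apply: measurable_funD; exact: measurable_funM.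
Qed.

Lemma complex_measurableX X n : complex_measurable X -> complex_measurable (fun w => X w ^+ n).
Proof.
move=> mX; elim: n => [|n IH].
  by under eq_fun do rewrite expr0; exact: complex_measurable_cst.
by under eq_fun do rewrite exprS; exact: complex_measurableM.
Qed.

Lemma complex_measurable_prod (I : eqType) (s : seq I) (F : I -> U -> R[i]) :
  (forall i, i \in s -> complex_measurable (F i)) ->
  complex_measurable (fun w => \prod_(i <- s) F i w).
Proof.
elim: s => [|i s IH] mF.
  by under eq_fun do rewrite big_nil; exact: complex_measurable_cst.
under eq_fun do rewrite big_cons; apply: complex_measurableM.
  by apply: mF; rewrite mem_head.
by apply: IH => j js; apply: mF; rewrite in_cons js orbT.
Qed.

Lemma complex_measurable_sum (I : eqType) (s : seq I) (F : I -> U -> R[i]) :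
  (forall i, i \in s -> complex_measurable (F i)) ->
  complex_measurable (fun w => \sum_(i <- s) F i w).
Proof.
elim: s => [|i s IH] mF.
  by under eq_fun do rewrite big_nil; exact: complex_measurable_cst.
have [m1 m2] : complex_measurable (F i) by apply: mF; rewrite mem_head.
have [n1 n2] : complex_measurable (fun w => \sum_(i <- s) F i w).
  by apply: IH => j js; apply: mF; rewrite in_cons js orbT.
split; under eq_fun do rewrite big_cons ?reD ?imD; exact: measurable_funD.
Qed.

End ComplexMeasurable.

Section CircleAverage.
Context {d : measure_display} {T : measurableType d} {R : realType}.
Variable P : probability T R.

Definition circle_point (t : R) : R * R := (cos t, sin t).

Lemma measurable_circle_point : measurable_fun setT circle_point.
Proof.
apply: measurable_fun_pair; apply: continuous_measurable_fun.
- exact: continuous_cos.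
- exact: continuous_sin.
Qed.

Lemma circle_integral0 (h Psi : R -> R) (M : R) : continuous h ->
  (forall t, `|h t| <= M) ->
  (forall t : R, is_derive t (1 : R) Psi (h t)) -> Psi (2 * pi) = Psi 0 ->
  (\int[uniform_prob (@two_pi_gt0 R)]_t (h t)%:E = 0)%E.
Proof.
move=> ch hM dPsi per.
have mh : measurable_fun setT h by exact: continuous_measurable_fun.
have bh : bounded_rv h by split => //; exists M.
have shift : (\int[uniform_prob (@two_pi_gt0 R)]_t (h t + M)%:E = M%:E)%E.
  rewrite integral_uniform; last 2 first.
  - by apply/measurable_EFinP; exact: measurable_funD.
  - by move=> x; rewrite lee_fin -lerBlDr sub0r; have := hM x; rewrite ler_norml => /andP[].
  have dF (x : R) : is_derive x (1 : R) (fun t => Psi t + M * t) (h x + M).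
    by apply: is_derive_eq; rewrite /GRing.scale/= mulr1.
  rewrite (@continuous_FTC2 _ _ (fun t => Psi t + M * t)).
  - rewrite per -EFinB -EFinM; congr EFin.
    rewrite mulr0 addr0 subr0 addrAC subrr add0r mulrCA mulVf ?mulr1//.
    by rewrite gt_eqF// two_pi_gt0.
  - exact: two_pi_gt0.
  - apply: continuous_subspaceT => x; apply: cvgD; [exact: ch|exact: cvg_cst].
  - have cF : continuous (fun t : R => Psi t + M * t).
      by move=> x; apply: differentiable_continuous; apply/derivable1_diffP; case: (dF x).
    split; first by move=> x _; case: (dF x).
      exact/cvg_at_right_filter/cF.
    exact/cvg_at_left_filter/cF.
  - by move=> x _; rewrite derive1E; apply: derive_val.
move: shift; under eq_integral do rewrite EFinD.
rewrite integralD//=; last 2 first.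
- exact: bounded_rv_integrable.
- by apply: bounded_rv_integrable; exact: bounded_rv_cst.
rewrite integral_cst//= [X in (_ * X)%E]probability_setT mule1.
have : (\int[uniform_prob (@two_pi_gt0 R)]_t (h t)%:E \is a fin_num)%E.
  by apply: integrable_fin_num => //; exact: bounded_rv_integrable.
move=> /fineK <-; rewrite -EFinD => -[/eqP].
by rewrite -[X in _ == X]add0r (inj_eq (addIr M)) => /eqP->.
Qed.

Lemma circle_pointP (p : R * R) : p.1 ^+ 2 + p.2 ^+ 2 = 1 ->
  exists t, p = circle_point t.
Proof.
case: p => a b /= ab1.
have a1 : -1 <= a <= 1.
  rewrite -ler_norml -(@ler_pXn2r _ 2)// ?nnegrE// real_normK ?num_real// expr1n.
  by rewrite -ab1 lerDl sqr_ge0.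
have sb : Num.sqrt (1 - a ^+ 2) = `|b| by rewrite -ab1 addrC addKr sqrtr_sqr.
have ca : cos (acos a) = a by rewrite acosK// in_itv.
have [b0|b0] := leP 0 b.
  by exists (acos a); rewrite /circle_point ca sin_acos// sb ger0_norm.
exists (- acos a); rewrite /circle_point cosN sinN ca sin_acos// sb.
by rewrite ler0_norm ?opprK// ltW.
Qed.

Section IndependentCirclePoint.
Variables (z : T -> R * R) (G : set (set T)).
Hypotheses (mz : measurable_fun setT z)
  (zlaw : forall B, measurable B -> P (z @^-1` B) = uniform_circle B)
  (GT : G setT) (GI : setI_closed G) (mG : G `<=` measurable)
  (zG : forall B A, measurable B -> G A ->
     P (z @^-1` B `&` A) = (P (z @^-1` B) * P A)%E).

Lemma independent_generated (B : set (R * R)) (A : set T) : measurable B ->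
  <<s G >> A -> P (z @^-1` B `&` A) = (P (z @^-1` B) * P A)%E.
Proof.
move=> mB sA.
have mzB : measurable (z @^-1` B) by rewrite -[X in measurable X]setTI; exact: mz.
pose m1 := mrestr P mzB.
have PB0 : (0 <= fine (P (z @^-1` B)))%R by rewrite fine_ge0.
pose m2 := mscale (NngNum PB0) P.
have fin : P (z @^-1` B) \is a fin_num by exact: fin_num_measure.
have m12 : m1 A = m2 A.
  apply: (g_sigma_algebra_measure_unique G mG (fun=> setT)) => //.
  - by rewrite bigcup_const//; exists 0%N.
  - move=> C GC; rewrite /= /mrestr /mscale/= setIC.
    by rewrite [X in (X * _)%E]fineK// zG.
  - move=> _; apply: le_lt_trans (probability_le1 P _) _; last by rewrite ltry.
    by rewrite setTI.
move: m12; rewrite /m1 /m2 /mrestr /mscale/= setIC => ->.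
by rewrite [X in (X * _)%E]fineK.
Qed.

Definition independent_pair : T -> (R * R) * g_sigma_algebraType G := fun w => (z w, w).

Lemma measurable_independent_pair : measurable_fun setT independent_pair.
Proof.
apply: measurable_fun_pair => //.
move=> _ /= A mA; rewrite setTI preimage_id.
have : <<s G >> `<=` measurable by apply: smallest_sub => //; exact: sigma_algebra_measurable.
exact.
Qed.

Lemma independent_circle_average (H : (R * R) * g_sigma_algebraType G -> R) (M : R) :
  measurable_fun setT H -> (forall x, `|H x| <= M) ->
  (forall w, \int[uniform_prob (@two_pi_gt0 R)]_t (H (circle_point t, w))%:E = 0)%E ->
  \int[P]_w H (z w, w) = 0.
Proof.
move=> mH HM H0.
have mc : measurable_fun setT (circle_point : measurableTypeR R -> R * R).
  exact: measurable_circle_point.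
pose Zc := @mfun_Sub _ _ (measurableTypeR R) (R * R)%type circle_point (mem_set mc).
pose m1 := distribution (uniform_prob (@two_pi_gt0 R)) Zc.
have mid : measurable_fun setT (id : T -> g_sigma_algebraType G).
  by move: measurable_independent_pair => /measurable_fun_pairP[].
pose Zi : {mfun _ >-> _} := mfun_Sub (mem_set mid).
pose m2 := distribution P Zi.
pose Zp : {mfun _ >-> _} := mfun_Sub (mem_set measurable_independent_pair).
pose m' := distribution P Zp.
have mm' X : measurable X -> (m1 \x m2)%E X = m' X.
  apply: product_measure_unique => A B mA mB.
  transitivity (P (z @^-1` A `&` B)); first by [].
  by rewrite independent_generated// zlaw.
have bH (D : measure_display) (U : measurableType D) (Q : probability U R)
    (k : U -> (R * R) * g_sigma_algebraType G) : measurable_fun setT k ->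
    Q.-integrable setT (EFin \o (H \o k)).
  move=> mk; apply: bounded_rv_integrable; split; first exact: measurableT_comp.
  by exists M => w; exact: HM.
have mEH : measurable_fun setT (EFin \o H) by exact/measurable_EFinP.
rewrite /Rintegral -[RHS]/(fine 0%E); congr fine.
transitivity (\int[m']_x (H x)%:E)%E.
  by rewrite (@integral_distribution _ _ _ _ _ P Zp (EFin \o H))//; exact: bH.
transitivity (\int[m1 \x m2]_x (H x)%:E)%E.
  by apply: eq_measure_integral => A mA _; symmetry; exact: mm'.
have intH : (m1 \x m2)%E.-integrable setT (EFin \o H).
  apply: measurable_bounded_integrable => //.
    apply: (eq_ind _ (fun y => y < +oo)%E _ _ (esym (mm' setT measurableT))).
    by rewrite (le_lt_trans (probability_le1 _ _))// ltry.
  exists M; split; first exact: num_real.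
  by move=> x Mx w _; apply: le_trans (HM w) _; exact: ltW.
rewrite -(fubini2 intH).
apply: integral0_eq => w _; rewrite /fubini_G.
rewrite (@integral_distribution _ _ _ _ _ _ Zc (fun x => (H (x, w))%:E)).
- exact: H0.
- by apply/measurable_EFinP; exact: (measurable_fun_pair1 (f := H)).
- apply: (bH _ _ (uniform_prob (@two_pi_gt0 R)) (fun t => (circle_point t, w))).
  by apply: measurable_fun_pair; [exact: measurable_circle_point|exact: measurable_cst].
Qed.

Hypothesis z_circle : forall w, (z w).1 ^+ 2 + (z w).2 ^+ 2 = 1.

Lemma circle_average0 (H Psi : R * R -> T -> R) (M : R) :
  measurable_fun setT (fun x : (R * R) * g_sigma_algebraType G => H x.1 x.2) ->
  (forall t w, `|H (circle_point t) w| <= M) ->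
  (forall w, continuous (fun t => H (circle_point t) w)) ->
  (forall w (t : R), is_derive t (1 : R) (fun t => Psi (circle_point t) w) (H (circle_point t) w)) ->
  \int[P]_w H (z w) w = 0.
Proof.
move=> mH HM cH dPsi.
pose C := [set x : (R * R) * g_sigma_algebraType G | x.1.1 ^+ 2 + x.1.2 ^+ 2 = 1].
have cpC t w : C (circle_point t, w) by rewrite /C/= cos2Dsin2.
have mC : measurable C.
  have m11 : measurable_fun setT (fun x : (R * R) * g_sigma_algebraType G => x.1.1).
    by apply: measurableT_comp; exact: measurable_fst.
  have m12 : measurable_fun setT (fun x : (R * R) * g_sigma_algebraType G => x.1.2).
    by apply: measurableT_comp; [exact: measurable_snd|exact: measurable_fst].
  have mf : measurable_fun setT (fun x : (R * R) * g_sigma_algebraType G => x.1.1 ^+ 2 + x.1.2 ^+ 2).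
    by apply: measurable_funD; exact: measurable_funX.
  by have := mf measurableT [set 1] (measurable_set1 _); rewrite setTI.
pose H' x := \1_C x * H x.1 x.2.
have H'E t w : H' (circle_point t, w) = H (circle_point t) w.
  by rewrite /H' indicE mem_set ?mul1r//; exact: cpC.
have -> : \int[P]_w H (z w) w = \int[P]_w H' (z w, w).
  apply: eq_Rintegral => w _; rewrite /H' indicE mem_set ?mul1r//.
  exact: z_circle.
have M0 : 0 <= M by apply: le_trans (HM 0 point).
have H'M x : `|H' x| <= M.
  rewrite /H' indicE; have [|] := boolP (x \in C); last by rewrite mul0r normr0.
  rewrite inE => -[] /= xC; rewrite mul1r.
  have [t ->] := circle_pointP xC.
  exact: HM.
apply: (independent_circle_average (H := H') (M := M)) => //.
  by apply: measurable_funM => //; exact: measurable_indic.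
move=> w; under eq_integral do rewrite H'E.
apply: (@circle_integral0 _ (fun t => Psi (circle_point t) w) M) => //.
rewrite /circle_point mulr_natl.
by rewrite cos2pi sin2pi cos0 sin0.
Qed.

Local Notation TG := (g_sigma_algebraType G).

(* With z, p, u complex, the integrand is the derivative of
   Im (z p) sin (t (Re (z u) + r) + a) in the angle of z. *)
Lemma circle_integration_by_parts (p1 p2 u1 u2 r : TG -> R) (t a : R) :
  bounded_rv p1 -> bounded_rv p2 -> bounded_rv u1 -> bounded_rv u2 -> bounded_rv r ->
  \int[P]_w ((((z w).1 * p1 w - (z w).2 * p2 w) *
               sin (t * ((z w).1 * u1 w - (z w).2 * u2 w + r w) + a)) -
     t * (((z w).1 * p2 w + (z w).2 * p1 w) * ((z w).1 * u2 w + (z w).2 * u1 w)) *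
       cos (t * ((z w).1 * u1 w - (z w).2 * u2 w + r w) + a)) = 0.
Proof.
move=> [mp1 [P1 hP1]] [mp2 [P2 hP2]] [mu1 [U1 hU1]] [mu2 [U2 hU2]] [mr _].
pose Th (x : R * R) (w : T) : R := t * (x.1 * u1 w - x.2 * u2 w + r w) + a.
pose H (x : R * R) (w : T) : R := ((x.1 * p1 w - x.2 * p2 w) * sin (Th x w)) -
  t * ((x.1 * p2 w + x.2 * p1 w) * (x.1 * u2 w + x.2 * u1 w)) * cos (Th x w).
pose Psi (x : R * R) (w : T) : R := (x.1 * p2 w + x.2 * p1 w) * sin (Th x w).
have mx1 : measurable_fun setT (fun x : (R * R) * TG => x.1.1).
  by apply: measurableT_comp; exact: measurable_fst.
have mx2 : measurable_fun setT (fun x : (R * R) * TG => x.1.2).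
  by apply: measurableT_comp; [exact: measurable_snd|exact: measurable_fst].
have m_snd (g : TG -> R) : measurable_fun setT g ->
    measurable_fun setT (fun x : (R * R) * TG => g x.2).
  by move=> mg; apply: measurableT_comp => //; exact: measurable_snd.
have mTh : measurable_fun setT (fun x : (R * R) * TG => Th x.1 x.2).
  apply: measurable_funD => //; apply: measurable_funM => //; apply: measurable_funD; last exact: m_snd.
  by apply: measurable_funB; apply: measurable_funM => //; exact: m_snd.
have dTh w (s : R) : is_derive s (1 : R) (fun s => Th (circle_point s) w)
    (t * (- sin s * u1 w - cos s * u2 w)).
  rewrite /Th/=; apply: is_derive_eq; rewrite /GRing.scale/=; ring.
have dsin w (s : R) : is_derive s (1 : R) (fun s => sin (Th (circle_point s) w))
    (cos (Th (circle_point s) w) * (t * (- sin s * u1 w - cos s * u2 w))).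
  by apply: is_derive1_comp; exact: dTh.
have cTh w : continuous (fun s => Th (circle_point s) w).
  by move=> s; apply: differentiable_continuous; apply/derivable1_diffP; case: (dTh w s).
apply: (@circle_average0 H Psi ((P1 + P2) + `|t| * ((P2 + P1) * (U2 + U1)))).
- rewrite /H; apply: measurable_funB.
    apply: measurable_funM; last exact: (measurableT_comp (continuous_measurable_fun (@continuous_sin R)) mTh).
    by apply: measurable_funB; apply: measurable_funM => //; exact: m_snd.
  apply: measurable_funM; last exact: (measurableT_comp (continuous_measurable_fun (@continuous_cos R)) mTh).
  apply: measurable_funM => //; apply: measurable_funM; apply: measurable_funD;
    by apply: measurable_funM => //; exact: m_snd.
- move=> s w; rewrite /H.
  have cs (x y X Y : R) : `|x| <= X -> `|y| <= Y ->
      `|cos s * x + sin s * y| <= X + Y.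
    move=> hx hy; apply: le_trans (ler_normD _ _) _; rewrite !normrM; apply: lerD.
      by rewrite -[leRHS]mul1r ler_pM// cos_max.
    by rewrite -[leRHS]mul1r ler_pM// sin_max.
  apply: le_trans (ler_normB _ _) _; rewrite !normrM; apply: lerD.
    rewrite -[leRHS]mulr1 ler_pM// ?sin_max//.
    by rewrite -mulrN; apply: cs; rewrite ?normrN.
  rewrite -mulrA ler_wpM2l// -[leRHS]mulr1 ler_pM ?mulr_ge0 ?cos_max//.
  by rewrite ler_pM//; apply: cs.
- move=> w s; rewrite /H; apply: cvgB; apply: cvgM.
  + by apply: cvgB; apply: cvgM; (try exact: cvg_cst); [exact: continuous_cos|exact: continuous_sin].
  + exact: (continuous_comp (cTh w s) (@continuous_sin R _)).
  + apply: cvgM; first exact: cvg_cst.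
    by apply: cvgM; apply: cvgD; apply: cvgM; (try exact: cvg_cst);
      (try exact: continuous_cos); exact: continuous_sin.
  + exact: (continuous_comp (cTh w s) (@continuous_cos R _)).
- move=> w s; rewrite /Psi /H/=.
  have d2 : is_derive s (1 : R) (fun s => cos s * p2 w + sin s * p1 w)
      (- sin s * p2 w + cos s * p1 w).
    by apply: is_derive_eq; rewrite /GRing.scale/=; ring.
  have := @is_deriveM _ _ _ _ s 1 _ _ d2 (dsin w s).
  by move=> dd; apply: is_derive_eq; rewrite /GRing.scale/=; ring.
Qed.

Lemma circle_power_mean0 (n : nat) (g : TG -> R[i]) (M : R) : (0 < n)%N ->
  complex_measurable g -> (forall w, `|complex.Re (g w)| <= M) ->
  (forall w, `|complex.Im (g w)| <= M) ->
  \int[P]_w complex.Re (((z w).1 +i* (z w).2)%C ^+ n * g w) = 0.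
Proof.
move=> n0 mg hr hi; have n0' : n%:R != 0 :> R by rewrite pnatr_eq0 -lt0n.
pose H (x : R * R) (w : T) : R := complex.Re ((x.1 +i* x.2)%C ^+ n * g w).
pose Psi (x : R * R) (w : T) : R := n%:R^-1 * complex.Im ((x.1 +i* x.2)%C ^+ n * g w).
have HE s w : H (circle_point s) w =
    cos (n%:R * s) * complex.Re (g w) - sin (n%:R * s) * complex.Im (g w).
  by rewrite /H reM de_moivre.
have PsiE s w : Psi (circle_point s) w =
    n%:R^-1 * (cos (n%:R * s) * complex.Im (g w) + sin (n%:R * s) * complex.Re (g w)).
  by rewrite /Psi imM de_moivre.
apply: (@circle_average0 H Psi (M + M)).
- have mx : complex_measurable (fun x : (R * R) * TG => (x.1.1 +i* x.1.2)%C).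
    split => /=; apply: measurableT_comp => //; exact: measurable_fst.
  have mg2 : complex_measurable (fun x : (R * R) * TG => g x.2).
    have m_snd (h : TG -> R) : measurable_fun setT h ->
        measurable_fun setT (fun x : (R * R) * TG => h x.2).
      by move=> mh; apply: measurableT_comp => //; exact: measurable_snd.
    by case: mg => m1 m2; split; [exact: (m_snd (fun w => complex.Re (g w)))|
      exact: (m_snd (fun w => complex.Im (g w)))].
  by case: (complex_measurableM (complex_measurableX n mx) mg2).
- move=> s w; rewrite HE; apply: le_trans (ler_normB _ _) _; rewrite !normrM; apply: lerD.
    by rewrite -[leRHS]mul1r ler_pM// cos_max.
  by rewrite -[leRHS]mul1r ler_pM// sin_max.
- move=> w; under eq_fun do rewrite HE.
  have cn : continuous (fun s : R => n%:R * s).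
    by move=> s; apply: cvgM; [exact: cvg_cst|exact: cvg_id].
  move=> s; apply: cvgB; apply: cvgM; try exact: cvg_cst.
    exact: (continuous_comp (cn s) (@continuous_cos R _)).
  exact: (continuous_comp (cn s) (@continuous_sin R _)).
- move=> w s; under eq_fun do rewrite PsiE; rewrite HE.
  have dn : is_derive s (1 : R) (fun s : R => n%:R * s) n%:R.
    by apply: is_derive_eq; rewrite /GRing.scale/= mulr1.
  have dc : is_derive s (1 : R) (fun s : R => cos (n%:R * s)) (- sin (n%:R * s) * n%:R).
    by apply: is_derive1_comp.
  have ds : is_derive s (1 : R) (fun s : R => sin (n%:R * s)) (cos (n%:R * s) * n%:R).
    by apply: is_derive1_comp.
  by apply: is_derive_eq; rewrite /GRing.scale/=; field.
Qed.

End IndependentCirclePoint.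
End CircleAverage.

Section CharacteristicODE.
Context {d : measure_display} {T : measurableType d} {R : realType}.
Variable P : probability T R.
Variables (Y V : T -> R) (v eta a : R).
Hypotheses (bY : bounded_rv Y) (bV : bounded_rv V) (v0 : 0 <= v).
Hypothesis ibp : forall t,
  \int[P]_w (Y w * sin (t * Y w + a)) = t * \int[P]_w (V w * cos (t * Y w + a)).
Hypothesis Vv : \int[P]_w `|V w - v| <= eta.

Let phi t := \int[P]_w cos (t * Y w + a).

Lemma bounded_rv_phase t : bounded_rv (fun w => t * Y w + a).
Proof. by apply: bounded_rvD; [exact: bounded_rvZ|exact: bounded_rv_cst]. Qed.

Lemma is_derive_characteristic (t : R) :
  is_derive t (1 : R) phi (- \int[P]_w (Y w * sin (t * Y w + a))).
Proof.
pose F (t : R) w := cos (t * Y w + a).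
have dF (x : R) w : is_derive x (1 : R) (F ^~ w) (- sin (x * Y w + a) * Y w).
  have dl : is_derive x (1 : R) (fun x : R => x * Y w + a) (Y w).
    by apply: is_derive_eq; rewrite /GRing.scale/=; ring.
  by rewrite /F; apply: is_derive1_comp.
have dFE (x : R) w : partial1of2 F x w = - (Y w * sin (x * Y w + a)).
  by rewrite partial1of2E derive_val; ring.
have [_ [M YM]] := bY.
have tI : `]t - 1, t + 1[%classic t by rewrite /= in_itv/= ltrBlDr !ltrDl ltr01.
have bF x : bounded_rv (F x) by apply/bounded_rv_cos/bounded_rv_phase.
have intF x : `]t - 1, t + 1[%classic x -> P.-integrable setT (EFin \o F x).
  by move=> _; exact: bounded_rv_integrable.
have derF x w : `]t - 1, t + 1[%classic x -> setT w -> derivable (F ^~ w) x 1.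
  by move=> _ _; case: (dF x w).
have M0 (w : T) : 0 <= (fun=> M) w :> R by apply: le_trans (YM w).
have intM : P.-integrable setT (EFin \o (fun=> M)).
  by apply: bounded_rv_integrable; exact: bounded_rv_cst.
have ubF x w : `]t - 1, t + 1[%classic x -> setT w -> `|partial1of2 F x w| <= (fun=> M) w.
  move=> _ _; rewrite dFE normrN normrM -[leRHS]mulr1 ler_pM//.
  exact: sin_max.
have derphi : derivable phi t 1.
  exact: (@derivable_under_integral _ _ _ P F setT measurableT t _ _ tI intF derF _ M0 intM ubF).
apply: DeriveDef => //; rewrite -derive1E.
rewrite [LHS](@differentiation_under_integral _ _ _ P F setT measurableT t _ _ tI intF derF _ M0 intM ubF).
under eq_Rintegral do rewrite dFE -mulN1r.
rewrite expectedZ ?mulN1r//.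
by apply: bounded_rvM => //; apply/bounded_rv_sin/bounded_rv_phase.
Qed.

(* [phi' t = - t E (V cos (t Y + a))] is compared with [phi' = - v t phi], whose
   solution is [expR (- v t ^+ 2 / 2) * cos a]. *)
Lemma characteristic_ode :
  `| \int[P]_w cos (Y w + a) - expR (- v / 2) * cos a | <= eta.
Proof.
have eta0 : 0 <= eta.
  by apply: le_trans Vv; apply: Rintegral_ge0 => w _.
pose D t := \int[P]_w ((V w - v) * cos (t * Y w + a)).
have bVv : bounded_rv (fun w => V w - v).
  by apply: bounded_rvB => //; exact: bounded_rv_cst.
have bc t : bounded_rv (fun w => cos (t * Y w + a)).
  by apply/bounded_rv_cos/bounded_rv_phase.
have D_le t : `|D t| <= eta.
  apply: le_trans Vv; apply: norm_expected_le.
  - exact: bounded_rvM.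
  - exact: bounded_rv_norm.
  - by move=> w; rewrite normrM -[leRHS]mulr1 ler_pM// cos_max.
have DE t : \int[P]_w (Y w * sin (t * Y w + a)) = t * (v * phi t + D t).
  rewrite ibp; congr (_ * _).
  rewrite /D /phi -expectedZ// -expectedD//; last 2 first.
  - exact: bounded_rvZ.
  - exact: bounded_rvM.
  by apply: eq_Rintegral => w _; ring.
pose psi t := phi t * expR (v / 2 * t ^+ 2).
have dpsi (t : R) : is_derive t (1 : R) psi (- (t * D t * expR (v / 2 * t ^+ 2))).
  have dphi := is_derive_characteristic t; rewrite DE in dphi.
  have de : is_derive t (1 : R) (fun t : R => expR (v / 2 * t ^+ 2))
      (expR (v / 2 * t ^+ 2) * (v * t)).
    have dq : is_derive t (1 : R) (fun t : R => v / 2 * t ^+ 2) (v * t).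
      by under eq_fun do rewrite expr2; apply: is_derive_eq; rewrite /GRing.scale/=; field.
    by apply: is_derive1_comp.
  by rewrite /psi; apply: is_derive_eq; rewrite /GRing.scale/=; ring.
have cpsi : {within `[0, 1], continuous psi}.
  apply: continuous_subspaceT => t; apply: differentiable_continuous.
  by apply/derivable1_diffP; case: (dpsi t).
have [t t01] := MVT (@ltr01 R) (fun x _ => dpsi x) cpsi.
rewrite subr0 mulr1 => e.
move: t01; rewrite in_itv/= => /andP[t0 t1].
have phi0 : phi 0 = cos a.
  rewrite /phi; under eq_Rintegral do rewrite mul0r add0r.
  exact: expected_cst.
have psi0 : psi 0 = cos a by rewrite /psi expr0n/= mulr0 expR0 mulr1.
have psi1 : psi 1 = phi 1 * expR (v / 2) by rewrite /psi expr1n mulr1.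
have phi1 : \int[P]_w cos (Y w + a) = phi 1.
  by rewrite /phi; under [RHS]eq_Rintegral do rewrite mul1r.
rewrite phi1.
have -> : phi 1 - expR (- v / 2) * cos a = (psi 1 - psi 0) * expR (- (v / 2)).
  rewrite psi1 psi0 mulrBl -mulrA -expRD subrr expR0 mulr1 mulNr; ring.
rewrite e normrM normrN (ger0_norm (expR_ge0 _)) !normrM (gtr0_norm t0) (ger0_norm (expR_ge0 _)).
rewrite -mulrA -expRD -[leRHS]mulr1; apply: ler_pM => //.
- by rewrite mulr_ge0// ltW.
- by rewrite -[leRHS]mul1r; apply: ler_pM => //; exact: ltW.
- rewrite -[leRHS]expR0 ler_expR subr_le0; apply: ler_piMr; first by rewrite divr_ge0.
  by rewrite expr_le1 ?ltW.
Qed.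

End CharacteristicODE.

(** * Multiplicative quadruples *)

Lemma card_fsetM (T U : choiceType) (A : {fset T}) (B : {fset U}) :
  #|` (A `*` B)%fset| = (#|` A| * #|` B|)%N.
Proof.
rewrite -(size_allpairs pair A B); apply: perm_size; apply: uniq_perm.
- exact: fset_uniq.
- by apply: allpairs_uniq => // -[x y] [x' y'].
- move=> [x y]; rewrite in_fsetM/=; apply/andP/allpairsP => [[xA yB]|[[a b] [aA bB [-> ->]]]] //.
  by exists (x, y).
Qed.

Section QuadrupleCounting.
Variable K : fieldType.
Implicit Types (S : {fset {poly K}}) (F G : {poly K}).

Lemma sum_mem_injective_le (T U : eqType) (r : seq T) (q : T -> T -> U) (M : seq U) :
  uniq r -> (forall x y x' y', q x y = q x' y' -> x = x' /\ y = y') ->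
  (\sum_(x <- r) \sum_(y <- r) (q x y \in M) <= size M)%N.
Proof.
move=> ur qinj.
have -> : (\sum_(x <- r) \sum_(y <- r) (q x y \in M) =
    \sum_(u <- [seq q x y | x <- r, y <- r]) (u \in M))%N by rewrite big_allpairs_dep.
rewrite -big_mkcond/= (_ : (\sum_(u <- _ | _) 1)%N = size [seq u <- [seq q x y | x <- r, y <- r] | u \in M]).
  apply: uniq_leq_size; last by move=> u; rewrite mem_filter => /andP[].
  apply/filter_uniq/allpairs_uniq => // -[x y] [x' y'] _ _ /= /qinj[-> ->] //.
by rewrite sum1_count size_filter.
Qed.

Lemma sum_eq_le1 (T : eqType) (r : seq T) (a : T) : uniq r -> (\sum_(y <- r) (y == a) <= 1)%N.
Proof.
move=> ur; rewrite -big_mkcond/= sum1_count (_ : count _ r = count_mem a r)//.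
by rewrite count_uniq_mem// leq_b1.
Qed.

Definition trivial_quadruple (x : ({poly K} * {poly K}) * ({poly K} * {poly K})) : bool :=
  (x.1.1 == x.2.1) && (x.1.2 == x.2.2) || (x.1.1 == x.2.2) && (x.1.2 == x.2.1).

Definition nontrivial_quadruples S :=
  [fset x in multiplicative_quadruples S | ~~ trivial_quadruple x]%fset.

Lemma multiplicative_quadruplesP S F1 F2 G1 G2 :
  ((F1, F2), (G1, G2)) \in multiplicative_quadruples S =
  [&& F1 \in S, F2 \in S, G1 \in S, G2 \in S & F1 * F2 == G1 * G2].
Proof. by rewrite in_fset_filter !in_fsetM/= -!andbA. Qed.

Lemma in_nontrivial_quadruples S x : (x \in nontrivial_quadruples S) =
  (x \in multiplicative_quadruples S) && ~~ trivial_quadruple x.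
Proof. exact: in_fset_filter. Qed.

Lemma nontrivial_quadruplesS S S' : (S `<=` S')%fset ->
  (#|` nontrivial_quadruples S| <= #|` nontrivial_quadruples S'|)%N.
Proof.
move=> /fsubsetP SS; apply/fsubset_leq_card/fsubsetP => -[[F1 F2] [G1 G2]].
rewrite !in_nontrivial_quadruples !multiplicative_quadruplesP => /andP[/and5P[h1 h2 h3 h4 ->] ->].
by rewrite !SS.
Qed.

Lemma card_nontrivial_quadruples S :
  (#|` nontrivial_quadruples S| + 2 * #|` S| ^ 2 <= #|` multiplicative_quadruples S| + #|` S|)%N.
Proof.
pose T1 := [fset (x, x) | x in (S `*` S)]%fset.
pose T2 := [fset (x, (x.2, x.1)) | x in (S `*` S)]%fset.
have c1 : #|` T1| = (#|` S| ^ 2)%N.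
  by rewrite card_in_imfset/= => [|x y _ _ []//]; rewrite [LHS]card_fsetM mulnn.
have c2 : #|` T2| = (#|` S| ^ 2)%N.
  by rewrite card_in_imfset/= => [|x y _ _ []//]; rewrite [LHS]card_fsetM mulnn.
have c3 : (#|` T1 `&` T2|%fset <= #|` S|)%N.
  apply: (@leq_trans #|` [fset ((F, F), (F, F)) | F in S]%fset|).
    apply/fsubset_leq_card/fsubsetP => z; rewrite in_fsetI => /andP[/imfsetP[/= [F G]]].
    rewrite in_fsetM/= => /andP[FS GS] -> /imfsetP[/= [F' G'] _ [eF _ _ eG]].
    by apply/imfsetP; exists F => //=; rewrite eG -eF.
  exact: leq_imfset_card.
have sub : (T1 `|` T2 `|` nontrivial_quadruples S `<=` multiplicative_quadruples S)%fset.
  apply/fsubsetP => z; rewrite !in_fsetU -orbA => /or3P[].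
  - move=> /imfsetP[/= [F G]]; rewrite in_fsetM/= => /andP[FS GS] ->.
    by rewrite multiplicative_quadruplesP FS GS eqxx.
  - move=> /imfsetP[/= [F G]]; rewrite in_fsetM/= => /andP[FS GS] ->.
    by rewrite multiplicative_quadruplesP FS GS mulrC eqxx.
  - by rewrite in_nontrivial_quadruples => /andP[].
have dis : [disjoint (T1 `|` T2)%fset & nontrivial_quadruples S]%fset.
  apply/fdisjointP => z; rewrite in_fsetU in_nontrivial_quadruples negb_and negbK => h.
  apply/orP; right; move: h => /orP[] /imfsetP[/= [F G] _ ->];
    by rewrite /trivial_quadruple/= !eqxx ?orbT.
have := fsubset_leq_card sub; have := (leq_card_fsetU (T1 `|` T2)%fset (nontrivial_quadruples S)).2.
rewrite dis => /eqP->; have := cardfsUI T1 T2.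
move: c1 c2 c3; set n1 := #|` _|; set n2 := #|` _|; set n3 := #|` _|; set n4 := #|` _|.
set n5 := #|` _|; set n6 := #|` _|; set n7 := #|` _|; set m := (_ ^ 2)%N.
by lia.
Qed.

Variables (S : {fset {poly K}}) (r : seq ({poly K} * {poly K})).
Hypotheses (ur : uniq r) (rS : forall x, x \in r -> x.1 \in S /\ x.2 \in S).

Let NT := nontrivial_quadruples S.

Lemma sum_eq_size (h : {poly K} * {poly K} -> {poly K} * {poly K}) :
  (\sum_(x <- r) \sum_(y <- r) (y == h x) <= size r)%N.
Proof.
apply: (@leq_trans (\sum_(x <- r) 1)%N); last by rewrite sum1_size.
by apply: leq_sum => x _; exact: sum_eq_le1.
Qed.

Lemma offdiagonal_pairs_count : (forall x, x \in r -> x.1 != x.2) ->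
  (\sum_(x <- r) \sum_(y <- r)
     ((x.1 * y.2 == x.2 * y.1)%R + (x.1 * y.1 == x.2 * y.2)%R) <=
   2 * size r + 2 * #|` NT|)%N.
Proof.
move=> off.
pose q1 (x y : {poly K} * {poly K}) := ((x.1, y.2), (x.2, y.1)).
pose q2 (x y : {poly K} * {poly K}) := ((x.1, y.1), (x.2, y.2)).
apply: (@leq_trans (\sum_(x <- r) \sum_(y <- r)
   (((y == x) + (q1 x y \in (NT : seq _))) + ((y == (x.2, x.1)) + (q2 x y \in (NT : seq _)))))%N).
  rewrite big_seq [leqRHS]big_seq; apply: leq_sum => -[a b] xr.
  rewrite big_seq [leqRHS]big_seq; apply: leq_sum => -[a' b'] yr.
  have [aS bS] := rS xr; have [aS' bS'] := rS yr; have /= ab := off _ xr.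
  apply: leq_add.
    case: (boolP (_ == _)) => // e; case: (boolP ((a', b') == (a, b))) => // ne.
    rewrite add0n lt0b /q1 in_nontrivial_quadruples multiplicative_quadruplesP/= aS bS' bS aS' e/=.
    rewrite /trivial_quadruple/= (negPf ab)/=; apply: contra ne => /andP[/eqP-> /eqP->].
    exact: eqxx.
  case: (boolP (_ == _)) => // e; case: (boolP ((a', b') == (b, a))) => // ne.
  rewrite add0n lt0b /q2 in_nontrivial_quadruples multiplicative_quadruplesP/= aS bS' bS aS' e/=.
  rewrite /trivial_quadruple/= (negPf ab)/=; apply: contra ne => /andP[/eqP-> /eqP->].
  exact: eqxx.
under eq_bigr do rewrite !big_split/=.
rewrite !big_split/= !mul2n -!addnn addnACA; apply: leq_add; apply: leq_add.
- exact: (sum_eq_size id).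
- exact: (sum_eq_size (fun x => (x.2, x.1))).
- apply: sum_mem_injective_le => // -[a b] [a' b'] [a1 b1] [a1' b1'].
  by rewrite /q1/= => -[-> -> -> ->].
- apply: sum_mem_injective_le => // -[a b] [a' b'] [a1 b1] [a1' b1'].
  by rewrite /q2/= => -[-> -> -> ->].
Qed.

Lemma all_pairs_count :
  (\sum_(x <- r) \sum_(y <- r) (x.1 * x.2 == y.1 * y.2)%R <= 2 * size r + #|` NT|)%N.
Proof.
pose q (x y : {poly K} * {poly K}) := (x, y).
apply: (@leq_trans (\sum_(x <- r) \sum_(y <- r)
   ((y == x) + (y == (x.2, x.1)) + (q x y \in (NT : seq _))))%N).
  rewrite big_seq [leqRHS]big_seq; apply: leq_sum => -[a b] xr.
  rewrite big_seq [leqRHS]big_seq; apply: leq_sum => -[a' b'] yr.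
  have [aS bS] := rS xr; have [aS' bS'] := rS yr.
  case: (boolP (_ == _)) => // e; case: (boolP ((a', b') == (a, b))) => // n1.
  case: (boolP ((a', b') == (b, a))) => // n2.
  rewrite !add0n lt0b /q in_nontrivial_quadruples multiplicative_quadruplesP/= aS bS' bS aS' e/=.
  rewrite /trivial_quadruple/= negb_or; apply/andP; split.
    by apply: contra n1 => /andP[/eqP-> /eqP->].
  by apply: contra n2 => /andP[/eqP-> /eqP->].
under eq_bigr do rewrite !big_split/=.
rewrite !big_split/= mul2n -addnn; apply: leq_add; first apply: leq_add.
- exact: (sum_eq_size id).
- exact: (sum_eq_size (fun x => (x.2, x.1))).
- by apply: sum_mem_injective_le => // x y x' y' [-> ->].
Qed.

End QuadrupleCounting.

(** * Steinhaus functions *)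

Lemma measurable_steinhaus_preimage {d : measure_display} {T : measurableType d}
    {R : realType} (P : probability T R) (K : fieldType) (f : {poly K} -> T -> R[i])
    Q (B : set (R * R)) : steinhaus P f -> monic_irreducible Q -> measurable B ->
  measurable ((coords \o f Q) @^-1` B).
Proof.
move=> f_steinhaus irrQ mB; rewrite -[X in measurable X]setTI.
exact: (steinhaus_measurable f_steinhaus irrQ).
Qed.

Section SteinhausModification.
Context {d : measure_display} {T : measurableType d} {R : realType}.
Variables (P : probability T R) (K : finFieldType) (f : {poly K} -> T -> R[i]).
Hypothesis f_steinhaus : steinhaus P f.

Lemma steinhaus_unit_ae : {ae P, forall w Q, monic_irreducible Q -> sqnorm (f Q w) = 1}.
Proof.
pose A n := fun w => if choice.unpickle n is Some Q then
  monic_irreducible Q -> sqnorm (f Q w) = 1 else True.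
have : {ae P, forall w n, A n w}.
  apply: ae_foralln => n; rewrite /A.
  case: (choice.unpickle n) => [Q|]; last exact: aeW.
  have [irrQ|nirr] := pselect (monic_irreducible Q); last by apply: aeW => w /nirr.
  pose C := [set x : R * R | x.1 ^+ 2 + x.2 ^+ 2 = 1].
  have mC : measurable C.
    have mf : measurable_fun setT (fun x : R * R => x.1 ^+ 2 + x.2 ^+ 2).
      by apply: measurable_funD; apply: measurable_funX; [exact: measurable_fst|exact: measurable_snd].
    by have := mf measurableT [set 1] (measurable_set1 _); rewrite setTI.
  exists ((coords \o f Q) @^-1` (~` C)); split.
  - by apply: (measurable_steinhaus_preimage f_steinhaus) => //; exact: measurableC.
  - apply: (eq_trans (steinhaus_uniform f_steinhaus irrQ (measurableC mC))).
    rewrite /uniform_circle (_ : [set t | _] = set0) ?measure0//.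
    by rewrite -subset0 => t; apply; rewrite /C/= cos2Dsin2.
  - by move=> w /= h C1; apply: h => _.
move=> [N [mN N0 NA]]; exists N; split => // w /= h; apply: NA => /= h'.
by apply: h => Q irrQ; have := h' (choice.pickle Q); rewrite /A choice.pickleK; exact.
Qed.

Lemma measure_eq_off_null (N A B : set T) : measurable N -> P N = 0%E ->
  measurable A -> measurable B -> (forall w, ~ N w -> A w <-> B w) -> P A = P B.
Proof.
move=> mN N0; have le (X Y : set T) : measurable X -> measurable Y ->
    (forall w, ~ N w -> X w -> Y w) -> (P X <= P Y)%E.
  move=> mX mY XY; rewrite -[leRHS]adde0 -N0.
  apply: (@le_trans _ _ (P (Y `|` N))); last exact: measureU2.
  apply: le_measure; rewrite ?inE//; first exact: measurableU.
  by move=> w Xw; have [Nw|nNw] := pselect (N w); [right|left; exact: XY].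
by move=> mA mB AB; apply/eqP; rewrite eq_le !le// => w nN /(AB w nN).
Qed.

Lemma steinhaus_unit_modification : exists (g : {poly K} -> T -> R[i]) (N : set T),
  [/\ steinhaus P g, forall Q w, monic_irreducible Q -> sqnorm (g Q w) = 1,
      measurable N, P N = 0%E & forall Q w, ~ N w -> g Q w = f Q w].
Proof.
have [N [mN N0 NA]] := steinhaus_unit_ae.
pose g Q w : R[i] := if w \in N then 1 else f Q w.
have gf Q w : ~ N w -> g Q w = f Q w.
  by move=> nN; rewrite /g memNset.
have pre_g Q (B : set (R * R)) : monic_irreducible Q -> measurable B ->
    measurable ((coords \o g Q) @^-1` B).
  move=> irrQ mB.
  have -> : (coords \o g Q) @^-1` B =
      (N `&` [set _ | B (coords (1 : R[i]))]) `|` ((coords \o f Q) @^-1` B `\` N).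
    apply/seteqP; split => w /=; rewrite /g.
      by case: ifPn; rewrite ?(inE, notin_setE) => h b; [left|right].
    by case: ifPn; rewrite ?(inE, notin_setE) => h [[]|[]].
  have mc (p : Prop) : measurable [set _ : T | p].
    have [hp|hp] := pselect p; first by rewrite (_ : mkset _ = setT)//; apply/seteqP; split.
    by rewrite (_ : mkset _ = set0)//; apply/seteqP; split.
  apply: measurableU; first by apply: measurableI => //; exact: mc.
  by apply: measurableD => //; exact: (measurable_steinhaus_preimage f_steinhaus).
exists g, N; split => //.
- split.
  + by move=> Q irrQ _ B mB; rewrite setTI; exact: pre_g.
  + move=> Q irrQ B mB; rewrite -(steinhaus_uniform f_steinhaus irrQ mB).
    apply: (@measure_eq_off_null N) => //; first exact: pre_g.
      exact: (measurable_steinhaus_preimage f_steinhaus).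
    by move=> w nN /=; rewrite gf.
  + move=> J B Jirr mB.
    have := steinhaus_independent f_steinhaus Jirr mB.
    rewrite (@measure_eq_off_null N _ (\bigcap_(i in [set` J]) (coords \o g i) @^-1` B i))//.
    * move=> ->; rewrite big_seq [RHS]big_seq; apply: eq_bigr => Q QJ.
      apply: (@measure_eq_off_null N) => //.
      - by apply: (measurable_steinhaus_preimage f_steinhaus); [exact: Jirr|exact: mB].
      - by apply: pre_g; [exact: Jirr|exact: mB].
      - by move=> w nN /=; rewrite gf.
    * by apply: fin_bigcap_measurable => // Q QJ; apply: (measurable_steinhaus_preimage f_steinhaus); [exact: Jirr|exact: mB].
    * by apply: fin_bigcap_measurable => // Q QJ; apply: pre_g; [exact: Jirr|exact: mB].
    * by move=> w nN; split => h Q QJ; have := h Q QJ; rewrite /= gf.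
  + by move=> w; rewrite /g; case: ifP => // _; exact: (steinhaus_one f_steinhaus).
  + move=> s a w sirr; rewrite /g; case: ifP => _.
      by rewrite big1// => Q _; rewrite expr1n.
    exact: (steinhaus_factorization f_steinhaus).
- move=> Q w irrQ; rewrite /g; case: ifPn => [_|].
    by rewrite /sqnorm/= expr1n expr0n addr0.
  by rewrite notin_setE => nN; apply: contrapT => h; apply: nN; apply: NA => /(_ Q irrQ).
Qed.

End SteinhausModification.

Section SteinhausUnit.
Context {d : measure_display} {T : measurableType d} {R : realType}.
Variables (P : probability T R) (K : fieldType) (f : {poly K} -> T -> R[i]).
Hypothesis f_steinhaus : steinhaus P f.
Hypothesis f_unit : forall Q w, monic_irreducible Q -> sqnorm (f Q w) = 1.
Implicit Types (F G Q : {poly K}).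

Lemma steinhaus_mul F G w : F \is monic -> G \is monic -> f (F * G) w = f F w * f G w.
Proof.
move=> mF mG; have [s [a [b [sirr FE GE]]]] := monic_factorization2 mF mG.
have fact := steinhaus_factorization f_steinhaus.
rewrite {2}FE {2}GE !fact// -big_split/= -[RHS]/(\prod_(Q <- s) _).
rewrite {1}FE {1}GE -big_split/= (eq_bigr (fun Q => Q ^+ (a Q + b Q))); last first.
  by move=> Q _; rewrite exprD.
by rewrite fact//; apply: eq_bigr => Q _; rewrite exprD.
Qed.

Lemma sqnorm_prod (I : eqType) (s : seq I) (x : I -> R[i]) :
  (forall i, i \in s -> sqnorm (x i) = 1) -> sqnorm (\prod_(i <- s) x i) = 1.
Proof.
elim: s => [|i s IH] h; first by rewrite big_nil /sqnorm/= expr1n expr0n addr0.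
rewrite big_cons sqnormM h ?mem_head// mul1r IH// => j js.
by apply: h; rewrite in_cons js orbT.
Qed.

Lemma sqnormX (x : R[i]) n : sqnorm x = 1 -> sqnorm (x ^+ n) = 1.
Proof.
move=> x1; elim: n => [|n IH]; first by rewrite expr0 /sqnorm/= expr1n expr0n addr0.
by rewrite exprS sqnormM x1 IH mulr1.
Qed.

Lemma steinhaus_sqnorm F w : F \is monic -> sqnorm (f F w) = 1.
Proof.
move=> /monic_factorization[s [a [sirr ->]]].
rewrite (steinhaus_factorization f_steinhaus)//; apply: sqnorm_prod => Q Qs.
by apply: sqnormX; apply: f_unit; exact: sirr.
Qed.

Lemma steinhaus_complex_measurable F : F \is monic -> complex_measurable (f F).
Proof.
move=> /monic_factorization[s [a [sirr ->]]].
rewrite (_ : f _ = (fun w => \prod_(Q <- s) f Q w ^+ a Q)); last first.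
  by apply/funext => w; rewrite (steinhaus_factorization f_steinhaus).
apply: complex_measurable_prod => Q Qs; apply: complex_measurableX.
by apply/complex_measurableE; apply: (steinhaus_measurable f_steinhaus); exact: sirr.
Qed.

Section OtherPrimes.
Variable Q0 : {poly K}.
Hypothesis irrQ0 : monic_irreducible Q0.

Definition other_events : set (set T) := [set A | exists (J : {fset {poly K}})
  (B : {poly K} -> set (R * R)), [/\ [set` J] `<=` [set Q | monic_irreducible Q],
    Q0 \notin J, forall Q, measurable (B Q) &
    A = \bigcap_(Q in [set` J]) (coords \o f Q) @^-1` B Q]].

Lemma other_eventsT : other_events setT.
Proof.
exists fset0, (fun=> setT); split => //.
by apply/esym; rewrite -subTset => w _ Q _.
Qed.

Lemma other_eventsI : setI_closed other_events.
Proof.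
move=> _ _ [J [B [Jirr J0 mB ->]]] [J' [B' [Jirr' J0' mB' ->]]].
exists (J `|` J')%fset, (fun Q => (if Q \in J then B Q else setT) `&`
  (if Q \in J' then B' Q else setT)); split.
- by move=> Q /=; rewrite in_fsetU => /orP[]; [exact: Jirr|exact: Jirr'].
- by rewrite in_fsetU negb_or J0.
- by move=> Q; apply: measurableI; case: ifP.
- apply/seteqP; split => [w [h h'] Q /= _|w h].
    by split; case: ifP => // QJ; [exact: h|exact: h'].
  split => Q /= QJ; have := h Q; rewrite /= in_fsetU QJ ?orbT => /(_ isT).
    by case.
  by case.
Qed.

Lemma other_events_measurable : other_events `<=` measurable.
Proof.
move=> _ [J [B [Jirr J0 mB ->]]].
apply: fin_bigcap_measurable => // Q QJ; apply: (measurable_steinhaus_preimage f_steinhaus) => //.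
exact: Jirr.
Qed.

Lemma other_events_independent (B : set (R * R)) (A : set T) : measurable B ->
  other_events A ->
  P ((coords \o f Q0) @^-1` B `&` A) = (P ((coords \o f Q0) @^-1` B) * P A)%E.
Proof.
move=> mB [J [C [Jirr J0 mC ->]]].
have ind := steinhaus_independent f_steinhaus.
pose C' Q := if Q == Q0 then B else C Q.
have C'J Q : Q \in J -> C' Q = C Q.
  by rewrite /C'; case: eqP => // ->; rewrite (negPf J0).
have mC' Q : measurable (C' Q) by rewrite /C'; case: ifP.
rewrite (_ : _ `&` _ = \bigcap_(Q in [set` (Q0 |` J)%fset]) (coords \o f Q) @^-1` C' Q).
  rewrite ind => [|Q /=|//]; last by rewrite in_fset1U => /orP[/eqP->//|/Jirr].
  rewrite big_fsetU1//= {1}/C' eqxx; congr (_ * _)%E.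
  rewrite ind//; rewrite big_seq [RHS]big_seq; apply: eq_bigr => Q QJ.
  by rewrite C'J.
apply/seteqP; split => [w [hB hJ] Q /=|w h].
  by rewrite in_fset1U => /orP[/eqP->|QJ]; [rewrite /C' eqxx|rewrite C'J//; exact: hJ].
split; first by have := h Q0; rewrite /= fset1U1 /C' eqxx; exact.
by move=> Q QJ; have := h Q; rewrite /= C'J// in_fset1U; apply; apply/orP; right.
Qed.

Local Notation TG := (g_sigma_algebraType other_events).

Definition free_of F := exists (s : {fset {poly K}}) (a : {poly K} -> nat),
  [/\ forall Q, Q \in s -> monic_irreducible Q, Q0 \notin s & F = \prod_(Q <- s) Q ^+ a Q].

Lemma free_of_monic F : free_of F -> F \is monic.
Proof.
move=> [s [a [sirr _ ->]]]; rewrite big_seq; apply: monic_prod => Q Qs.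
by apply: monic_exp; case: (sirr _ Qs).
Qed.

Lemma nondivisible_free_of F : F \is monic -> ~~ (Q0 %| F) -> free_of F.
Proof.
move=> /monic_factorization[s [a [sirr FE]]] ndiv.
have [Q0s|Q0s] := boolP (Q0 \in s); last by exists s, a.
exists (s `\ Q0)%fset, a; split.
- by move=> Q; rewrite in_fsetD1 => /andP[_ /sirr].
- by rewrite in_fsetD1 eqxx.
- rewrite FE (big_fsetD1 Q0)//=; have [->|a0] := posnP (a Q0); first by rewrite expr0 mul1r.
  by move: ndiv; rewrite FE (big_fsetD1 Q0)//= -(prednK a0) exprS -mulrA dvdp_mulr.
Qed.

Lemma free_of_complex_measurable F : free_of F ->
  complex_measurable (fun w : TG => f F w).
Proof.
move=> [s [a [sirr Q0s ->]]].
rewrite (_ : (fun w : TG => _) = (fun w => \prod_(Q <- s) f Q w ^+ a Q)); last first.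
  by apply/funext => w; rewrite (steinhaus_factorization f_steinhaus).
apply: complex_measurable_prod => Q Qs; apply: complex_measurableX.
apply/complex_measurableE => _ B mB; rewrite setTI.
apply: sub_sigma_algebra; exists [fset Q]%fset, (fun=> B); split => //.
- by move=> Q' /=; rewrite in_fset1 => /eqP->; exact: sirr.
- by rewrite in_fset1; apply: contraNneq Q0s => ->.
- apply/seteqP; split => [w h Q' /=|w h].
    by rewrite in_fset1 => /eqP->.
  by apply: h; rewrite /= in_fset1.
Qed.

End OtherPrimes.

Lemma steinhaus_circle Q0 w : monic_irreducible Q0 ->
  (coords (f Q0 w)).1 ^+ 2 + (coords (f Q0 w)).2 ^+ 2 = 1.
Proof. exact: f_unit. Qed.

Lemma steinhaus_bounded_rv (c : R[i]) F : F \is monic ->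
  bounded_rv (fun w => complex.Re (c * f F w)) /\
  bounded_rv (fun w => complex.Im (c * f F w)).
Proof.
move=> mF; have m1 := steinhaus_complex_measurable mF.
have [mr mi] := complex_measurableM (complex_measurable_cst c) m1.
have bd w : sqnorm (c * f F w) <= (1 + sqnorm c) ^+ 2.
  rewrite sqnormM steinhaus_sqnorm// mulr1 sqrrD !expr1n mul1r.
  by have := sqr_ge0 (sqnorm c); have : 0 <= sqnorm c by [rewrite addr_ge0 ?sqr_ge0]; lra.
have c0 : 0 <= 1 + sqnorm c by rewrite !addr_ge0 ?sqr_ge0.
split; split => //; exists (1 + sqnorm c) => w; [exact: norm_re_le|exact: norm_im_le].
Qed.

Lemma steinhaus_orthogonal_gt (c : R[i]) F G (s : {fset {poly K}}) (a b : {poly K} -> nat) Q0 :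
  (forall Q, Q \in s -> monic_irreducible Q) ->
  F = \prod_(Q <- s) Q ^+ a Q -> G = \prod_(Q <- s) Q ^+ b Q ->
  Q0 \in s -> (b Q0 < a Q0)%N ->
  \int[P]_w complex.Re (c * (f F w * conjc (f G w))) = 0.
Proof.
move=> sirr FE GE Q0s ab.
have irrQ0 := sirr _ Q0s.
have free (e : {poly K} -> nat) : free_of Q0 (\prod_(Q <- s `\ Q0) Q ^+ e Q)%fset.
  exists (s `\ Q0)%fset, e; split => //.
    by move=> Q; rewrite in_fsetD1 => /andP[_ /sirr].
  by rewrite in_fsetD1 eqxx.
have [mQ0 _] := irrQ0.
have split_f (e : {poly K} -> nat) w :
    f (\prod_(Q <- s) Q ^+ e Q) w = f Q0 w ^+ e Q0 * f (\prod_(Q <- s `\ Q0) Q ^+ e Q)%fset w.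
  rewrite (big_fsetD1 Q0)//= steinhaus_mul ?monic_exp//; last exact: free_of_monic (free e).
  congr (_ * _); have := @steinhaus_factorization _ _ _ _ _ _ f_steinhaus [fset Q0]%fset (fun=> e Q0) w.
  by rewrite !big_seq_fset1; apply => Q; rewrite in_fset1 => /eqP->.
set F' := (\prod_(Q <- s `\ Q0) Q ^+ a Q)%fset; set G' := (\prod_(Q <- s `\ Q0) Q ^+ b Q)%fset.
have mF' : F' \is monic by exact: free_of_monic (free a).
have mG' : G' \is monic by exact: free_of_monic (free b).
pose g w := c * (f F' w * conjc (f G' w)).
have gE w : c * (f F w * conjc (f G w)) = f Q0 w ^+ (a Q0 - b Q0) * g w.
  rewrite FE GE !split_f -/F' -/G' rmorphM rmorphXn -{1}(subnK (ltnW ab)) exprD /g.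
  have z1 : f Q0 w ^+ b Q0 * conjc (f Q0 w) ^+ b Q0 = 1.
    rewrite -exprMn; have := f_unit w irrQ0; case: (f Q0 w) => x y /= xy.
    rewrite (_ : _ * _ = 1) ?expr1n//.
    by apply/eqP; rewrite eq_complex/=; apply/andP; split; apply/eqP; [rewrite -xy /sqnorm/=; ring|ring].
  rewrite -[RHS]mulr1 -z1; ring.
under eq_Rintegral do rewrite gE.
have gb w : sqnorm (g w) <= (1 + sqnorm c) ^+ 2.
  rewrite /g !sqnormM sqnorm_conj !steinhaus_sqnorm// !mulr1 sqrrD !expr1n mul1r.
  by have := sqr_ge0 (sqnorm c); have : 0 <= sqnorm c by [rewrite addr_ge0 ?sqr_ge0]; lra.
have c0 : 0 <= 1 + sqnorm c by rewrite !addr_ge0 ?sqr_ge0.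
have mg : complex_measurable (g : g_sigma_algebraType (other_events Q0) -> R[i]).
  apply: complex_measurableM; first exact: complex_measurable_cst.
  apply: complex_measurableM; first exact: free_of_complex_measurable (free a).
  have [m1 m2] := free_of_complex_measurable (free b).
  split; first by under eq_fun do rewrite re_conj.
  by under eq_fun do rewrite im_conj; exact: measurableT_comp.
have := @circle_power_mean0 _ _ _ P (coords \o f Q0) (other_events Q0)
  (steinhaus_measurable f_steinhaus irrQ0) (@steinhaus_uniform _ _ _ _ _ _ f_steinhaus Q0 irrQ0)
  (other_eventsT Q0) (@other_eventsI Q0) (@other_events_measurable Q0)
  (@other_events_independent Q0 irrQ0) (fun w => steinhaus_circle w irrQ0)
  (a Q0 - b Q0)%N g (1 + sqnorm c).
rewrite subn_gt0 => /(_ ab mg) <-.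
- by apply: eq_Rintegral => w _ /=; case: (f Q0 w).
- by move=> w; exact: norm_re_le.
- by move=> w; exact: norm_im_le.
Qed.

Lemma steinhaus_orthogonal (c : R[i]) F G : F \is monic -> G \is monic -> F <> G ->
  \int[P]_w complex.Re (c * (f F w * conjc (f G w))) = 0.
Proof.
move=> mF mG FG; have [s [a [b [sirr FE GE]]]] := monic_factorization2 mF mG.
have [Q0 Q0s ab] : exists2 Q, Q \in s & a Q != b Q.
  apply: contrapT => /forall2NP h; apply: FG; rewrite FE GE.
  rewrite big_seq [RHS]big_seq; apply: eq_bigr => Q Qs.
  by case: (h Q) => [//|/negP]; rewrite negbK => /eqP->.
have [ab1|ab1|/eqP] := ltngtP (a Q0) (b Q0); last by rewrite (negPf ab).
  rewrite -[RHS](steinhaus_orthogonal_gt (conjc c) sirr GE FE Q0s ab1).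
  apply: eq_Rintegral => w _; rewrite -re_conj !rmorphM/= conjcK.
  by rewrite [conjc (f F w) * _]mulrC.
exact: (steinhaus_orthogonal_gt c sirr FE GE Q0s ab1).
Qed.

Lemma steinhaus_integration_by_parts (c : R[i]) (Q0 F : {poly K}) (s : {fset {poly K}}) (t a : R) :
  monic_irreducible Q0 -> F \is monic -> Q0 %| F -> ~~ (Q0 ^+ 2 %| F) ->
  (forall G, G \in s -> G \is monic /\ ~~ (Q0 ^+ 2 %| G)) ->
  let Y w := \sum_(G <- s) complex.Re (c * f G w) in
  \int[P]_w (complex.Re (c * f F w) * sin (t * Y w + a)) =
  t * \int[P]_w (complex.Im (c * f F w) *
      (\sum_(G <- s | Q0 %| G) complex.Im (c * f G w)) * cos (t * Y w + a)).
Proof.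
move=> irrQ0 mF Q0F nF sG Y; have [mQ0 _] := irrQ0.
have quot G : G \is monic -> Q0 %| G -> ~~ (Q0 ^+ 2 %| G) ->
    [/\ G %/ Q0 \is monic, free_of Q0 (G %/ Q0) & forall w, f G w = f Q0 w * f (G %/ Q0) w].
  move=> mG Q0G nG; have GE : G = (G %/ Q0) * Q0 by apply/eqP; rewrite -Pdiv.IdomainMonic.dvdp_eq.
  have mq : G %/ Q0 \is monic by move: (mG); rewrite {1}GE monicMr.
  split => //; last by move=> w; rewrite {1}GE steinhaus_mul// mulrC.
  apply: nondivisible_free_of => //; apply: contra nG => h.
  by rewrite GE expr2 dvdp_mul.
pose p w := c * f (F %/ Q0) w.
pose u w := \sum_(G <- s | Q0 %| G) c * f (G %/ Q0) w.
pose r w := \sum_(G <- s | ~~ (Q0 %| G)) complex.Re (c * f G w).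
pose z w := coords (f Q0 w).
have decomp w (x : R[i]) : c * (f Q0 w * x) = f Q0 w * (c * x) by rewrite mulrCA.
have FE w : c * f F w = f Q0 w * p w.
  by have [_ _ ->] := quot F mF Q0F nF; rewrite decomp.
have uE w : \sum_(G <- s | Q0 %| G) c * f G w = f Q0 w * u w.
  rewrite /u mulr_sumr big_seq_cond [RHS]big_seq_cond; apply: eq_bigr => G /andP[Gs Q0G].
  by have [mG nG] := sG _ Gs; have [_ _ ->] := quot G mG Q0G nG; rewrite decomp.
have YE w : Y w = (z w).1 * complex.Re (u w) - (z w).2 * complex.Im (u w) + r w.
  rewrite /Y (bigID (fun G => Q0 %| G))/= -re_sum uE -/(r w) reM.
  by [].
have bdd G : free_of Q0 G -> bounded_rv (fun w : g_sigma_algebraType (other_events Q0) => complex.Re (c * f G w)) /\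
   bounded_rv (fun w : g_sigma_algebraType (other_events Q0) => complex.Im (c * f G w)).
  move=> frG; have [mr mi] := complex_measurableM (complex_measurable_cst c) (free_of_complex_measurable frG).
  have [[_ [M HM]] [_ [N HN]]] := steinhaus_bounded_rv c (free_of_monic frG).
  by split; split => //; [exists M|exists N].
have [bp1 bp2] := bdd _ (let: And3 _ h _ := quot F mF Q0F nF in h).
have bu1 : bounded_rv (fun w : g_sigma_algebraType (other_events Q0) => complex.Re (u w)).
  rewrite /u; under eq_fun do rewrite re_sum -big_filter.
  apply: bounded_rv_sum => G; rewrite mem_filter => /andP[Q0G Gs].
  by have [mG nG] := sG _ Gs; have [_ h _] := quot G mG Q0G nG; case: (bdd _ h).
have bu2 : bounded_rv (fun w : g_sigma_algebraType (other_events Q0) => complex.Im (u w)).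
  rewrite /u; under eq_fun do rewrite im_sum -big_filter.
  apply: bounded_rv_sum => G; rewrite mem_filter => /andP[Q0G Gs].
  by have [mG nG] := sG _ Gs; have [_ h _] := quot G mG Q0G nG; case: (bdd _ h).
have br : bounded_rv (r : g_sigma_algebraType (other_events Q0) -> R).
  rewrite /r; under eq_fun do rewrite -big_filter.
  apply: bounded_rv_sum => G; rewrite mem_filter => /andP[Q0G Gs].
  by have [mG nG] := sG _ Gs; case: (bdd _ (nondivisible_free_of mG Q0G)).
have := @circle_integration_by_parts _ _ _ P (coords \o f Q0) (other_events Q0)
  (steinhaus_measurable f_steinhaus irrQ0) (@steinhaus_uniform _ _ _ _ _ _ f_steinhaus Q0 irrQ0)
  (other_eventsT Q0) (@other_eventsI Q0) (@other_events_measurable Q0)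
  (@other_events_independent Q0 irrQ0) (fun w => steinhaus_circle w irrQ0)
  _ _ _ _ _ t a bp1 bp2 bu1 bu2 br.
have [bF1 bF2] := steinhaus_bounded_rv c mF.
have bY : bounded_rv Y.
  by apply: bounded_rv_sum => G Gs; have [mG _] := sG _ Gs; case: (steinhaus_bounded_rv c mG).
have bT : bounded_rv (fun w => t * Y w + a).
  by apply: bounded_rvD; [exact: bounded_rvZ|exact: bounded_rv_cst].
have bS : bounded_rv (fun w => \sum_(G <- s | Q0 %| G) complex.Im (c * f G w)).
  under eq_fun do rewrite -big_filter.
  apply: bounded_rv_sum => G; rewrite mem_filter => /andP[Q0G Gs].
  by have [mG _] := sG _ Gs; case: (steinhaus_bounded_rv c mG).
have bA : bounded_rv (fun w => complex.Re (c * f F w) * sin (t * Y w + a)).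
  by apply: bounded_rvM => //; exact: bounded_rv_sin.
have bB : bounded_rv (fun w => complex.Im (c * f F w) *
      (\sum_(G <- s | Q0 %| G) complex.Im (c * f G w)) * cos (t * Y w + a)).
  by apply: bounded_rvM; [exact: bounded_rvM|exact: bounded_rv_cos].
rewrite -expectedZ// => h; apply/eqP; rewrite -subr_eq0 -expectedB//; last exact: bounded_rvZ.
apply/eqP; rewrite -[RHS]h; apply: eq_Rintegral => w _.
rewrite YE -im_sum uE FE reM !imM -/(z w).1 -/(z w).2 /=; ring.
Qed.

Lemma steinhaus_bounded_rv2 (c : R[i]) F G : F \is monic -> G \is monic ->
  bounded_rv (fun w => complex.Re (c * (f F w * conjc (f G w)))).
Proof.
move=> mF mG.
have [m1 m2] := steinhaus_complex_measurable mG.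
have mGc : complex_measurable (fun w => conjc (f G w)).
  split; first by under eq_fun do rewrite re_conj.
  by under eq_fun do rewrite im_conj; exact: measurableT_comp.
have [mr _] := complex_measurableM (complex_measurable_cst c)
  (complex_measurableM (steinhaus_complex_measurable mF) mGc).
split => //; exists (1 + sqnorm c) => w; apply: norm_re_le.
  by rewrite !addr_ge0 ?sqr_ge0.
rewrite !sqnormM sqnorm_conj !steinhaus_sqnorm// !mulr1 sqrrD !expr1n mul1r.
by have := sqr_ge0 (sqnorm c); have : 0 <= sqnorm c by [rewrite addr_ge0 ?sqr_ge0]; lra.
Qed.

Lemma steinhaus_mean_le (c : R[i]) (M : R) F G : F \is monic -> G \is monic ->
  complex.Re c <= M -> \int[P]_w complex.Re (c * (f F w * conjc (f G w))) <= M * (F == G)%:R.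
Proof.
move=> mF mG cM; case: eqP => [<-|FG]; last by rewrite steinhaus_orthogonal// mulr0.
rewrite mulr1; have -> : \int[P]_w complex.Re (c * (f F w * conjc (f F w))) = \int[P]_w complex.Re c.
  apply: eq_Rintegral => w _; have := steinhaus_sqnorm w mF.
  case: (f F w) => x y; rewrite /sqnorm/= => xy.
  have -> : (x +i* y)%C * (x -i* y)%C = 1.
    by apply/eqP; rewrite eq_complex/=; apply/andP; split; apply/eqP; [rewrite -xy; ring|ring].
  by rewrite mulr1.
by rewrite expected_cst.
Qed.

Lemma steinhaus_second_moment (I : eqType) (r : seq I) (H L : I -> {poly K}) (c : R[i]) :
  (forall i, i \in r -> H i \is monic /\ L i \is monic) ->
  \int[P]_w ((\sum_(i <- r) complex.Re (c * (f (H i) w * conjc (f (L i) w)))) ^+ 2) <=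
  sqnorm c * (\sum_(i <- r) \sum_(j <- r)
    ((H i * L j == L i * H j)%R + (H i * H j == L i * L j)%R))%:R.
Proof.
move=> mHL.
pose x i w := complex.Re (c * (f (H i) w * conjc (f (L i) w))).
have bx i : i \in r -> bounded_rv (x i).
  by move=> ir; have [mH mL] := mHL i ir; exact: steinhaus_bounded_rv2.
have -> : \int[P]_w ((\sum_(i <- r) x i w) ^+ 2) =
    \sum_(i <- r) \sum_(j <- r) \int[P]_w (x i w * x j w).
  under eq_Rintegral do rewrite expr2 mulr_suml.
  rewrite expected_sum; last first.
    by move=> i ir; apply: bounded_rvM; [exact: bx|exact: bounded_rv_sum].
  rewrite big_seq [RHS]big_seq; apply: eq_bigr => i ir.
  under eq_Rintegral do rewrite mulr_sumr.
  by rewrite expected_sum// => j jr; apply: bounded_rvM; exact: bx.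
rewrite natr_sum mulr_sumr big_seq [leRHS]big_seq; apply: ler_sum => i ir.
rewrite natr_sum mulr_sumr big_seq [leRHS]big_seq; apply: ler_sum => j jr.
have mM (F G : {poly K}) : F \is monic -> G \is monic -> F * G \is monic.
  by move=> mF mG; rewrite monicMl.
have [mHi mLi] := mHL i ir; have [mHj mLj] := mHL j jr.
have sq0 : 0 <= sqnorm c by rewrite addr_ge0 ?sqr_ge0.
have re2 : complex.Re (c * c) <= sqnorm c.
  by rewrite reM /sqnorm; have := sqr_ge0 (complex.Im c); lra.
have E1 := steinhaus_mean_le (mM _ _ mHi mHj) (mM _ _ mLi mLj) re2.
have E2 := @steinhaus_mean_le (sqnorm c)%:C%C (sqnorm c) _ _ (mM _ _ mHi mLj) (mM _ _ mLi mHj) (lexx _).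
have b1 : bounded_rv (fun w => complex.Re ((c * c) * (f (H i * H j) w * conjc (f (L i * L j) w)))).
  by apply: steinhaus_bounded_rv2; rewrite monicMl.
have b2 : bounded_rv (fun w => complex.Re ((sqnorm c)%:C%C * (f (H i * L j) w * conjc (f (L i * H j) w)))).
  by apply: steinhaus_bounded_rv2; rewrite monicMl.
have -> : \int[P]_w (x i w * x j w) = 2^-1 * (
    \int[P]_w complex.Re ((c * c) * (f (H i * H j) w * conjc (f (L i * L j) w))) +
    \int[P]_w complex.Re ((sqnorm c)%:C%C * (f (H i * L j) w * conjc (f (L i * H j) w)))).
  rewrite -expectedD// -expectedZ; last exact: bounded_rvD.
  apply: eq_Rintegral => w _; rewrite /x !steinhaus_mul//.
  move: (f (H i) w) (f (L i) w) (f (H j) w) (f (L j) w) => [h1 h2] [l1 l2] [k1 k2] [m1 m2].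
  by case: (c) => c1 c2; rewrite /sqnorm/=; field.
rewrite natrD mulrDr; move: E1 E2; set A := (_ == _)%:R; set B := (_ == _)%:R => E1 E2.
have A0 : 0 <= sqnorm c * A by rewrite mulr_ge0.
have B0 : 0 <= sqnorm c * B by rewrite mulr_ge0.
by lra.
Qed.

Definition prime_pairs (S : {fset {poly K}}) (p : {poly K} -> {poly K}) : seq ({poly K} * {poly K}) :=
  [seq (F, G) | F <- (S : seq _), G <- [seq G <- (S : seq _) | p F %| G]].

Lemma mem_prime_pairs (S : {fset {poly K}}) p x : (x \in prime_pairs S p) =
  [&& x.1 \in S, x.2 \in S & p x.1 %| x.2].
Proof.
case: x => F G /=; apply/allpairsPdep/and3P => [[F' [G' [FS]]]|[FS GS d']].
  by rewrite mem_filter => /andP[d' GS] [-> ->]; split.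
by exists F, G; rewrite mem_filter; split => //; apply/andP.
Qed.

Lemma prime_pairs_uniq (S : {fset {poly K}}) p : uniq (prime_pairs S p).
Proof.
apply: allpairs_uniq_dep; first exact: fset_uniq.
  by move=> F _; apply/filter_uniq/fset_uniq.
by move=> [F G] [F' G'] _ _ /= [-> ->].
Qed.

Section Quantitative.
Variables (S : {fset {poly K}}) (p : {poly K} -> {poly K}) (N : nat) (c : R[i]).
Hypotheses (N0 : (0 < N)%N)
  (S_monic : forall F, F \in S -> F \is monic /\ size F = N.+1)
  (p_irr : forall F, F \in S -> monic_irreducible (p F))
  (p_div : forall F, F \in S -> p F %| F)
  (p_sqfree : forall F G, F \in S -> G \in S -> ~~ (p F ^+ 2 %| G)).

Let r := prime_pairs S p.
Let rp x : x \in r -> [/\ x.1 \in S, x.2 \in S & p x.1 %| x.2].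
Proof. by rewrite mem_prime_pairs => /and3P. Qed.

Let V w := \sum_(x <- r) complex.Im (c * f x.1 w) * complex.Im (c * f x.2 w).
Let Y w := \sum_(F <- S) complex.Re (c * f F w).
Let v : R := sqnorm c * #|` S|%:R / 2.

Let bI F : F \in S -> bounded_rv (fun w => complex.Im (c * f F w)).
Proof. by move=> /S_monic[mF _]; case: (steinhaus_bounded_rv c mF). Qed.

Let bR F : F \in S -> bounded_rv (fun w => complex.Re (c * f F w)).
Proof. by move=> /S_monic[mF _]; case: (steinhaus_bounded_rv c mF). Qed.

Let bV : bounded_rv V.
Proof.
by apply: bounded_rv_sum => x /rp[x1 x2 _]; apply: bounded_rvM; exact: bI.
Qed.

Let bY : bounded_rv Y.
Proof. by apply: bounded_rv_sum => F; exact: bR. Qed.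

Lemma steinhaus_sum_integration_by_parts (a t : R) :
  \int[P]_w (Y w * sin (t * Y w + a)) = t * \int[P]_w (V w * cos (t * Y w + a)).
Proof.
have bT : bounded_rv (fun w => t * Y w + a).
  by apply: bounded_rvD; [exact: bounded_rvZ|exact: bounded_rv_cst].
have bs := bounded_rv_sin bT; have bc := bounded_rv_cos bT.
have -> : \int[P]_w (Y w * sin (t * Y w + a)) =
    \sum_(F <- S) \int[P]_w (complex.Re (c * f F w) * sin (t * Y w + a)).
  rewrite -expected_sum; last by move=> F FS; apply: bounded_rvM => //; exact: bR.
  by apply: eq_Rintegral => w _; rewrite mulr_suml.
have bS F : F \in S -> bounded_rv (fun w => \sum_(G <- S | p F %| G) complex.Im (c * f G w)).
  move=> FS; under eq_fun do rewrite -big_filter.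
  by apply: bounded_rv_sum => G; rewrite mem_filter => /andP[_ GS]; exact: bI.
have -> : \int[P]_w (V w * cos (t * Y w + a)) =
    \sum_(F <- S) \int[P]_w (complex.Im (c * f F w) *
      (\sum_(G <- S | p F %| G) complex.Im (c * f G w)) * cos (t * Y w + a)).
  rewrite -expected_sum; last first.
    move=> F FS; apply: bounded_rvM => //; apply: bounded_rvM; [exact: bI|exact: bS].
  apply: eq_Rintegral => w _; rewrite -mulr_suml; congr (_ * _).
  rewrite /V /r /prime_pairs big_allpairs_dep/=; apply: eq_bigr => F _.
  by rewrite mulr_sumr big_filter.
rewrite mulr_sumr big_seq [RHS]big_seq; apply: eq_bigr => F FS.
have [mF _] := S_monic FS.
apply: steinhaus_integration_by_parts => //.
- exact: p_irr.
- exact: p_div.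
- exact: p_sqfree.
- by move=> G GS; split; [case: (S_monic GS)|exact: p_sqfree].
Qed.

Let off := [seq x <- r | x.1 != x.2].
Let A1 w := \sum_(x <- off) complex.Re (1 * (f x.1 w * conjc (f x.2 w))).
Let A2 w := \sum_(x <- r) complex.Re ((c * c) * (f (x.1 * x.2) w * conjc (f 1 w))).

Let monic_r x : x \in r -> x.1 \is monic /\ x.2 \is monic.
Proof. by move=> /rp[/S_monic[m1 _] /S_monic[m2 _] _]. Qed.

Let VE w : V w - v = 2^-1 * (sqnorm c * A1 w - A2 w).
Proof.
have dec x : x \in r -> complex.Im (c * f x.1 w) * complex.Im (c * f x.2 w) =
    2^-1 * (sqnorm c * complex.Re (1 * (f x.1 w * conjc (f x.2 w))) -
    complex.Re ((c * c) * (f (x.1 * x.2) w * conjc (f 1 w)))).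
  move=> /monic_r[m1 m2]; rewrite steinhaus_mul// (steinhaus_one f_steinhaus).
  move: (f x.1 w) (f x.2 w) => [x1 x2] [y1 y2]; case: (c) => c1 c2.
  by rewrite /sqnorm/=; field.
have diag : \sum_(x <- r | ~~ (x.1 != x.2)) complex.Re (1 * (f x.1 w * conjc (f x.2 w))) =
    #|` S|%:R.
  rewrite /r /prime_pairs big_mkcond big_allpairs_dep/=.
  rewrite card_fset_sum1 natr_sum big_seq [RHS]big_seq; apply: eq_bigr => F FS.
  rewrite big_filter big_mkcond/= (bigD1_seq F FS (fset_uniq S))/= p_div// negbK eqxx.
  rewrite big1 ?addr0; last by move=> G GF; case: ifP => // _; rewrite negbK eq_sym (negbTE GF).
  have [mF _] := S_monic FS; have := steinhaus_sqnorm w mF; rewrite /sqnorm.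
  by rewrite mul1r; case: (f F w) => x y /= xy; rewrite -xy; ring.
rewrite /V (eq_big_seq _ dec) -mulr_sumr sumrB -mulr_sumr -/(A2 w).
rewrite (bigID (fun x => x.1 != x.2))/= diag -big_filter -/off -/(A1 w) /v.
by field.
Qed.

Lemma steinhaus_variance_bound :
  \int[P]_w ((V w - v) ^+ 2) <=
  sqnorm c ^+ 2 * (4 * (size r)%:R + 3 * #|` nontrivial_quadruples S|%:R).
Proof.
have monic_off x : x \in off -> x.1 \is monic /\ x.2 \is monic.
  by rewrite mem_filter => /andP[_ /monic_r].
have bA1 : bounded_rv A1.
  by apply: bounded_rv_sum => x /monic_off[m1 m2]; exact: steinhaus_bounded_rv2.
have bA2 : bounded_rv A2.
  apply: bounded_rv_sum => x /monic_r[m1 m2]; apply: steinhaus_bounded_rv2; last exact: monic1.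
  by rewrite monicMl.
have E1 : \int[P]_w (A1 w ^+ 2) <= (2 * (size r)%:R + 2 * #|` nontrivial_quadruples S|%:R).
  apply: le_trans (steinhaus_second_moment (H := fst) (L := snd) 1 monic_off) _.
  rewrite {1}/sqnorm/= expr1n expr0n addr0 mul1r -!natrM -natrD ler_nat.
  have uoff : uniq off by apply: filter_uniq; exact: prime_pairs_uniq.
  have offS x : x \in off -> x.1 \in S /\ x.2 \in S.
    by rewrite mem_filter => /andP[_ /rp[]].
  apply: leq_trans (@offdiagonal_pairs_count _ S off uoff offS _) _.
    by move=> x; rewrite mem_filter => /andP[].
  by rewrite leq_add2r leq_mul2l /=; by rewrite size_filter count_size.
have E2 : \int[P]_w (A2 w ^+ 2) <= sqnorm c ^+ 2 * (2 * (size r)%:R + #|` nontrivial_quadruples S|%:R).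
  have m1 x : x \in r -> (x.1 * x.2) \is monic /\ (1 : {poly K}) \is monic.
    by move=> /monic_r[h1 h2]; rewrite monicMl// monic1.
  apply: le_trans (steinhaus_second_moment (H := fun x => x.1 * x.2) (L := fun=> 1) (c * c) m1) _.
  rewrite sqnormM -expr2; apply: ler_wpM2l; first exact: sqr_ge0.
  rewrite -natrM -natrD ler_nat.
  have rS x : x \in r -> x.1 \in S /\ x.2 \in S by move=> /rp[].
  apply: leq_trans (all_pairs_count (prime_pairs_uniq S p) rS).
  rewrite big_seq [leqRHS]big_seq; apply: leq_sum => x xr.
  rewrite big_seq [leqRHS]big_seq; apply: leq_sum => y yr.
  rewrite mulr1 mul1r (_ : (_ * _ * (_ * _) == _) = false) ?addn0//.
  apply/negbTE/negP => /eqP e.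
  have [/S_monic[mx1 s1] _ _] := rp xr; have [mx mx2] := m1 _ xr; have [my _] := m1 _ yr.
  have := congr1 (fun q : {poly K} => (size q).-1) e.
  have [_ mxx2] := monic_r xr.
  rewrite mulr1 size_poly1 monic_size_mul// monic_size_mul// s1/=.
  by move: N0; lia.
have bVv : bounded_rv (fun w => V w - v) by apply: bounded_rvB => //; exact: bounded_rv_cst.
apply: (@le_trans _ _ (\int[P]_w (2^-1 * (sqnorm c ^+ 2 * A1 w ^+ 2) + 2^-1 * A2 w ^+ 2))).
  apply: le_expected.
  - exact: bounded_rv_sqr.
  - by apply: bounded_rvD; apply: bounded_rvZ; [apply: bounded_rvZ|]; exact: bounded_rv_sqr.
  - move=> w; rewrite VE; have := sqr_ge0 (sqnorm c * A1 w + A2 w).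
    by rewrite -exprMn; nra.
rewrite expectedD; last 2 first.
- by apply/bounded_rvZ/bounded_rvZ; exact: bounded_rv_sqr.
- by apply/bounded_rvZ; exact: bounded_rv_sqr.
rewrite !expectedZ; last 3 first.
- exact: bounded_rv_sqr.
- exact: bounded_rv_sqr.
- by apply: bounded_rvZ; exact: bounded_rv_sqr.
have := ler_wpM2l (sqr_ge0 (sqnorm c)) E1; move: E2.
have h0 : 0 <= sqnorm c ^+ 2 * (size r)%:R by rewrite mulr_ge0 ?sqr_ge0.
have h1 : 0 <= sqnorm c ^+ 2 * #|` nontrivial_quadruples S|%:R by rewrite mulr_ge0 ?sqr_ge0.
lra.
Qed.

Lemma steinhaus_characteristic_bound (a : R) :
  `| \int[P]_w cos (Y w + a) - expR (- v / 2) * cos a | <=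
  sqnorm c * Num.sqrt (4 * (size r)%:R + 3 * #|` nontrivial_quadruples S|%:R).
Proof.
have sq0 : 0 <= sqnorm c by rewrite addr_ge0 ?sqr_ge0.
apply: (@characteristic_ode _ _ _ P Y V v _ a bY bV).
- by rewrite /v divr_ge0// mulr_ge0.
- by move=> t; exact: steinhaus_sum_integration_by_parts.
have bVv : bounded_rv (fun w => V w - v) by apply: bounded_rvB => //; exact: bounded_rv_cst.
apply: le_trans (expected_norm_le_sqrt _ bVv) _.
have <- : Num.sqrt (sqnorm c ^+ 2) = sqnorm c by rewrite sqrtr_sqr ger0_norm.
rewrite -sqrtrM ?sqr_ge0// ler_wsqrtr//; exact: steinhaus_variance_bound.
Qed.

End Quantitative.
End SteinhausUnit.

(** * The complex normal law *)

Section GaussianCharacteristic.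
Variable R : realType.
Local Notation mu := (@lebesgue_measure R).
Local Notation gamma := (normal_prob (0 : R) (Num.sqrt 2^-1)).
Local Notation p := (normal_pdf (0 : R) (Num.sqrt 2^-1)).

Lemma gaussian_pdfE (x : R) : p x = (Num.sqrt pi)^-1 * expR (- x ^+ 2).
Proof.
have s0 : Num.sqrt 2^-1 != 0 :> R by rewrite gt_eqF// sqrtr_gt0 invr_gt0.
rewrite normal_pdfE// /normal_peak /normal_fun sqr_sqrtr ?invr_ge0// subr0.
rewrite -[2^-1 *+ 2]mulr_natr mulVf// divr1.
by rewrite -mulrnAl -[2^-1 *+ 2]mulr_natr mulVf// mul1r.
Qed.

Lemma gaussian_integral (g : R -> R) : bounded_rv g ->
  (\int[gamma]_x (g x)%:E = \int[mu]_x (g x * p x)%:E)%E.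
Proof.
move=> bg; have [mg _] := bg.
have ig : gamma.-integrable setT (EFin \o g).
  exact: (@bounded_rv_integrable _ (measurableTypeR R) R gamma g bg).
have dom := @normal_prob_dominates R 0 (Num.sqrt 2^-1).
rewrite -(Radon_Nikodym_change_of_variables dom measurableT ig)/=.
under [RHS]eq_integral do rewrite EFinM.
have iRN := @Radon_Nikodym_integrable _ _ _ (charge_of_finite_measure gamma) mu dom.
have mRN := measurable_int _ iRN.
apply: ae_eq_integral => //.
- by apply: emeasurable_funM => //; exact/measurable_EFinP.
- apply: emeasurable_funM => //; first exact/measurable_EFinP.
  by apply/measurable_EFinP; exact: measurable_normal_pdf.
- apply: ae_eqe_mul2l; apply: integral_ae_eq => //.
    by apply/measurable_EFinP; exact: measurable_normal_pdf.
  by move=> E _ mE; rewrite -(@Radon_Nikodym_integral _ _ _ (charge_of_finite_measure gamma) mu E dom mE).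
Qed.

Lemma integrable_half_gaussian : mu.-integrable setT (fun x : R => (expR (- x ^+ 2 / 2))%:E).
Proof.
have := @integrable_normal_pdf R 0 1.
have -> : (fun x : R => (normal_pdf 0 1 x)%:E) =
    (fun x : R => (normal_peak 1)%:E * (expR (- x ^+ 2 / 2))%:E)%E.
  apply/funext => x; rewrite normal_pdfE ?oner_neq0// /normal_fun subr0 expr1n.
  by rewrite -EFinM.
move=> /(integrableZl measurableT (normal_peak 1)^-1); apply: eq_integrable => // x _.
by rewrite -!EFinM mulKf// gt_eqF// normal_peak_gt0// oner_neq0.
Qed.

Lemma norm_le_half_gaussian (x : R) : `|x| * expR (- x ^+ 2) <= expR (- x ^+ 2 / 2).
Proof.
have -> : expR (- x ^+ 2 / 2) = expR (x ^+ 2 / 2) * expR (- x ^+ 2).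
  by rewrite -expRD; congr expR; field.
apply: ler_wpM2r; first exact: expR_ge0.
apply: le_trans (expR_ge1Dx _).
rewrite -[x ^+ 2]real_normK ?num_real//.
by have := sqr_ge0 (`|x| - 1); lra.
Qed.

Lemma integrable_gaussian_dominated (g : R -> R) (C : R) : measurable_fun setT g ->
  (forall x, `|g x| <= C * (1 + `|x|)) ->
  mu.-integrable setT (fun x => (g x * p x)%:E).
Proof.
move=> mg gC.
have C0 : 0 <= C by have := gC 0; rewrite normr0 addr0 mulr1; exact: le_trans.
have pi0 : 0 <= (Num.sqrt pi)^-1 :> R by rewrite invr_ge0 sqrtr_ge0.
apply: (le_integrable measurableT _ _
   (integrableZl measurableT (2 * C * (Num.sqrt pi)^-1) integrable_half_gaussian)).
  apply/measurable_EFinP; apply: measurable_funM => //; exact: measurable_normal_pdf.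
move=> x _ /=; rewrite lee_fin gaussian_pdfE !normrM (ger0_norm (expR_ge0 _)).
rewrite (ger0_norm pi0) (ger0_norm C0) (ger0_norm (expR_ge0 _)) (ger0_norm (ler0n R 2)).
apply: (@le_trans _ _ (C * (1 + `|x|) * ((Num.sqrt pi)^-1 * expR (- x ^+ 2)))).
  by apply: ler_wpM2r => //; rewrite mulr_ge0 ?expR_ge0.
rewrite [leLHS](_ : _ = C * (Num.sqrt pi)^-1 * ((1 + `|x|) * expR (- x ^+ 2))); last by ring.
rewrite [leRHS](_ : _ = C * (Num.sqrt pi)^-1 * (2 * expR (- x ^+ 2 / 2))); last by ring.
apply: ler_wpM2l; first exact: mulr_ge0.
rewrite mulrDl mul1r mulr_natl mulr2n; apply: lerD; last exact: norm_le_half_gaussian.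
by rewrite ler_expR; have := sqr_ge0 x; lra.
Qed.

Lemma integral_derivative0 (F F' : R -> R) (C : R) :
  (forall x : R, is_derive x (1 : R) F (F' x)) -> continuous F' ->
  mu.-integrable setT (EFin \o F') -> (forall x, `|F x| <= C * expR (- x ^+ 2)) ->
  (\int[mu]_x (F' x)%:E = 0)%E.
Proof.
move=> dF cF' iF' FC.
have cF : continuous F.
  by move=> x; apply: differentiable_continuous; apply/derivable1_diffP; case: (dF x).
have C0 : 0 <= C.
  have := FC 0; rewrite expr0n/= oppr0 expR0 mulr1; exact: le_trans.
pose D n : set R := `[- n.+1%:R, n.+1%:R]%classic.
have seg n : (\int[mu]_(x in D n) (F' x)%:E = (F n.+1%:R - F (- n.+1%:R))%:E)%E.
  rewrite /D (@continuous_FTC2 _ F' F)//.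
  - by rewrite gtrN.
  - exact: continuous_subspaceT.
  - split; first by move=> x _; case: (dF x).
      exact/cvg_at_right_filter/cF.
    exact/cvg_at_left_filter/cF.
  - by move=> x _; rewrite derive1E; apply: derive_val.
have lim0 : (\int[mu]_(x in D n) (F' x)%:E)%E @[n --> \oo] --> 0%E.
  under eq_fun do rewrite seg.
  apply/fine_cvgP; split; first exact: nearW.
  rewrite /comp/=.
  apply: norm_cvg0.
  have lim : (4 * C) * n.+1%:R^-1 @[n --> \oo] --> (0 : R).
    by rewrite -(mulr0 (4 * C)); apply: cvgM; [exact: cvg_cst|exact: cvg_harmonic].
  apply: (@squeeze_cvgr _ _ _ _ (cst 0) _ _ _ _ _ lim) => //; last exact: cvg_cst.
  apply: nearW => n; rewrite normr_ge0/=.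
  have e n0 : (0 < n0)%N -> expR (- (n0%:R : R) ^+ 2) <= 2 * n0%:R^-1.
    move=> n00; have n0' : 0 < n0%:R :> R by rewrite ltr0n.
    rewrite expRN -[2 * _]invrK lef_pV2 ?posrE ?expR_gt0 ?invr_gt0 ?mulr_gt0 ?invr_gt0//.
    apply: le_trans (expR_ge1Dx _); rewrite invfM invrK.
    by have := sqr_ge0 (n0%:R - 1 : R); lra.
  apply: le_trans (ler_normB _ _) _.
  have := FC n.+1%:R; have := FC (- n.+1%:R); rewrite sqrrN => h1 h2.
  apply: le_trans (lerD h2 h1) _.
  have h := ler_wpM2l C0 (e n.+1 isT).
  rewrite [leRHS](_ : _ = C * (2 * n.+1%:R^-1) + C * (2 * n.+1%:R^-1)); last by ring.
  exact: (lerD h h).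
have conv : (\int[mu]_(x in D n) (F' x)%:E)%E @[n --> \oo] --> (\int[mu]_x (F' x)%:E)%E.
  under eq_fun do rewrite integral_mkcond.
  have mD n : measurable (D n) by exact: measurable_itv.
  have mF' : measurable_fun setT F' by exact: continuous_measurable_fun.
  pose fn n : R -> \bar R := (EFin \o F') \_ (D n).
  have h1 n : measurable_fun setT (fn n).
    by apply/(measurable_restrictT _ _).1 => //; apply: measurable_funTS; exact/measurable_EFinP.
  have h2 : measurable_fun setT (EFin \o F') by exact/measurable_EFinP.
  have h3 : {ae mu, forall x, setT x -> fn n x @[n --> \oo] --> (EFin \o F') x}.
    apply: aeW => x _; apply: cvg_near_cst; near=> n.
    rewrite /fn patchE mem_set// /D/= in_itv/= -ler_norml.
    near: n; exists (Num.truncn `|x|) => // n /= xn.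
    by apply: ltW; apply: lt_le_trans (truncnS_gt _) _; rewrite ler_nat.
  have h4 : mu.-integrable setT (fun x => `|(F' x)%:E|%E) by exact: integrable_abse.
  have h5 : {ae mu, forall x n, setT x -> (`|fn n x| <= `|(F' x)%:E|)%E}.
    by apply: aeW => x n _; rewrite /fn patchE; case: ifP => // _; rewrite abse0.
  by have [_ _] := @dominated_convergence _ _ _ mu setT measurableT fn _ _ h1 h2 h3 h4 h5.
by rewrite -(cvg_lim _ conv)// (cvg_lim _ lim0).
Unshelve. all: by end_near. Qed.

Lemma is_derive_gaussian_pdf (x : R) : is_derive x (1 : R) p (- (2 * x) * p x).
Proof.
have -> : p = (fun x => (Num.sqrt pi)^-1 * expR (- x ^+ 2)).
  by apply/funext => y; exact: gaussian_pdfE.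
have dq : is_derive x (1 : R) (fun x : R => - x ^+ 2) (- (2 * x)).
  by under eq_fun do rewrite expr2; apply: is_derive_eq; rewrite /GRing.scale/=; ring.
have de : is_derive x (1 : R) (fun x : R => expR (- x ^+ 2)) (expR (- x ^+ 2) * (- (2 * x))).
  by apply: is_derive1_comp.
by apply: is_derive_eq; rewrite /GRing.scale/=; ring.
Qed.

Lemma continuous_gaussian_pdf : continuous p.
Proof. by apply: continuous_normal_pdf; rewrite gt_eqF// sqrtr_gt0 invr_gt0. Qed.

Lemma gaussian_integration_by_parts (t b : R) :
  \int[mu]_x (x * sin (t * x + b) * p x) = t / 2 * \int[mu]_x (cos (t * x + b) * p x).
Proof.
have cl : continuous (fun x : R => t * x + b).
  move=> x; apply: cvgD; last exact: cvg_cst.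
  by apply: cvgM; [exact: cvg_cst|exact: cvg_id].
have cs : continuous (fun x : R => sin (t * x + b)).
  by move=> x; exact: (continuous_comp (cl x) (@continuous_sin R _)).
have cc : continuous (fun x : R => cos (t * x + b)).
  by move=> x; exact: (continuous_comp (cl x) (@continuous_cos R _)).
have i1 : mu.-integrable setT (fun x => (x * sin (t * x + b) * p x)%:E).
  apply: (@integrable_gaussian_dominated _ 1).
    by apply: measurable_funM => //; exact: continuous_measurable_fun.
  move=> x; rewrite mul1r normrM -[leRHS]mulr1; apply: ler_pM => //; last exact: sin_max.
  by rewrite lerDr.
have i2 : mu.-integrable setT (fun x => (cos (t * x + b) * p x)%:E).
  apply: (@integrable_gaussian_dominated _ 1); first exact: continuous_measurable_fun.
  by move=> x; rewrite mul1r; apply: le_trans (cos_max _) _; rewrite lerDl.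
pose F (x : R) := - 2^-1 * (p x * sin (t * x + b)).
pose F' (x : R) := x * sin (t * x + b) * p x - t / 2 * (cos (t * x + b) * p x).
have i2' : mu.-integrable setT (fun x => (t / 2 * (cos (t * x + b) * p x))%:E).
  by under eq_fun do rewrite EFinM; exact: integrableZl.
have iF' : mu.-integrable setT (EFin \o F').
  rewrite (_ : _ \o _ = (fun x => (x * sin (t * x + b) * p x)%:E - (t / 2 * (cos (t * x + b) * p x))%:E)%E).
    exact: integrableB.
  by apply/funext => x; rewrite /= EFinB.
have F'0 : (\int[mu]_x (F' x)%:E = 0)%E.
  apply: (@integral_derivative0 F F' (2^-1 * (Num.sqrt pi)^-1)) => //.
  - move=> x.
    have dl : is_derive x (1 : R) (fun x : R => t * x + b) t.
      by apply: is_derive_eq; rewrite /GRing.scale/=; ring.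
    have ds : is_derive x (1 : R) (fun x : R => sin (t * x + b)) (cos (t * x + b) * t).
      by apply: is_derive1_comp.
    have dp := is_derive_gaussian_pdf x.
    by rewrite /F /F'; apply: is_derive_eq; rewrite /GRing.scale/=; field.
  - move=> x; apply: cvgB; apply: cvgM; try exact: cvg_cst.
    + by apply: cvgM; [exact: cvg_id|exact: cs].
    + exact: continuous_gaussian_pdf.
    + by apply: cvgM; [exact: cc|exact: continuous_gaussian_pdf].
  - move=> x; rewrite /F normrM normrN (ger0_norm (_ : 0 <= 2^-1))//.
    rewrite [leRHS](_ : _ = 2^-1 * p x); last by rewrite gaussian_pdfE; ring.
    apply: ler_wpM2l => //; rewrite normrM (ger0_norm (normal_pdf_ge0 _ _ _)).
    by rewrite -[leRHS]mulr1; apply: ler_wpM2l; [exact: normal_pdf_ge0|exact: sin_max].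
have := congr1 fine F'0; rewrite -/(Rintegral mu setT F') /F' RintegralB// RintegralZl// => /eqP.
by rewrite /= subr_eq0 => /eqP.
Qed.

Lemma gaussian_characteristic (t b : R) :
  \int[gamma]_x cos (t * x + b) = expR (- (t ^+ 2 / 4)) * cos b.
Proof.
pose F (t x : R) := cos (t * x + b) * p x.
pose phi t := \int[mu]_x F t x.
have cl t' : continuous (fun x : R => t' * x + b).
  move=> x; apply: cvgD; last exact: cvg_cst.
  by apply: cvgM; [exact: cvg_cst|exact: cvg_id].
have cc t' : continuous (fun x : R => cos (t' * x + b)).
  by move=> x; exact: (continuous_comp (cl t' x) (@continuous_cos R _)).
have cs t' : continuous (fun x : R => sin (t' * x + b)).
  by move=> x; exact: (continuous_comp (cl t' x) (@continuous_sin R _)).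
have phiE t' : \int[gamma]_x cos (t' * x + b) = phi t'.
  rewrite /phi /Rintegral gaussian_integral//; split; first exact: continuous_measurable_fun.
  by exists 1 => x; exact: cos_max.
have iF t' : mu.-integrable setT (EFin \o F t').
  apply: (@integrable_gaussian_dominated _ 1); first exact: continuous_measurable_fun.
  by move=> x; rewrite mul1r; apply: le_trans (cos_max _) _; rewrite lerDl.
have dF (s x : R) : is_derive s (1 : R) (F ^~ x) (- (x * sin (s * x + b) * p x)).
  have dl : is_derive s (1 : R) (fun s : R => s * x + b) x.
    by apply: is_derive_eq; rewrite /GRing.scale/=; ring.
  have dc : is_derive s (1 : R) (fun s : R => cos (s * x + b)) (- sin (s * x + b) * x).
    by apply: is_derive1_comp.
  by rewrite /F; apply: is_derive_eq; rewrite /GRing.scale/=; ring.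
have dFE (s x : R) : partial1of2 F s x = - (x * sin (s * x + b) * p x).
  by rewrite partial1of2E derive_val.
pose G (x : R) := `|x| * p x.
have G0 (x : R) : 0 <= G x by rewrite mulr_ge0// normal_pdf_ge0.
have iG : mu.-integrable setT (EFin \o G).
  apply: (@integrable_gaussian_dominated (fun x => `|x|) 1).
    by apply: measurableT_comp.
  by move=> x; rewrite mul1r normr_id lerDr.
have dphi (s : R) : is_derive s (1 : R) phi (- (s / 2 * phi s)).
  have sI : `]s - 1, s + 1[%classic s by rewrite /= in_itv/= ltrBlDr !ltrDl ltr01.
  have intF x : `]s - 1, s + 1[%classic x -> mu.-integrable setT (EFin \o F x) by [].
  have derF x w : `]s - 1, s + 1[%classic x -> [set: R] w -> derivable (F ^~ w) x 1.
    by move=> _ _; case: (dF x w).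
  have ubF x w : `]s - 1, s + 1[%classic x -> [set: R] w -> `|partial1of2 F x w| <= G w.
    move=> _ _; rewrite dFE normrN !normrM /G (ger0_norm (normal_pdf_ge0 _ _ _)).
    apply: ler_wpM2r; first exact: normal_pdf_ge0.
    by rewrite -[leRHS]mulr1 ler_pM// sin_max.
  have derphi : derivable phi s 1.
    exact: (@derivable_under_integral _ _ _ mu F setT measurableT s _ _ sI intF derF _ G0 iG ubF).
  apply: DeriveDef => //; rewrite -derive1E.
  rewrite [LHS](@differentiation_under_integral _ _ _ mu F setT measurableT s _ _ sI intF derF _ G0 iG ubF).
  under eq_Rintegral do rewrite dFE -mulN1r.
  rewrite RintegralZl//; last first.
    apply: (@integrable_gaussian_dominated _ 1).
      by apply: measurable_funM => //; exact: (continuous_measurable_fun (cs s)).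
    move=> x; rewrite mul1r normrM -[leRHS]mulr1; apply: ler_pM => //; last exact: sin_max.
    by rewrite lerDr.
  by rewrite gaussian_integration_by_parts mulN1r.
pose psi s := phi s * expR (s ^+ 2 / 4).
have dpsi (s : R) : is_derive s (1 : R) psi 0.
  have dphis := dphi s.
  have dq : is_derive s (1 : R) (fun s : R => s ^+ 2 / 4) (s / 2).
    by under eq_fun do rewrite expr2; apply: is_derive_eq; rewrite /GRing.scale/=; field.
  have de : is_derive s (1 : R) (fun s : R => expR (s ^+ 2 / 4)) (expR (s ^+ 2 / 4) * (s / 2)).
    by apply: is_derive1_comp.
  by rewrite /psi; apply: is_derive_eq; rewrite /GRing.scale/=; ring.
have e := @is_derive_0_is_cst _ psi t 0 dpsi.
rewrite phiE; have -> : phi t = psi t * expR (- (t ^+ 2 / 4)).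
  by rewrite /psi -mulrA -expRD subrr expR0 mulr1.
rewrite e mulrC; congr (_ * _).
rewrite /psi expr0n/= mul0r expR0 mulr1 -phiE.
under eq_Rintegral do rewrite mul0r add0r.
exact: expected_cst.
Qed.

Lemma CN01_characteristic (a b c : R) :
  \int[CN01]_z cos (a * z.1 + b * z.2 + c) = expR (- ((a ^+ 2 + b ^+ 2) / 4)) * cos c.
Proof.
have cl (k e : R) : continuous (fun x : R => k * x + e).
  move=> x; apply: cvgD; last exact: cvg_cst.
  by apply: cvgM; [exact: cvg_cst|exact: cvg_id].
have bcos (k e : R) : @bounded_rv _ (measurableTypeR R) R (fun x : R => cos (k * x + e)).
  split; last by exists 1 => x; exact: cos_max.
  apply: (@continuous_measurable_fun R (fun x : R => cos (k * x + e))) => x.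
  exact: (continuous_comp (cl k e x) (@continuous_cos R _)).
have bz : @bounded_rv _ (measurableTypeR R * measurableTypeR R)%type R
    (fun z => cos (a * z.1 + b * z.2 + c)).
  split; last by exists 1 => x; exact: cos_max.
  have m1 : measurable_fun setT (fun z : measurableTypeR R * measurableTypeR R => (a * z.1 + b * z.2 + c : R)).
    apply: measurable_funD; last exact: measurable_cst.
    by apply: measurable_funD; apply: measurable_funM; (try exact: measurable_cst);
      [exact: measurable_fst|exact: measurable_snd].
  by apply: (measurableT_comp _ m1); exact: continuous_measurable_fun (@continuous_cos R).
have iz := @bounded_rv_integrable _ _ R CN01 _ bz.
rewrite /Rintegral -[RHS]/(fine (_%:E)); congr fine.
rewrite /CN01 -(fubini1 iz).
transitivity (\int[gamma]_x ((expR (- (b ^+ 2 / 4)))%:E * (cos (a * x + c))%:E))%E.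
  apply: eq_integral => x _; rewrite /fubini_F/=.
  have bx := bcos b (a * x + c).
  rewrite -EFinM -(gaussian_characteristic b (a * x + c)) /Rintegral fineK; last first.
    by apply: integrable_fin_num => //; exact: bounded_rv_integrable.
  by apply: eq_integral => y _; congr (cos _)%:E; ring.
have ig := @bounded_rv_integrable _ (measurableTypeR R) R gamma _ (bcos a c).
rewrite integralZl//.
have -> : (\int[gamma]_x (cos (a * x + c))%:E = (expR (- (a ^+ 2 / 4)) * cos c)%:E)%E.
  rewrite -(gaussian_characteristic a c) /Rintegral fineK//.
  exact: integrable_fin_num.
by rewrite -EFinM mulrA -expRD; congr (expR _ * _)%:E; field.
Qed.

End GaussianCharacteristic.

(** * Smooth and squareful exceptions *)

Section RegularElements.
Variable K : finFieldType.
Implicit Types (D F G Q : {poly K}) (S : {fset {poly K}}).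
Local Notation q := #|K|.

Definition has_large_prime k F :=
  exists Q, [/\ monic_irreducible Q, Q %| F & (k < (size Q).-1)%N].

Definition regular k S := [fset F in S | `[< has_large_prime k F /\
  forall D, D \is monic -> (k < (size D).-1)%N -> ~~ (D ^+ 2 %| F) >]]%fset.

Lemma regularP k S F : reflect [/\ F \in S, has_large_prime k F &
    forall D, D \is monic -> (k < (size D).-1)%N -> ~~ (D ^+ 2 %| F)]
  (F \in regular k S).
Proof.
rewrite in_fset_filter; apply: (iffP andP) => [[FS /asboolP[h1 h2]]|[FS h1 h2]].
  by split.
by split => //; exact/asboolP.
Qed.

Lemma regular_sub k S : (regular k S `<=` S)%fset.
Proof. by apply/fsubsetP => F /regularP[]. Qed.

Lemma card_monic_multiples D n S : D \is monic ->
  (forall F, F \in S -> [/\ F \is monic, size F = n.+1 & D %| F]) ->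
  (#|` S| * q ^ (size D).-1 <= q ^ n)%N.
Proof.
move=> mD SD; have [->|[F0 F0S]] := fset_0Vmem S; first by rewrite cardfs0 mul0n.
have [mF0 sF0 dF0] := SD _ F0S.
have Dn : ((size D).-1 <= n)%N.
  by have := dvdp_leq (monic_neq0 mF0) dF0; rewrite sF0; case: (size D).
rewrite -[in leqRHS](subnK Dn) expnD leq_mul2r; apply/orP; right.
apply: leq_trans (card_monics K _); apply: (card_multiples mD) => F /SD[mF sF].
move=> /(Pdiv.IdomainMonic.dvdpP mD)[F' FE].
have mF' : F' \is monic by move: mF; rewrite FE monicMr.
exists F' => //; apply/monicsP; split => //.
have := monic_size_mul mF' mD; rewrite -FE sF /= => ->.
by rewrite addnK prednK// size_poly_gt0 monic_neq0.
Qed.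

Lemma card_irregular k N S : (forall F, F \in S -> F \is monic /\ size F = N.+1) ->
  (#|` (S `\` regular k S)%fset| <= #|` smooth K k N| +
    \sum_(k.+1 <= j < N.+1) \sum_(D <- monics K j) #|` [fset F in monics K N | (D ^+ 2 %| F)%R]%fset|)%N.
Proof.
move=> Smon.
pose B F := (\sum_(k.+1 <= j < N.+1) \sum_(D <- monics K j) (D ^+ 2 %| F)%R)%N.
have step F : F \in (S `\` regular k S)%fset -> (1 <= (F \in smooth K k N) + B F)%N.
  rewrite in_fsetD => /andP[nreg FS]; have [mF sF] := Smon _ FS.
  have [//|/negP nsm] := boolP (F \in smooth K k N).
  have [Q [irrQ QF kQ]] : has_large_prime k F.
    apply: contrapT => nl; apply: nsm; apply/smoothP; split => // Q irrQ QF.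
    by rewrite leqNgt; apply/negP => kQ; apply: nl; exists Q.
  have [D [mD kD DF]] : exists D, [/\ D \is monic, (k < (size D).-1)%N & D ^+ 2 %| F].
    apply: contrapT => nD; move/negP: nreg; apply; apply/regularP; split => //.
      by exists Q.
    by move=> D mD kD; apply/negP => DF; apply: nD; exists D.
  have jN : ((size D).-1 < N.+1)%N.
    have : ((size (D ^+ 2)).-1 <= N)%N.
      by have := dvdp_leq (monic_neq0 mF) DF; rewrite sF; case: (size _).
    by rewrite monic_size_exp// ltnS; apply: leq_trans; rewrite leq_pmull.
  rewrite addnC addn_gt0; apply/orP; left; rewrite /B.
  rewrite (big_rem (size D).-1)/=; last by rewrite mem_index_iota kD.
  have Dm : D \in monics K (size D).-1.
    by apply/monicsP; split => //; rewrite prednK// size_poly_gt0 monic_neq0.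
  by rewrite (big_rem D)//= DF.
have cardE (X Y : {fset {poly K}}) : (X `<=` Y)%fset -> #|` X| = (\sum_(F <- Y) (F \in X))%N.
  move=> XY; rewrite -(big_fset_incl _ XY) => [|F _ /negPf->//].
  by rewrite card_fset_sum1; apply: eq_big_seq => F ->.
have SM : (S `\` regular k S `<=` monics K N)%fset.
  by apply/fsubsetP => F; rewrite in_fsetD => /andP[_ /Smon?]; exact/monicsP.
have sM : (smooth K k N `<=` monics K N)%fset.
  by apply/fsubsetP => F /smoothP[mF sF _]; exact/monicsP.
rewrite (cardE _ _ SM) (cardE _ _ sM).
apply: (@leq_trans (\sum_(F <- monics K N) ((F \in smooth K k N) + B F))%N).
  by apply: leq_sum => F _; case: (boolP (F \in _)) => // /step.
rewrite big_split/= leq_add2l exchange_big/=; apply: leq_sum => j _.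
rewrite exchange_big/=; apply: leq_sum => D _.
rewrite card_fset_sum1 -[leqRHS]big_fset_condE/= [leqRHS]big_mkcond/=.
by apply: leq_sum => F _; case: ifP.
Qed.

Lemma size_prime_pairs_le k N S p : (forall F, F \in S -> F \is monic /\ size F = N.+1) ->
  (forall F, F \in S -> p F \is monic /\ (k < (size (p F)).-1)%N) ->
  (size (prime_pairs S p) * q ^ k.+1 <= #|` S| * q ^ N)%N.
Proof.
move=> Smon pS; have q0 : (0 < q)%N by apply/card_gt0P; exists 0.
rewrite size_allpairs_dep sumnE big_map big_distrl/= card_fset_sum1 big_distrl/=.
rewrite big_seq [leqRHS]big_seq; apply: leq_sum => F FS; rewrite mul1n.
have [mp kp] := pS _ FS.
rewrite size_filter.
have -> : count (fun G => p F %| G) S = #|` [fset G in S | (p F %| G)%R]%fset|.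
  rewrite card_fset_sum1 -[RHS]big_fset_condE/= -sum1_count.
  by [].
have h : (#|` [fset G in S | (p F %| G)%R]%fset| * q ^ (size (p F)).-1 <= q ^ N)%N.
  apply: card_monic_multiples => // G; rewrite in_fset_filter => /andP[/Smon[mG sG] dG].
  by split.
by apply: leq_trans h; rewrite leq_mul2l leq_pexp2l// orbT.
Qed.

Context {R : realType}.

Lemma card_squareful_le k N : (1 < q)%N ->
  ((\sum_(k.+1 <= j < N.+1) \sum_(D <- monics K j)
    #|` [fset F in monics K N | (D ^+ 2 %| F)%R]%fset|)%:R : R) <=
  2 * (q%:R ^+ N / q%:R ^+ k.+1).
Proof.
move=> q1; have q0 : 0 < q%:R :> R by rewrite ltr0n ltnW.
have q2 : 2 <= q%:R :> R by rewrite ler_nat.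
pose x : R := q%:R^-1.
have x0 : 0 < x by rewrite invr_gt0.
have x2 : x <= 2^-1 by rewrite lef_pV2 ?posrE.
apply: (@le_trans _ _ (\sum_(k.+1 <= j < N.+1) q%:R ^+ N * x ^+ j)).
  rewrite natr_sum; apply: ler_sum => j _; rewrite natr_sum.
  apply: (@le_trans _ _ (\sum_(D <- monics K j) q%:R ^+ N * x ^+ (j + j))).
    rewrite big_seq [leRHS]big_seq; apply: ler_sum => D /monicsP[mD sD].
    rewrite exprVn ler_pdivlMr ?exprn_gt0// -!natrX -natrM ler_nat.
    have mD2 : D ^+ 2 \is monic by exact: monic_exp.
    have -> : (j + j = (size (D ^+ 2)).-1)%N by rewrite monic_size_exp// sD mul2n addnn.
    apply: card_monic_multiples => // F; rewrite in_fset_filter => /andP[/monicsP[mF sF] DF].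
    by split.
  have xj : 0 <= x ^+ j by rewrite exprn_ge0// ltW.
  have mj : #|` monics K j|%:R * x ^+ j <= 1.
    rewrite exprVn ler_pdivrMr ?exprn_gt0// mul1r -natrX ler_nat; exact: card_monics.
  rewrite big_const_seq count_predT iter_addr_0 -[X in X <= _]mulr_natl exprD.
  rewrite [leLHS](_ : _ = q%:R ^+ N * x ^+ j * (#|` monics K j|%:R * x ^+ j)); last by ring.
  by rewrite ler_piMr// mulr_ge0// exprn_ge0// ltW.
rewrite -mulr_sumr -[k.+1]add1n big_addn.
under eq_bigr do rewrite exprD.
rewrite -mulr_suml add1n -exprVn -/x exprS [leRHS]mulrCA.
apply: ler_wpM2l; first by rewrite exprn_ge0// ltW.
rewrite mulrA; apply: ler_wpM2r; first by rewrite exprn_ge0// ltW.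
apply: (le_trans (geometric_sum_le _ (ltW x0) _)); first by lra.
by rewrite ler_pdivrMr; nra.
Qed.

Lemma smooth0 N : (0 < N)%N -> smooth K 0 N = fset0.
Proof.
move=> N0; apply/fsetP => F; rewrite in_fset0; apply/negP => /smoothP[mF sF Fsm].
have F1 : (1 < size F)%N by rewrite sF.
have [Q irrQ QF] := monic_irreducible_divisor mF F1.
by have := Fsm _ irrQ QF; case: irrQ => _ [Q1 _]; move: Q1; case: (size Q) => [|[|]].
Qed.

(* k ln q <= 3L/8 < (k + 1) ln q. Any constant slightly above 1/3 works, since the
   exponent of [card_smooth_le] is then close to - L^2 / (4 k ln q) = - 2L/3. *)
Lemma smoothness_level N : (0 < N)%N -> (1 < q)%N ->
  let L : R := Num.sqrt (N%:R * ln q%:R) in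
  exists k, q%:R ^+ N / q%:R ^+ k.+1 <= q%:R ^+ N * expR (- (3 / 8 * L)) /\
    #|` smooth K k N|%:R <= q%:R ^+ N * expR (1 - 3 / 8 * L).
Proof.
move=> N0 q1 L.
have q0 : 0 < q%:R :> R by rewrite ltr0n ltnW.
have l2 : 2 / 3 <= ln q%:R :> R.
  by apply: le_trans (@ln2_ge R) _; rewrite ler_ln ?posrE// ler_nat.
set l : R := ln q%:R in L l2 *.
have l0 : 0 < l by apply: (lt_le_trans _ l2); lra.
have L0 : 0 <= L by exact: sqrtr_ge0.
have L2 : L ^+ 2 = N%:R * l by rewrite sqr_sqrtr// mulr_ge0// ltW.
have x0 : 0 <= 3 / 8 * L / l by apply: divr_ge0; [exact: mulr_ge0|exact: ltW].
have /andP[kx xk] := truncn_itv x0; set k := Num.truncn _ in kx xk.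
rewrite ler_pdivlMr// in kx; rewrite ltr_pdivrMr// in xk.
exists k; split.
  apply: ler_wpM2l; first by rewrite exprn_ge0// ltW.
  rewrite expRN lef_pV2 ?posrE ?exprn_gt0 ?expR_gt0//.
  by rewrite -[X in X ^+ _](lnK q0) -expRM_natl ler_expR ltW.
have [k0|k0] := posnP k.
  by rewrite k0 smooth0// cardfs0 mulr_ge0 ?expR_ge0// exprn_ge0// ltW.
apply: (le_trans (card_smooth_le R N k0 q1)).
rewrite ler_pM2l ?exprn_gt0// ler_expR ler_pdivrMr ?mulr_gt0 ?ltr0n// natrM -[k.+1%:R]natr1.
have k1 : 1 <= k%:R :> R by rewrite ler1n.
move: kx L2 k1; move: (k%:R : R) (N%:R : R) => u v kx L2 u1.
have uL : u * u <= 9 / 16 * (L * u) by nra.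
have vL : 8 / 3 * (L * u) <= v.
  rewrite -(ler_pM2r l0) -L2 expr2; nra.
by nra.
Qed.

End RegularElements.

(** * Weak convergence *)

Section TrigPolynomialsOfRandomVariables.
Context {R : realType} {d : measure_display} {T : measurableType d}.
Variables (P : probability T R) (X Y : T -> R).
Implicit Types (g h : R * R -> R) (B M x y e : R).
Hypotheses (mX : measurable_fun setT X) (mY : measurable_fun setT Y).

Lemma trig_poly_bounded_rv h : trig_poly h -> bounded_rv (fun w => h (X w, Y w)).
Proof.
have mlin a b : measurable_fun setT (fun w => a * X w + b * Y w).
  by apply: measurable_funD; apply: measurable_funM => //; exact: measurable_cst.
elim => {h} [a b|a b|h1 h2 _ b1 _ b2|c h _ bh].
- split; last by exists 1 => w; exact: cos_max.
  apply: (@measurableT_comp _ _ _ _ _ _ cos); last exact: mlin.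
  by apply: continuous_measurable_fun; exact: continuous_cos.
- split; last by exists 1 => w; exact: sin_max.
  apply: (@measurableT_comp _ _ _ _ _ _ sin); last exact: mlin.
  by apply: continuous_measurable_fun; exact: continuous_sin.
- exact: bounded_rvD.
- exact: bounded_rvZ.
Qed.

Lemma continuous_bounded_rv (g : R * R -> R) B : continuous g -> (forall z, `|g z| <= B) ->
  bounded_rv (fun w => g (X w, Y w)).
Proof.
move=> cg gB; split; last by exists B.
have /choice[h hP] (n : nat) : exists h : R * R -> R, [/\ trig_poly h, forall z, `|h z| <= B &
    forall z, `|z.1| <= n.+1%:R -> `|z.2| <= n.+1%:R -> `|h z - g z| <= n.+1%:R^-1].
  by apply: trig_approximation => //; rewrite ?invr_gt0 ltr0n.
apply/measurable_EFinP.
apply: (@emeasurable_fun_cvg _ _ _ _ (fun n w => (h n (X w, Y w))%:E)).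
  by move=> n; apply/measurable_EFinP; have [th _ _] := hP n; case: (trig_poly_bounded_rv th).
move=> w _; apply: cvg_EFin; first by near=> n.
apply/cvgrPdist_le => /= e e0; near=> n.
have [_ _] := hP n => /(_ (X w, Y w))/= near_g; rewrite distrC.
have nX : `|X w| <= n%:R by near: n; exact: nbhs_infty_ger.
have nY : `|Y w| <= n%:R by near: n; exact: nbhs_infty_ger.
apply: (le_trans (near_g _ _)); rewrite ?(le_trans nX) ?(le_trans nY) ?ler_nat//.
by apply/ltW; near: n; exact: (near_infty_natSinv_lt (PosNum e0)).
Unshelve. all: by end_near. Qed.

(* A continuous substitute for the indicator of the complement of the square [-M, M]^2. *)
Definition tail (M x y : R) : R := (x ^+ 2 + y ^+ 2) / (M ^+ 2 + x ^+ 2 + y ^+ 2).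

Lemma tail_ge0 M x y : 0 < M -> 0 <= tail M x y.
Proof. by move=> M0; rewrite divr_ge0// ?addr_ge0 ?sqr_ge0. Qed.

Lemma tail_le1 M x y : 0 < M -> tail M x y <= 1.
Proof.
move=> M0; rewrite ler_pdivrMr; last by have := sqr_ge0 x; have := sqr_ge0 y; nra.
by rewrite mul1r; have := sqr_ge0 M; lra.
Qed.

Lemma tail_le_sqr M x y : 0 < M -> tail M x y <= (x ^+ 2 + y ^+ 2) / M ^+ 2.
Proof.
move=> M0; apply: ler_wpM2l; first by rewrite addr_ge0 ?sqr_ge0.
have M2 : 0 < M ^+ 2 by rewrite exprn_gt0.
by rewrite lef_pV2 ?posrE//; have := sqr_ge0 x; have := sqr_ge0 y; lra.
Qed.

Lemma tail_antitone M M' x y : 0 < M -> M <= M' -> tail M' x y <= tail M x y.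
Proof.
move=> M0 MM; apply: ler_wpM2l; first by rewrite addr_ge0 ?sqr_ge0.
by rewrite lef_pV2 ?posrE; have := sqr_ge0 x; have := sqr_ge0 y; nra.
Qed.

Lemma tail_ge_half M x y : 0 < M -> (M < `|x|) || (M < `|y|) -> 2^-1 <= tail M x y.
Proof.
move=> M0 xy; rewrite ler_pdivlMr; last by have := sqr_ge0 x; have := sqr_ge0 y; nra.
have sq (z : R) : M < `|z| -> M ^+ 2 <= z ^+ 2.
  by move=> Mz; rewrite -(real_normK (num_real z)); nra.
have := sqr_ge0 x; have := sqr_ge0 y.
by case/orP: xy => /sq; lra.
Qed.

Lemma tail_bounded_rv M : 0 < M -> bounded_rv (fun w => tail M (X w) (Y w)).
Proof.
move=> M0; apply: (@continuous_bounded_rv (fun z => tail M z.1 z.2) 1); last first.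
  by move=> z; rewrite ger0_norm ?tail_le1 ?tail_ge0.
have c1 : continuous (fun z : R * R => z.1 ^+ 2).
  by under eq_fun do rewrite expr2; move=> z; apply: cvgM; exact: cvg_fst.
have c2 : continuous (fun z : R * R => z.2 ^+ 2).
  by under eq_fun do rewrite expr2; move=> z; apply: cvgM; exact: cvg_snd.
move=> z; apply: cvgM; first by apply: cvgD; [exact: c1|exact: c2].
apply: cvgV; first by rewrite gt_eqF//; have := sqr_ge0 z.1; have := sqr_ge0 z.2; nra.
by apply: cvgD; [apply: cvgD; [exact: cvg_cst|exact: c1]|exact: c2].
Qed.

Lemma expected_tail_small e : 0 < e -> exists2 M, 0 < M &
  forall M', M <= M' -> \int[P]_w tail M' (X w) (Y w) <= e.
Proof.
move=> e0.
have bt n : bounded_rv (fun w => tail n.+1%:R (X w) (Y w)) by apply: tail_bounded_rv.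
have tail0 w : (tail n.+1%:R (X w) (Y w))%:E @[n --> \oo] --> 0%E.
  apply: cvg_EFin; first by near=> n.
  set r := X w ^+ 2 + Y w ^+ 2.
  have r0 : 0 <= r by rewrite addr_ge0 ?sqr_ge0.
  apply/cvgrPdist_le => /= e' e'0; near=> n.
  rewrite sub0r normrN ger0_norm ?tail_ge0//.
  apply: (le_trans (tail_le_sqr _ _ _)) => //; rewrite -/r ler_pdivrMr ?exprn_gt0//.
  have nr : r / e' <= n%:R by near: n; exact: nbhs_infty_ger.
  rewrite ler_pdivrMr// in nr; rewrite mulrC; apply: (le_trans nr).
  rewrite ler_pM2r// -natrX ler_nat; apply: leq_trans (leqnSn n) _.
  by rewrite -mulnn leq_pmulr.
have le1 n w : (`|(tail n.+1%:R (X w) (Y w))%:E| <= 1%E)%E.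
  by rewrite lee_fin ger0_norm ?tail_le1 ?tail_ge0.
have [_ _] := @dominated_convergence _ _ _ P setT measurableT
  (fun n w => (tail n.+1%:R (X w) (Y w))%:E) (cst 0%E) (cst 1%E)
  (fun n => measurable_int P (bounded_rv_integrable P (bt n))) (measurable_cst _)
  (aeW P (fun w _ => tail0 w)) (bounded_rv_integrable P (bounded_rv_cst 1))
  (aeW P (fun w n _ => le1 n w)).
rewrite integral0 => /fine_cvg/cvgrPdist_le/(_ _ e0)[n _ /(_ n (leqnn n))/= ne].
exists n.+1%:R => // M nM; apply: (le_trans _ ne); rewrite sub0r normrN.
apply: (le_trans _ (ler_norm _)); apply: le_expected => // [|w].
  by apply: tail_bounded_rv; exact: lt_le_trans nM.
exact: tail_antitone.
Unshelve. all: by end_near. Qed.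

Lemma expected_tail_le M : 0 < M -> bounded_rv X -> bounded_rv Y ->
  \int[P]_w tail M (X w) (Y w) <= (\int[P]_w (X w ^+ 2) + \int[P]_w (Y w ^+ 2)) / M ^+ 2.
Proof.
move=> M0 bX bY; have b2 := bounded_rvD (bounded_rv_sqr bX) (bounded_rv_sqr bY).
rewrite -(expectedD P (bounded_rv_sqr bX) (bounded_rv_sqr bY)) mulrC -(expectedZ P _ b2).
apply: le_expected; [exact: tail_bounded_rv|exact: bounded_rvZ|move=> w].
by rewrite [leRHS]mulrC; exact: tail_le_sqr.
Qed.

Lemma expected_approximation (g h : R * R -> R) B M e : continuous g -> trig_poly h ->
  (forall z, `|g z| <= B) -> (forall z, `|h z| <= B) -> 0 < M ->
  (forall z, `|z.1| <= M -> `|z.2| <= M -> `|h z - g z| <= e) ->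
  `|\int[P]_w h (X w, Y w) - \int[P]_w g (X w, Y w)| <=
    e + 4 * B * \int[P]_w tail M (X w) (Y w).
Proof.
move=> cg th gB hB M0 hg; have bg := continuous_bounded_rv cg gB.
have bh := trig_poly_bounded_rv th; have bt := tail_bounded_rv M0.
have B0 : 0 <= B by apply: (le_trans _ (gB (0, 0))).
have e0 : 0 <= e by apply: (le_trans (normr_ge0 _) (hg (0, 0) _ _)); rewrite /= normr0 ltW.
rewrite -(expectedB P bh bg) -(expectedZ P _ bt) -[e in leRHS](expected_cst P).
rewrite -(expectedD P (bounded_rv_cst e) (bounded_rvZ _ bt)).
apply: norm_expected_le; first exact: bounded_rvB.
  by apply: bounded_rvD; [exact: bounded_rv_cst|exact: bounded_rvZ].
move=> w; have t0 := tail_ge0 (X w) (Y w) M0.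
have [Xl|Xg] := leP `|X w| M; first have [Yl|Yg] := leP `|Y w| M.
- apply: (le_trans (hg _ _ _)) => //; by rewrite lerDl mulr_ge0// mulr_ge0.
- apply: (le_trans (ler_normB _ _)); have := gB (X w, Y w); have := hB (X w, Y w).
  have : 2^-1 <= tail M (X w) (Y w) by apply: tail_ge_half => //; rewrite Yg orbT.
  by nra.
- apply: (le_trans (ler_normB _ _)); have := gB (X w, Y w); have := hB (X w, Y w).
  have : 2^-1 <= tail M (X w) (Y w) by apply: tail_ge_half => //; rewrite Xg.
  by nra.
Qed.

End TrigPolynomialsOfRandomVariables.

Section WeakConvergence.
Context {R : realType} {I : Type} {F : set_system I} {FF : Filter F}.
Variables (d : I -> measure_display) (T : forall i, measurableType (d i)).
Variables (P : forall i, probability (T i) R) (err : R -> R -> I -> R).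
Implicit Types (a b c e : R) (g h : R * R -> R).
Hypothesis err0 : forall a b, err a b i @[i --> F] --> (0 : R).

Definition near_CN01 i (X Y : T i -> R) := [/\ bounded_rv X, bounded_rv Y,
  \int[P i]_w (X w ^+ 2) + \int[P i]_w (Y w ^+ 2) <= 2 &
  forall a b c, `|\int[P i]_w cos (a * X w + b * Y w + c)
    - expR (- ((a ^+ 2 + b ^+ 2) / 4)) * cos c| <= err a b i].

Let plane := (measurableTypeR R * measurableTypeR R)%type.
Let gaussian_mean (h : R * R -> R) : R := \int[CN01]_z h (z.1, z.2).
Let m1 : measurable_fun setT (fst : plane -> R) := measurable_fst.
Let m2 : measurable_fun setT (snd : plane -> R) := measurable_snd.

Lemma trig_poly_expected_near h e : trig_poly h -> 0 < e ->
  \forall i \near F, forall X Y, near_CN01 X Y ->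
    `|\int[P i]_w h (X w, Y w) - gaussian_mean h| <= e.
Proof.
move=> th; elim: th e => {h} [a b|a b|h1 h2 th1 IH1 th2 IH2|c h th IH] e e0.
- have /cvgrPdist_le/(_ _ e0) := err0 a b; apply: filterS => i /= ie X Y [_ _ _ /(_ a b 0)].
  rewrite -CN01_characteristic sub0r normrN in ie *.
  under eq_Rintegral do rewrite addr0.
  under [X in _ - X]eq_Rintegral do rewrite addr0.
  by move=> /le_trans; apply; apply: (le_trans (ler_norm _)).
- have /cvgrPdist_le/(_ _ e0) := err0 a b; apply: filterS => i /= ie X Y [_ _ _ /(_ a b (- (pi / 2)))].
  have cosE (x : R) : cos (x + - (pi / 2)) = sin x.
    by rewrite cosB cos_pihalf sin_pihalf mulr0 add0r mulr1.
  rewrite -CN01_characteristic sub0r normrN in ie *.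
  under eq_Rintegral do rewrite cosE.
  under [X in _ - X]eq_Rintegral do rewrite cosE.
  by move=> /le_trans; apply; apply: (le_trans (ler_norm _)).
- have e2 : 0 < e / 2 by rewrite divr_gt0.
  apply: filterS (filterI (IH1 _ e2) (IH2 _ e2)) => i [h1e h2e] X Y XY.
  have [[mX _] [mY _] _ _] := XY; have := h1e _ _ XY; have := h2e _ _ XY.
  rewrite /gaussian_mean.
  rewrite (expectedD _ (trig_poly_bounded_rv mX mY th1) (trig_poly_bounded_rv mX mY th2)).
  rewrite (expectedD _ (trig_poly_bounded_rv m1 m2 th1) (trig_poly_bounded_rv m1 m2 th2)).
  move=> l2 l1; rewrite opprD addrACA (splitr e); apply: (le_trans (ler_normD _ _)).
  exact: lerD.
- have c1 : 0 < `|c| + 1 by rewrite ltr_pwDr.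
  have ec : 0 < e / (`|c| + 1) by rewrite divr_gt0.
  apply: filterS (IH _ ec) => i he X Y XY.
  have [[mX _] [mY _] _ _] := XY; have := he _ _ XY.
  rewrite /gaussian_mean (expectedZ _ _ (trig_poly_bounded_rv mX mY th)).
  rewrite (expectedZ _ _ (trig_poly_bounded_rv m1 m2 th)).
  rewrite -mulrBr normrM ler_pdivlMr//; apply: le_trans; rewrite mulrC.
  by apply: ler_wpM2l => //; rewrite lerDl.
Qed.

Lemma near_CN01_weak_convergence (U : I -> (R * R -> R) -> \bar R) :
  (\forall i \near F, exists X Y, near_CN01 (i := i) X Y /\
    forall g, continuous g -> (exists B : R, forall z, `|g z| <= B) ->
      U i g = (\int[P i]_w g (X w, Y w))%:E) ->
  forall g, continuous g -> (exists B : R, forall z, `|g z| <= B) ->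
    (U i g @[i --> F] --> \int[CN01]_z (g z)%:E)%E.
Proof.
move=> UP g cg [B gB].
have -> : (\int[@CN01 R]_z (g z)%:E = (gaussian_mean g)%:E)%E.
  rewrite /gaussian_mean /Rintegral fineK; first by apply: eq_integral => -[x y].
  apply: integrable_fin_num => //.
  exact: (bounded_rv_integrable _ (continuous_bounded_rv m1 m2 cg gB)).
apply/fine_cvgP; split.
  by apply: filterS UP => i [X [Y [_ ->]]] //; exists B.
apply/cvgrPdist_le => e e0.
have B0 : 0 <= B by apply: (le_trans _ (gB (0, 0))).
pose n := e / 5; have n0 : 0 < n by rewrite divr_gt0.
have n4 : 0 < n / (4 * B + 1) by rewrite divr_gt0// ltr_wpDl// mulr_ge0.
have [M1 M10 tM1] := expected_tail_small CN01 m1 m2 n4.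
pose M := M1 + 1 + 2 / (n / (4 * B + 1)).
have p2 : 0 < 2 / (n / (4 * B + 1)) by rewrite divr_gt0.
have M0 : 0 < M by rewrite /M; lra.
have M1M : M1 <= M by rewrite /M; lra.
have tMX : 2 / M ^+ 2 <= n / (4 * B + 1).
  rewrite ler_pdivrMr ?exprn_gt0// mulrC -ler_pdivrMr//.
  by rewrite /M; nra.
have small t : 0 <= t -> t <= n / (4 * B + 1) -> 4 * B * t <= n.
  by move=> t0; rewrite ler_pdivlMr; nra.
have [h [th hB hg]] := trig_approximation cg gB M0 n0.
apply: filterS (filterI UP (trig_poly_expected_near th n0)) => i [[X [Y [XY UE]]] near_h].
rewrite /= UE//=; last by exists B.
have [bX bY XY2 _] := XY; have [mX _] := bX; have [mY _] := bY.
have h1 := expected_approximation (P i) mX mY cg th gB hB M0 hg.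
have h2 := expected_approximation CN01 m1 m2 cg th gB hB M0 hg.
have h3 := near_h _ _ XY.
have t1 := tM1 _ M1M.
have t2 : \int[P i]_w tail M (X w) (Y w) <= n / (4 * B + 1).
  apply: (le_trans _ tMX); apply: (le_trans (expected_tail_le _ mX mY M0 bX bY)).
  by rewrite ler_wpM2r// invr_ge0 exprn_ge0// ltW.
have tail_mean_ge0 d' (T' : measurableType d') (Q : probability T' R) X' Y' :
    0 <= \int[Q]_w tail M (X' w) (Y' w).
  by apply: Rintegral_ge0 => w _; exact: tail_ge0.
have := small _ (tail_mean_ge0 _ _ _ _ _) t1; have := small _ (tail_mean_ge0 _ _ _ _ _) t2.
move: h1 h2 h3; rewrite -/(gaussian_mean h) -/(gaussian_mean g) !ler_norml.
have : e = 5 * n by rewrite /n; field.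
by move=> -> /andP[? ?] /andP[? ?] /andP[? ?] ? ?; apply/andP; split; lra.
Qed.

End WeakConvergence.

(** * The normalized sums *)

Lemma cos_lipschitz (R : realType) (x y : R) : `|cos x - cos y| <= `|x - y|.
Proof.
wlog xy : x y / x <= y => [h|].
  by have [/h//|/ltW/h] := leP x y; rewrite distrC (distrC y).
have [z _ zE] := @MVT_segment R cos (fun z => - sin z) x y xy
  (fun z _ => is_derive_cos z) (continuous_subspaceT (@continuous_cos R)).
rewrite distrC zE normrM normrN (distrC x); exact: ler_piMl (normr_ge0 _) (sin_max z).
Qed.

Lemma expRN_lipschitz (R : realType) (x y : R) : 0 <= x -> 0 <= y ->
  `|expR (- x) - expR (- y)| <= `|x - y|.
Proof.
wlog xy : x y / x <= y => [h x0 y0|x0 _].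
  by have [/h|/ltW/h] := leP x y; [exact|rewrite distrC (distrC y); exact].
rewrite ger0_norm; last by rewrite subr_ge0 ler_expR lerN2.
rewrite distrC ger0_norm ?subr_ge0//.
have -> : expR (- y) = expR (- x) * expR (- (y - x)) by rewrite -expRD; congr expR; ring.
have e1 : expR (- x) <= 1 by rewrite -expR0 ler_expR oppr_le0.
have := expR_ge1Dx (- (y - x)); have := expR_gt0 (- x); nra.
Qed.

Section NormalizedSums.
Context {d : measure_display} {T : measurableType d} {R : realType}.
Variables (P : probability T R) (K : finFieldType) (f : {poly K} -> T -> R[i]).
Hypothesis f_steinhaus : steinhaus P f.

Let sum_re (c : R[i]) (B : {fset {poly K}}) w := \sum_(F <- B) complex.Re (c * f F w).

Lemma normalized_sum_combination (A : {fset {poly K}}) (a b : R) w :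
  a * complex.Re (normalized_sum A f w) + b * complex.Im (normalized_sum A f w) =
  sum_re ((a / Num.sqrt #|` A|%:R) +i* (- b / Num.sqrt #|` A|%:R))%C A w.
Proof.
rewrite /normalized_sum /sum_re reM imM re_sum im_sum/=.
rewrite [RHS](eq_bigr (fun F => (a / Num.sqrt #|` A|%:R) * complex.Re (f F w) +
  (b / Num.sqrt #|` A|%:R) * complex.Im (f F w))) => [|F _]; last by rewrite reM/=; ring.
by rewrite big_split/= -!mulr_sumr; ring.
Qed.

Lemma normalized_sum_measurable (A : {fset {poly K}}) : (forall F, F \in A -> F \is monic) ->
  complex_measurable (normalized_sum A f).
Proof.
move=> Amon; apply: complex_measurableM; first exact: complex_measurable_cst.
apply: complex_measurable_sum => F FA; exact: (steinhaus_complex_measurable f_steinhaus (Amon _ FA)).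
Qed.

Hypothesis f_unit : forall Q w, monic_irreducible Q -> sqnorm (f Q w) = 1.
Variables (A : {fset {poly K}}) (N : nat).
Hypotheses (N0 : (0 < N)%N) (A_monic : forall F, F \in A -> F \is monic /\ size F = N.+1)
  (A0 : (0 < #|` A|)%N).

Let n : R := #|` A|%:R.
Let n0 : 0 < n. Proof. by rewrite ltr0n. Qed.

Lemma sum_re_bounded_rv c (B : {fset {poly K}}) : (B `<=` A)%fset -> bounded_rv (sum_re c B).
Proof.
move=> /fsubsetP BA; apply: bounded_rv_sum => F /BA/A_monic[mF _].
by case: (steinhaus_bounded_rv f_steinhaus f_unit c mF).
Qed.

Lemma sum_re_second_moment c (B : {fset {poly K}}) : (B `<=` A)%fset ->
  \int[P]_w (sum_re c B w ^+ 2) <= sqnorm c * #|` B|%:R.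
Proof.
move=> /fsubsetP BA.
have mB F : F \in B -> F \is monic /\ (1 : {poly K}) \is monic.
  by move=> /BA/A_monic[mF _]; rewrite monic1.
have := steinhaus_second_moment f_steinhaus f_unit c mB.
under eq_Rintegral do under eq_bigr do rewrite (steinhaus_one f_steinhaus) conjc1 mulr1.
move/le_trans; apply; apply: ler_wpM2l; first by rewrite addr_ge0 ?sqr_ge0.
rewrite ler_nat -sum1_size.
rewrite big_seq [leqRHS]big_seq; apply: leq_sum => F FB.
apply: leq_trans (@sum_eq_le1 _ B F (fset_uniq B)).
rewrite big_seq [leqRHS]big_seq; apply: leq_sum => G GB.
rewrite !mulr1 mul1r (_ : (F * G == 1) = false) ?addn0 1?eq_sym//.
apply/negbTE/eqP => /(congr1 (fun q : {poly K} => (size q).-1)).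
have [mF sF] := A_monic (BA _ FB); have [mG sG] := A_monic (BA _ GB).
by rewrite monic_size_mul// sF size_poly1 /=; move: N0; lia.
Qed.

Let coef (a b : R) : R[i] := ((a / Num.sqrt n) +i* (- b / Num.sqrt n))%C.

Let sqnorm_coef a b : sqnorm (coef a b) = (a ^+ 2 + b ^+ 2) / n.
Proof.
have s0 : Num.sqrt n != 0 by rewrite gt_eqF// sqrtr_gt0.
rewrite /sqnorm/= -[in RHS](sqr_sqrtr (ltW n0)); field; exact: s0.
Qed.

Let re_coef w : complex.Re (normalized_sum A f w) = sum_re (coef 1 0) A w.
Proof. by rewrite -normalized_sum_combination mul1r mul0r addr0. Qed.

Let im_coef w : complex.Im (normalized_sum A f w) = sum_re (coef 0 1) A w.
Proof. by rewrite -normalized_sum_combination mul1r mul0r add0r. Qed.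

Lemma normalized_sum_bounded_rv :
  bounded_rv (fun w => complex.Re (normalized_sum A f w)) /\
  bounded_rv (fun w => complex.Im (normalized_sum A f w)).
Proof.
by split; [under eq_fun do rewrite re_coef|under eq_fun do rewrite im_coef];
  apply: sum_re_bounded_rv.
Qed.

Lemma normalized_sum_second_moment :
  \int[P]_w (complex.Re (normalized_sum A f w) ^+ 2) +
  \int[P]_w (complex.Im (normalized_sum A f w) ^+ 2) <= 2.
Proof.
have h a b : a ^+ 2 + b ^+ 2 = 1 -> \int[P]_w (sum_re (coef a b) A w ^+ 2) <= 1.
  move=> ab; apply: (le_trans (sum_re_second_moment _ (fsubset_refl A))).
  by rewrite sqnorm_coef ab mul1r mulVf// gt_eqF.
under eq_Rintegral do rewrite re_coef; under [X in _ + X <= _]eq_Rintegral do rewrite im_coef.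
by have -> : 2 = 1 + 1 :> R by []; apply: lerD; apply: h; rewrite ?expr1n expr0n ?addr0 ?add0r.
Qed.

Variables (S : {fset {poly K}}) (k : nat).
Hypothesis SA : (S `<=` A)%fset.
Let S' := regular k S.
Let S'A : (S' `<=` A)%fset. Proof. exact: fsubset_trans (regular_sub k S) SA. Qed.

Let sum_re_split c w : sum_re c A w = sum_re c S' w + sum_re c (A `\` S')%fset w.
Proof.
rewrite /sum_re (big_fsetID _ (fun F => F \in S'))/=; congr (_ + _); apply: eq_fbigl => F.
  by rewrite in_fset_filter andbC; case: (boolP (F \in S')) => // /(fsubsetP S'A)->.
by rewrite in_fset_filter in_fsetD andbC.
Qed.

Let card_split : n = #|` S'|%:R + #|` (A `\` S')%fset|%:R :> R.
Proof. by rewrite /n -natrD -(cardfsID S' A) (fsetIidPr S'A). Qed.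

Lemma normalized_sum_characteristic (r1 r2 : R) :
  #|` (A `\` S')%fset|%:R <= r1 * n ->
  4 * (#|` S'|%:R * (#|K|%:R ^+ N / #|K|%:R ^+ k.+1)) + 3 * #|` nontrivial_quadruples S|%:R
    <= r2 * n ^+ 2 ->
  forall a b t, `| \int[P]_w cos (a * complex.Re (normalized_sum A f w) +
      b * complex.Im (normalized_sum A f w) + t) -
    expR (- ((a ^+ 2 + b ^+ 2) / 4)) * cos t | <=
  Num.sqrt ((a ^+ 2 + b ^+ 2) * r1) + (a ^+ 2 + b ^+ 2) * Num.sqrt r2 +
  (a ^+ 2 + b ^+ 2) / 4 * r1.
Proof.
move=> h1 h2 a b t; set rho := a ^+ 2 + b ^+ 2; pose c := coef a b.
have rho0 : 0 <= rho by rewrite addr_ge0 ?sqr_ge0.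
have S'mon F : F \in S' -> F \is monic /\ size F = N.+1 by move=> /(fsubsetP S'A)/A_monic.
have /choice[p pP] (F : {poly K}) : exists Q, F \in S' ->
    [/\ monic_irreducible Q, Q %| F & (k < (size Q).-1)%N].
  have [/regularP[_ [Q QF] _]|nF] := boolP (F \in S'); first by exists Q.
  by exists 0.
have psq F G : F \in S' -> G \in S' -> ~~ (p F ^+ 2 %| G).
  by move=> /pP[[mp _] _ kp] /regularP[_ _ Gsq]; exact: Gsq.
have charS' := @steinhaus_characteristic_bound _ _ _ P K f f_steinhaus f_unit S' p N c N0
  S'mon (fun F FS => let: And3 irr _ _ := pP F FS in irr)
  (fun F FS => let: And3 _ dv _ := pP F FS in dv) psq t.
have bZ B : (B `<=` A)%fset -> bounded_rv (sum_re c B) by exact: sum_re_bounded_rv.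
have bC B : (B `<=` A)%fset -> bounded_rv (fun w => cos (sum_re c B w + t)).
  by move=> BA; apply/bounded_rv_cos/bounded_rvD; [exact: bZ|exact: bounded_rv_cst].
have DA : (A `\` S' `<=` A)%fset := fsubsetDl A S'.
have charA : `|\int[P]_w cos (sum_re c A w + t) - \int[P]_w cos (sum_re c S' w + t)| <=
    Num.sqrt (rho * r1).
  rewrite -(expectedB P (bC _ (fsubset_refl A)) (bC _ S'A)).
  apply: (@le_trans _ _ (\int[P]_w `|sum_re c (A `\` S')%fset w|)); first apply: norm_expected_le.
  - by apply: bounded_rvB; apply: bC.
  - exact/bounded_rv_norm/bZ.
  - move=> w; apply: (le_trans (cos_lipschitz _ _)); rewrite sum_re_split.
    by rewrite le_eqVlt; apply/orP; left; apply/eqP; congr `|_|; ring.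
  apply: (le_trans (expected_norm_le_sqrt _ (bZ _ DA))); apply: ler_wsqrtr.
  apply: (le_trans (sum_re_second_moment _ DA)); rewrite sqnorm_coef -/rho -mulrA.
  by apply: ler_wpM2l => //; rewrite mulrC ler_pdivrMr.
have charV : sqnorm c * Num.sqrt (4 * (size (prime_pairs S' p))%:R +
    3 * #|` nontrivial_quadruples S'|%:R) <= rho * Num.sqrt r2.
  rewrite sqnorm_coef -/rho -mulrA; apply: ler_wpM2l => //.
  rewrite mulrC ler_pdivrMr//.
  have -> : Num.sqrt r2 * n = Num.sqrt (r2 * n ^+ 2).
    by rewrite [in RHS]mulrC sqrtrM ?sqr_ge0// sqrtr_sqr ger0_norm ?ltW// mulrC.
  apply/ler_wsqrtr/(le_trans _ h2); apply: lerD; last first.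
    by rewrite ler_pM2l// ler_nat; apply: nontrivial_quadruplesS; exact: regular_sub.
  have q0 : 0 < #|K|%:R :> R by rewrite ltr0n; apply/card_gt0P; exists 0.
  rewrite ler_pM2l// mulrA ler_pdivlMr ?exprn_gt0// -!natrX -!natrM ler_nat.
  by apply: size_prime_pairs_le => // F /pP[[mp _] _ kp].
have charE : `|expR (- (sqnorm c * #|` S'|%:R / 2) / 2) * cos t - expR (- (rho / 4)) * cos t| <=
    rho / 4 * r1.
  rewrite -mulrBl normrM -[leRHS]mulr1; apply: ler_pM => //; last exact: cos_max.
  rewrite mulNr; apply: (le_trans (expRN_lipschitz _ _)).
  - by rewrite sqnorm_coef -/rho !mulr_ge0// invr_ge0 ltW.
  - by rewrite mulr_ge0.
  have -> : sqnorm c * #|` S'|%:R / 2 / 2 - rho / 4 = - (rho / 4 * (#|` (A `\` S')%fset|%:R / n)).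
    have -> : #|` (A `\` S')%fset|%:R = n - #|` S'|%:R by rewrite card_split; ring.
    by rewrite sqnorm_coef -/rho; field; exact: lt0r_neq0.
  have A'0 : 0 <= #|` (A `\` S')%fset|%:R / n := divr_ge0 (ler0n R _) (ltW n0).
  have r40 : 0 <= rho / 4 by rewrite divr_ge0.
  by rewrite normrN (ger0_norm (mulr_ge0 r40 A'0)) ler_wpM2l// ler_pdivrMr.
under eq_Rintegral do rewrite normalized_sum_combination.
have ->: \int[P]_w cos (sum_re (coef a b) A w + t) - expR (- (rho / 4)) * cos t =
  (\int[P]_w cos (sum_re c A w + t) - \int[P]_w cos (sum_re c S' w + t)) +
  (\int[P]_w cos (sum_re c S' w + t) - expR (- (sqnorm c * #|` S'|%:R / 2) / 2) * cos t) +
  (expR (- (sqnorm c * #|` S'|%:R / 2) / 2) * cos t - expR (- (rho / 4)) * cos t) by rewrite /c; ring.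
apply: (le_trans (ler_normD _ _)); apply: lerD => //.
apply: (le_trans (ler_normD _ _)); apply: lerD => //.
exact: (le_trans charS').
Qed.

End NormalizedSums.

Section ExceptionalRatios.
Variables (R : realType) (K : finFieldType) (A S : {fset {poly K}}) (N : nat) (c : R).
Local Notation q := #|K|.
Let L : R := Num.sqrt (N%:R * ln q%:R).
Let n : R := #|` A|%:R.
Let s : R := #|` S|%:R.
Let E : R := expR (- (L / 24)).
Hypotheses (N0 : (0 < N)%N) (q1 : (1 < q)%N) (c0 : 0 < c)
  (A_monic : forall F, F \in A -> F \is monic /\ size F = N.+1)
  (A_large : c * (q%:R ^+ N * expR (- (3^-1 * L))) <= n)
  (SA : (S `<=` A)%fset) (S_large : n <= 2 * s).

Let q0 : 0 < q%:R :> R. Proof. by rewrite ltr0n ltnW. Qed.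
Let qN0 : 0 < q%:R ^+ N :> R. Proof. by rewrite exprn_gt0. Qed.
Let n0 : 0 < n.
Proof. by apply: lt_le_trans A_large; rewrite !mulr_gt0// expR_gt0. Qed.
Let s0 : 0 < s. Proof. by move: n0 S_large; lra. Qed.
Let L0 : 0 <= L. Proof. exact: sqrtr_ge0. Qed.

Let level_le : q%:R ^+ N * expR (- (3 / 8 * L)) <= n * (E / c).
Proof.
have -> : expR (- (3 / 8 * L)) = expR (- (3^-1 * L)) * E.
  by rewrite /E -expRD; congr expR; field.
rewrite mulrA [leRHS]mulrCA mulrC ler_pM2l ?expR_gt0// ler_pdivlMr// mulrC.
exact: A_large.
Qed.

Let inv_card_le : n^-1 <= E / c.
Proof.
have L2 : L ^+ 2 = N%:R * ln q%:R.
  by rewrite sqr_sqrtr// mulr_ge0// ln_ge0// ler1n ltnW.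
have qE : q%:R ^+ N = expR (L ^+ 2) :> R by rewrite L2 expRM_natl lnK.
have L23 : 2 / 3 <= L ^+ 2.
  rewrite L2 -[leLHS]mul1r; apply: ler_pM => //; first by rewrite ler1n.
  by apply: (le_trans (ln2_ge R)); rewrite ler_ln ?posrE// ler_nat.
have cE : c <= n * E.
  have : c * (q%:R ^+ N * expR (- (3^-1 * L))) * E <= n * E by rewrite ler_wpM2r// expR_ge0.
  apply: le_trans; rewrite qE /E -expRD -mulrA -expRD -[leLHS]mulr1 ler_pM2l//.
  by rewrite -[leLHS]expR0 ler_expR; nra.
by rewrite ler_pdivlMr// mulrC ler_pdivrMr// mulrC.
Qed.

Lemma exceptional_ratios : exists k,
  #|` (A `\` regular k S)%fset|%:R <= ((1 - s / n) + (expR 1 + 2) * (E / c)) * n /\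
  4 * (#|` regular k S|%:R * (q%:R ^+ N / q%:R ^+ k.+1)) + 3 * #|` nontrivial_quadruples S|%:R <=
  (4 * (E / c) + 3 * ((#|` multiplicative_quadruples S|%:R / s ^+ 2 - 2) + 2 * (E / c))) * n ^+ 2.
Proof.
have [k [kq ksm]] := smoothness_level (R := R) N0 q1; exists k.
have kn := le_trans kq level_le.
have sn : s <= n by rewrite ler_nat; exact: fsubset_leq_card.
have S_monic F : F \in S -> F \is monic /\ size F = N.+1 by move=> /(fsubsetP SA)/A_monic.
split.
  have irr : #|` (S `\` regular k S)%fset|%:R <= (expR 1 + 2) * (n * (E / c)).
    have := card_irregular k S_monic; rewrite -(ler_nat R) => /le_trans; apply.
    rewrite natrD [leRHS]mulrDl; apply: lerD.
      apply: (le_trans ksm); rewrite expRD mulrCA; apply: ler_wpM2l; first exact: expR_ge0.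
      exact: level_le.
    by apply: (le_trans (card_squareful_le k N q1)); rewrite ler_pM2l.
  have cA : n = #|` regular k S|%:R + #|` (A `\` regular k S)%fset|%:R.
    by rewrite /n -natrD -(cardfsID (regular k S) A) (fsetIidPr (fsubset_trans (regular_sub k S) SA)).
  have cS : s = #|` regular k S|%:R + #|` (S `\` regular k S)%fset|%:R.
    by rewrite /s -natrD -(cardfsID (regular k S) S) (fsetIidPr (regular_sub k S)).
  have -> : #|` (A `\` regular k S)%fset|%:R = n - #|` regular k S|%:R by rewrite cA; ring.
  rewrite mulrDl mulrBl mul1r divfK ?gt_eqF// -mulrA (mulrC _ n).
  by move: irr cS; lra.
have NT : #|` nontrivial_quadruples S|%:R <=
    ((#|` multiplicative_quadruples S|%:R / s ^+ 2 - 2) + 2 * (E / c)) * n ^+ 2.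
  set t := (X in X * _).
  have ts : #|` nontrivial_quadruples S|%:R <= t * s ^+ 2.
    have h : #|` nontrivial_quadruples S|%:R + 2 * s ^+ 2 <=
        #|` multiplicative_quadruples S|%:R + s.
      by rewrite /s -natrX -natrM -!natrD ler_nat; exact: card_nontrivial_quadruples.
    rewrite /t mulrDl mulrBl divfK ?expf_neq0 ?gt_eqF//.
    have : s <= 2 * (E / c) * s ^+ 2.
      have : n^-1 * s ^+ 2 <= E / c * s ^+ 2 by rewrite ler_wpM2r ?sqr_ge0.
      have : s <= 2 * (n^-1 * s ^+ 2).
        by rewrite [_^-1 * _]mulrC mulrA ler_pdivlMr//; move: s0 S_large; nra.
      lra.
    by move: h; rewrite -/s; lra.
  have t0 : 0 <= t by rewrite -(pmulr_lge0 t (exprn_gt0 2 s0)) (le_trans _ ts).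
  by apply: (le_trans ts); rewrite ler_wpM2l// ler_pXn2r// nnegrE ltW.
rewrite [leRHS]mulrDl; apply: lerD; rewrite -[leRHS]mulrA ler_pM2l//.
rewrite [leRHS]mulrC expr2 -mulrA; apply: ler_pM => //.
by rewrite ler_nat; apply/fsubset_leq_card/(fsubset_trans (regular_sub k S) SA).
Qed.

End ExceptionalRatios.

Section Modification.
Context {d : measure_display} {T : measurableType d} {R : realType}.
Variables (P : probability T R) (K : finFieldType) (f : {poly K} -> T -> R[i]).
Hypothesis f_steinhaus : steinhaus P f.
Variable A : {fset {poly K}}.
Hypothesis A_monic : forall F, F \in A -> F \is monic.

Lemma normalized_sum_unit_modification : exists f' : {poly K} -> T -> R[i],
  [/\ steinhaus P f', forall Q w, monic_irreducible Q -> sqnorm (f' Q w) = 1 &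
  forall g B, continuous g -> (forall z, `|g z| <= B) ->
  (\int[P]_w (g (coords (normalized_sum A f w)))%:E =
   (\int[P]_w g (complex.Re (normalized_sum A f' w), complex.Im (normalized_sum A f' w)))%:E)%E].
Proof.
have [f' [N [f'_st f'_unit mN PN ff']]] := steinhaus_unit_modification f_steinhaus.
exists f'; split => // g B cg gB.
have b h : steinhaus P h -> bounded_rv (fun w => g (coords (normalized_sum A h w))).
  move=> h_st; have [m1 m2] := normalized_sum_measurable h_st A_monic.
  exact: (continuous_bounded_rv m1 m2 cg gB).
rewrite /Rintegral fineK; last first.
  apply: integrable_fin_num => //; exact: bounded_rv_integrable (b _ f'_st).
apply: ae_eq_integral => //.
- exact: (measurable_int P (bounded_rv_integrable P (b _ f_steinhaus))).
- exact: (measurable_int P (bounded_rv_integrable P (b _ f'_st))).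
exists N; split => // w /= nw; apply: contrapT => nN; apply: nw => _.
rewrite /normalized_sum; congr (g (coords (_ * _)))%:E.
by apply: eq_bigr => F _; rewrite ff'.
Qed.

End Modification.

Lemma qN_infty_filter : Filter qN_infty.
Proof.
apply: filter_from_filter; first by exists 0%N.
move=> i j _ _; exists (maxn i j) => // -[q N] [/= ppq N1].
by rewrite geq_max => /andP[iq jq]; split; split.
Qed.

Lemma prime_power_gt1 q : prime_power q -> (1 < q)%N.
Proof.
move=> [p [k [pp k0 ->]]]; apply: leq_trans (prime_gt1 pp) _.
by rewrite -{1}[p]expn1 leq_pexp2l// prime_gt0.
Qed.

Lemma cvg_exp_sqrt_log (R : realType) :
  expR (- (Num.sqrt (x.2%:R * ln x.1%:R) / 24)) @[x --> qN_infty] --> (0 : R).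
Proof.
have FF := qN_infty_filter.
apply/cvgrPdist_le => /= e e0; pose y := 24 / e.
have y0 : 0 < y by rewrite divr_gt0.
exists (Num.truncn (expR (y ^+ 2))).+1 => // -[q N] [/= /prime_power_gt1 q1 N1 qN].
have q0 : 0 < q%:R :> R by rewrite ltr0n ltnW.
have yL : y <= Num.sqrt (N%:R * ln q%:R).
  rewrite -[leLHS](ger0_norm (ltW y0)) -sqrtr_sqr; apply: ler_wsqrtr.
  rewrite -ler_expR expRM_natl lnK// -natrX; apply: ltW.
  apply: lt_le_trans (_ : (Num.truncn (expR (y ^+ 2))).+1%:R <= _); last by rewrite ler_nat.
  exact: truncnS_gt.
rewrite sub0r normrN ger0_norm ?expR_ge0// expRN.
set L := Num.sqrt _ in yL *.
rewrite -[leRHS]invrK lef_pV2 ?posrE ?invr_gt0 ?expR_gt0//.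
apply: (le_trans _ (expR_ge1Dx _)).
have -> : e^-1 = y / 24 by rewrite /y; field; exact: lt0r_neq0.
by move: yL; lra.
Qed.

Theorem theorem1p1 (R : realType)
  (K : nat -> finFieldType)
  (cardK : forall q, prime_power q -> #|K q| = q)
  (A S : forall q : nat, nat -> {fset {poly K q}})
  (A_monic_degree : forall q N, prime_power q -> (1 <= N)%N ->
     forall Q, Q \in A q N -> Q \is monic /\ size Q = N.+1)
  (c : R) (c_gt0 : 0 < c)
  (A_large : forall q N, prime_power q -> (1 <= N)%N ->
     c * (q%:R ^+ N * expR (- (3^-1 * Num.sqrt (N%:R * ln q%:R))))
       <= #|` A q N|%:R)
  (S_sub_A : forall q N, prime_power q -> (1 <= N)%N ->
     (S q N `<=` A q N)%fset)
  (S_card : (#|` S x.1 x.2|%:R / #|` A x.1 x.2|%:R : R) @[x --> qN_infty] --> (1 : R))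
  (S_quadruples :
     (#|` multiplicative_quadruples (S x.1 x.2)|%:R / #|` S x.1 x.2|%:R ^+ 2 : R)
       @[x --> qN_infty] --> (2 : R))
  (d : nat -> measure_display) (T : forall q, measurableType (d q))
  (P : forall q, probability (T q) R)
  (f : forall q, {poly K q} -> T q -> R[i])
  (f_steinhaus : forall q, prime_power q -> steinhaus (P q) (f q)) :
  cvg_in_distribution qN_infty (fun x : nat * nat => P x.1)
    (fun x => normalized_sum (A x.1 x.2) (f x.1)) CN01.
Proof.
have FF := qN_infty_filter.
pose E (x : nat * nat) : R := expR (- (Num.sqrt (x.2%:R * ln x.1%:R) / 24)).
pose r1 x := (1 - #|` S x.1 x.2|%:R / #|` A x.1 x.2|%:R) + (expR 1 + 2) * (E x / c).
pose r2 x := 4 * (E x / c) + 3 * ((#|` multiplicative_quadruples (S x.1 x.2)|%:R /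
  #|` S x.1 x.2|%:R ^+ 2 - 2) + 2 * (E x / c)).
have E0 : E x / c @[x --> qN_infty] --> (0 : R).
  by rewrite -[0](mul0r c^-1); apply: cvgMl; exact: cvg_exp_sqrt_log.
have r10 : r1 x @[x --> qN_infty] --> (0 : R).
  rewrite [X in _ --> X](_ : 0 = (1 - 1) + (expR 1 + 2) * 0); last by ring.
  apply: cvgD; last exact: cvgMr.
  by apply: cvgB => //; exact: cvg_cst.
have r20 : r2 x @[x --> qN_infty] --> (0 : R).
  rewrite [X in _ --> X](_ : 0 = 4 * 0 + 3 * ((2 - 2) + 2 * 0)); last by ring.
  apply: cvgD; apply: cvgMr => //.
  apply: cvgD; last exact: cvgMr.
  by apply: cvgB => //; exact: cvg_cst.
pose err (a b : R) x := Num.sqrt ((a ^+ 2 + b ^+ 2) * r1 x) +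
  (a ^+ 2 + b ^+ 2) * Num.sqrt (r2 x) + (a ^+ 2 + b ^+ 2) / 4 * r1 x.
have err0 a b : err a b x @[x --> qN_infty] --> (0 : R).
  have sqrt0 (u : nat * nat -> R) : u x @[x --> qN_infty] --> (0 : R) ->
      Num.sqrt (u x) @[x --> qN_infty] --> (0 : R).
    by move=> u0; have := cvg_comp _ _ u0 (@sqrt_continuous R 0); rewrite sqrtr0.
  rewrite [X in _ --> X](_ : 0 = 0 + (a ^+ 2 + b ^+ 2) / 4 * 0); last by ring.
  apply: cvgD; last exact: cvgMr.
  rewrite [X in _ --> X](_ : 0 = 0 + (a ^+ 2 + b ^+ 2) * 0); last by ring.
  apply: cvgD; last by apply: cvgMr; exact: sqrt0.
  by apply: sqrt0; rewrite -(mulr0 (a ^+ 2 + b ^+ 2)); exact: cvgMr.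
have dom : \forall x \near qN_infty, prime_power x.1 /\ (1 <= x.2)%N.
  by exists 0%N => // x [? ? _].
have large : \forall x \near qN_infty, `|1 - #|` S x.1 x.2|%:R / #|` A x.1 x.2|%:R| <= 2^-1 :> R.
  by have /cvgrPdist_le := S_card; apply; rewrite invr_gt0.
move=> g cg gB.
apply: (near_CN01_weak_convergence (P := fun x => P x.1) err0
  (U := fun x g => (\int[P x.1]_w (g (coords (normalized_sum (A x.1 x.2) (f x.1) w)))%:E)%E)) => //.
apply: filterS (filterI dom large) => -[q N] [[/= ppq N0]] SA2.
have q1 := prime_power_gt1 ppq; have cK := cardK _ ppq.
have Amon := A_monic_degree _ _ ppq N0; have SA := S_sub_A _ _ ppq N0.
have Al := A_large _ _ ppq N0; rewrite -{1 2}cK in Al.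
have Kq1 : (1 < #|K q|)%N by rewrite cK.
have A0 : 0 < #|` A q N|%:R :> R.
  by apply: lt_le_trans Al; rewrite !mulr_gt0// ?exprn_gt0 ?expR_gt0// ltr0n ltnW.
have SA' : #|` A q N|%:R <= 2 * #|` S q N|%:R :> R.
  move: SA2; rewrite ler_norml => /andP[_]; rewrite lerBlDr -lerBlDl => h.
  have : (1 - 2^-1) * #|` A q N|%:R <= #|` S q N|%:R :> R by rewrite -ler_pdivlMr.
  by lra.
have [k [h1 h2]] := exceptional_ratios N0 Kq1 c_gt0 Amon Al SA SA'.
rewrite [#|K q|]cK in h1 h2.
have Am F : F \in A q N -> F \is monic by move=> /Amon[].
have [f' [f'st f'u f'E]] := normalized_sum_unit_modification (f_steinhaus _ ppq) Am.
have A0' : (0 < #|` A q N|)%N by rewrite -(ltr0n R).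
have [bX bY] := normalized_sum_bounded_rv f'st f'u Amon.
exists (fun w => complex.Re (normalized_sum (A q N) f' w)),
  (fun w => complex.Im (normalized_sum (A q N) f' w)); split.
  split; [exact: bX|exact: bY|exact: (normalized_sum_second_moment f'st f'u N0 Amon A0')|].
  move=> a b t; apply: (normalized_sum_characteristic f'st f'u N0 Amon A0' SA h1).
  by rewrite [#|K q|]cK.
by move=> g' cg' [B g'B]; exact: f'E cg' g'B.
Qed.
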